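(* Consider the thermostatted Kac master equation on $\mathbb{R}^N$ described in the context. There exists a steady state $F_N$ of this equation (a probability distribution on $\mathbb{R}^N$ with $\mathcal{L}[F_N]=0$); it is unique, and its moments of order up to $2$ coincide with those of $g^{\otimes N}$.
   Context: Fix an integer $N\ge 2$, rates $\lambda>0$, $\mu>0$, and a probability density $g$ on $\mathbb{R}$ with $g\in L^2$, $\int w\,g(w)\,dw=0$ and finite second moment $K_g=\int w^2 g(w)\,dw$. For $v\in\mathbb{R}^N$, $\theta\in[0,2\pi]$, $w\in\mathbb{R}$: $v_{ij}(\theta)$ ($i<j$) is obtained from $v$ by replacing $v_i$ with $v_i\cos\theta+v_j\sin\theta$ and $v_j$ with $-v_i\sin\theta+v_j\cos\theta$; $v_j(w,\theta)$ is obtained from $v$ by replacing $v_j$ with $v_j\cos\theta+w\sin\theta$; and $w_j^*=w\cos\theta-v_j\sin\theta$. Define $Q[F](v)=\binom{N}{2}^{-1}\sum_{i<j}\frac{1}{2\pi}\int_0^{2\pi}F(v_{ij}(\theta))\,d\theta$ and $R_j[F](v)=\int_{\mathbb{R}}\frac{1}{2\pi}\int_0^{2\pi} g(w_j^* )F(v_j(w,\theta))\,d\theta\,dw$. The master equation is $\partial_t F_N=\mathcal{L}[F_N]:=-\lambda N(I-Q)[F_N]-\mu\sum_{j=1}^N(I-R_j)[F_N]$. *)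

(* Defs.v *)
From HB Require Import structures.
From mathcomp Require Import all_boot all_order all_algebra.
From mathcomp Require Import all_classical all_reals all_analysis.
Set Implicit Arguments. Unset Strict Implicit. Unset Printing Implicit Defensive.
Import Order.TTheory GRing.Theory Num.Theory.
Import numFieldNormedType.Exports.
Local Open Scope classical_set_scope.
Local Open Scope ring_scope.

(* R^n is represented by n.-tuple R, which carries the library's product
   (Borel) sigma-algebra.  The n-dimensional Lebesgue integral of a
   nonnegative function is given by the iterated (Tonelli) integral against
   one-dimensional Lebesgue measure, integrating the first coordinate last. *)
Fixpoint iint {R : realType} (n : nat) : (n.-tuple R -> \bar R) -> \bar R :=
  match n with
  | 0 => fun f => f [tuple]
  | n'.+1 => fun f =>
      (\int[@lebesgue_measure R]_x iint (fun t : n'.-tuple R => f (cons_tuple x t)))%E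
  end.

Section Defs.
Context {R : realType} {n : nat}.

Definition null_Rn (A : set (n.-tuple R)) : Prop :=
  measurable A /\ iint (fun v => (\1_A v)%:E) = 0%E.
Definition ae_Rn (P : n.-tuple R -> Prop) : Prop :=
  exists A, null_Rn A /\ forall v, ~ A v -> P v.

Definition integrable_Rn (f : n.-tuple R -> R) : Prop :=
  measurable_fun setT f /\ (iint (fun v => (`|f v|)%:E) < +oo)%E.
Definition integral_Rn (f : n.-tuple R -> R) : R :=
  fine (iint (fun v => (Num.max (f v) 0)%:E))
  - fine (iint (fun v => (Num.max (- f v) 0)%:E)).

Definition is_densityN (F : n.-tuple R -> R) : Prop :=
  [/\ measurable_fun setT F, forall v, 0 <= F v
    & iint (fun v => (F v)%:E) = 1%E].

Definition gtensor (g : R -> R) (v : n.-tuple R) : R := \prod_(i < n) g (tnth v i).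

Definition rot_pair (i j : 'I_n) (th : R) (v : n.-tuple R) : n.-tuple R :=
  [tuple (if k == i then tnth v i * cos th + tnth v j * sin th
          else if k == j then - tnth v i * sin th + tnth v j * cos th
          else tnth v k) | k < n].

Definition rot_res (j : 'I_n) (w th : R) (v : n.-tuple R) : n.-tuple R :=
  [tuple (if k == j then tnth v j * cos th + w * sin th else tnth v k) | k < n].

Definition wstar (j : 'I_n) (w th : R) (v : n.-tuple R) : R :=
  w * cos th - tnth v j * sin th.

Definition angles : set R := `[0%R, (2 * pi)%R].

Definition Qop (F : n.-tuple R -> R) (v : n.-tuple R) : R :=
  ('C(n, 2)%:R)^-1 *
  \sum_(i < n) \sum_(j < n | (i < j)%N)
    (2 * pi)^-1 * Rintegral (@lebesgue_measure R) angles (fun th => F (rot_pair i j th v)).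

Definition Rop (g : R -> R) (j : 'I_n) (F : n.-tuple R -> R) (v : n.-tuple R) : R :=
  fine (\int[@lebesgue_measure R]_w
          \int[@lebesgue_measure R]_(th in angles)
             ((2 * pi)^-1 * (g (wstar j w th v) * F (rot_res j w th v)))%:E)%E.

Definition Lop (lam mu : R) (g : R -> R) (F : n.-tuple R -> R) (v : n.-tuple R) : R :=
  - (lam * n%:R) * (F v - Qop F v) - mu * \sum_(j < n) (F v - Rop g j F v).

Definition steady_state (lam mu : R) (g : R -> R) (F : n.-tuple R -> R) : Prop :=
  is_densityN F /\ ae_Rn (fun v => Lop lam mu g F v = 0).

End Defs.

(* Main.v *)
(* Write [L F = (la + mu) N (A F - F)] with [A] a Markov operator on densities,
   whose dual [B] averages observables over one random collision: a density is
   steady iff it is almost everywhere [A]-invariant.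

   The power [A ^ N] satisfies Doeblin's condition on the energy balls: with
   positive probability the N particles meet the reservoir one after the other,
   and each such collision spreads the velocity over an interval, because the
   angle is uniform and [g] charges some [{ b <= |w| <= C }]; this minorizes the
   law of the result by a multiple of Lebesgue measure on a box.  The energy
   contracts under [B] up to a constant.  Nummelin splitting then produces an
   invariant density of finite energy: subtracting the minorizing part at each
   step turns it into the series of expected occupations of a regeneration
   cycle.  The minimum of two invariant densities is again invariant; what exceeds
   it on either side is a pair of disjointly supported invariant functions,
   which the minorization forces to vanish.  By this uniqueness an [A ^ N]-invariant
   density [F] is [A]-invariant, since [A F] is [A ^ N]-invariant too.

   For the moments, [B] maps the squares [(x0 + x1 v_k + x2 v_l) ^ 2] to
   combinations of such squares and of the [v_i ^ 2]; testing invariance against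
   them gives linear equations which the reservoir makes strictly contracting,
   so the first and second moments are those of [g].

   Invariance of Lebesgue measure under a plane rotation, which gives the
   duality of [A] and [B], is reduced to translation invariance by writing the
   rotation as a product of shears. *)

Require Import Defs.
From HB Require Import structures.
From mathcomp Require Import all_boot all_order all_algebra.
From mathcomp Require Import all_classical all_reals all_analysis.
From mathcomp Require Import measurable_realfun lra ring.
Set Implicit Arguments. Unset Strict Implicit. Unset Printing Implicit Defensive.
Import Order.TTheory GRing.Theory Num.Theory.
Import numFieldNormedType.Exports.
Local Open Scope classical_set_scope.
Local Open Scope ring_scope.

(** * Nonnegative measurable functions *)

(** Densities and observables take values in [[0, +oo]]: every integral exists and Tonelli applies
    without side conditions. The price is that the abstract part knows an operator only through its
    integrals against observables, so that additivity, monotonicity and invariance are statements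
    almost everywhere, obtained by testing.

    One step cannot satisfy the minorization: from a fixed point, a collision leads to finitely many
    circles and lines, a null set as soon as [N >= 2]; every coordinate must be refreshed once. The
    resulting lower bound decays with the initial speeds, because a fast particle sweeps a given
    interval quickly. It is therefore uniform only on energy balls, and the energy serves as
    Lyapunov function to bring mass back to them.

    Uniqueness has to cover competitors of infinite energy, so it is drawn from the minorization
    alone; finite energy comes with the density that is constructed, and makes its moments
    meaningful. The moments are read off squares because the duality concerns nonnegative
    observables; polarization then recovers the linear and mixed terms. *)

Section nonneg_measurable.
Context d (T : measurableType d) (R : realType).
Local Open Scope ereal_scope.

Definition nnm (f : T -> \bar R) :=
  measurable_fun setT f /\ forall x, 0 <= f x.

Lemma nnmD f h : nnm f -> nnm h -> nnm (fun x => f x + h x).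
Proof.
by move=> [mf f0] [mh h0]; split; [exact: emeasurable_funD|move=> x; exact: adde_ge0].
Qed.

Lemma nnmM f h : nnm f -> nnm h -> nnm (fun x => f x * h x).
Proof.
by move=> [mf f0] [mh h0]; split; [exact: emeasurable_funM|move=> x; exact: mule_ge0].
Qed.

Lemma nnm_cst (c : \bar R) : 0 <= c -> nnm (fun=> c).
Proof. by move=> c0; split => //; exact: measurable_cst. Qed.

Lemma nnmZ c f : 0 <= c -> nnm f -> nnm (fun x => c * f x).
Proof. by move=> c0 ?; apply: nnmM => //; exact: nnm_cst. Qed.

Lemma nnm_EFin (f : T -> R) : measurable_fun setT f -> (forall x, (0 <= f x)%R) ->
  nnm (fun x => (f x)%:E).
Proof.
by move=> mf f0; split; [exact/measurable_EFinP|move=> x; rewrite lee_fin].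
Qed.

Lemma nnm_indic (A : set T) : measurable A -> nnm (fun x => (\1_A x)%:E).
Proof.
move=> mA; apply: nnm_EFin => [|x]; first exact: measurable_indic.
by rewrite indicE.
Qed.

Lemma nnm_series (f : nat -> T -> \bar R) : (forall k, nnm (f k)) ->
  nnm (fun x => \sum_(0 <= k <oo) f k x).
Proof.
move=> nf; split => [|x].
  by apply: (@ge0_emeasurable_sum _ _ _ setT f xpredT) => [k x _ _|k _]; apply nf.
by apply: nneseries_ge0 => k _ _; apply nf.
Qed.

Lemma nnm_sum (I : Type) (s : seq I) (Q : pred I) (f : I -> T -> \bar R) :
  (forall i, Q i -> nnm (f i)) -> nnm (fun x => \sum_(i <- s | Q i) f i x).
Proof.
move=> nf; split => [|x]; last by apply: sume_ge0 => i /nf[_]; exact.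
rewrite (_ : (fun x => _) = (fun x => \sum_(i <- s) if Q i then f i x else 0)).
  apply: emeasurable_sum => i; case: (boolP (Q i)) => [/nf[]//|_].
  exact: measurable_cst.
by apply/funext => x; rewrite big_mkcond.
Qed.

Variable m : {measure set T -> \bar R}.

Lemma nnm_integralZ c f : 0 <= c -> nnm f ->
  \int[m]_x (c * f x) = c * \int[m]_x f x.
Proof. by move=> c0 [mf f0]; rewrite ge0_integralZl. Qed.

Lemma nnm_integralD f h : nnm f -> nnm h ->
  \int[m]_x (f x + h x) = \int[m]_x f x + \int[m]_x h x.
Proof. by move=> [mf f0] [mh h0]; rewrite ge0_integralD. Qed.

Lemma nnm_integral_sum (I : Type) (s : seq I) (Q : pred I) (f : I -> T -> \bar R) :
  (forall i, Q i -> nnm (f i)) ->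
  \int[m]_x (\sum_(i <- s | Q i) f i x) = \sum_(i <- s | Q i) \int[m]_x f i x.
Proof.
move=> nf; elim: s => [|i s IH].
  by rewrite big_nil; apply: integral0_eq => x _; rewrite big_nil.
rewrite big_cons; under eq_integral do rewrite big_cons.
case: (boolP (Q i)) => // Qi; rewrite -IH -nnm_integralD//; first exact: nf.
exact: nnm_sum.
Qed.

Lemma nnm_integral_ge0 f : nnm f -> 0 <= \int[m]_x f x.
Proof. by move=> [_ f0]; apply: integral_ge0. Qed.

Lemma nnm_le_integral f h : nnm f -> nnm h -> (forall x, f x <= h x) ->
  \int[m]_x f x <= \int[m]_x h x.
Proof. by move=> [mf f0] [mh h0] fh; apply: ge0_le_integral. Qed.

Lemma nnm_ae_eq_integral f h : nnm f -> nnm h -> {ae m, forall x, f x = h x} ->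
  \int[m]_x f x = \int[m]_x h x.
Proof.
move=> [mf f0] [mh h0] fh; apply: ge0_ae_eq_integral => //.
by apply: filterS fh => x /= ->.
Qed.

Lemma nnm_ae_fin f : nnm f -> \int[m]_x f x < +oo -> {ae m, forall x, f x \is a fin_num}.
Proof.
move=> [mf f0] foo.
suff: {ae m, forall x, setT x -> f x \is a fin_num} by apply: filterS => x /=; exact.
apply: integrable_ae => //; apply/integrableP; split => //.
by under eq_integral do rewrite gee0_abs//.
Qed.

Lemma integral_indicE f (A : set T) : measurable A ->
  \int[m]_(x in A) f x = \int[m]_x ((\1_A x)%:E * f x).
Proof.
move=> mA; rewrite integral_mkcond; apply: eq_integral => x _.
by rewrite patchE indicE; case: ifP => _; rewrite ?mul1e ?mul0e.
Qed.

(** The inequality integrates to the same direction on a set [E] and on its complement; as the total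
    of [k] does not exceed that of [u], cancelling the finite contribution of the complement gives
    equality on every [E]. *)
Lemma nnm_le_ae_eq u k : nnm u -> nnm k -> {ae m, forall x, u x <= k x} ->
  \int[m]_x k x <= \int[m]_x u x -> \int[m]_x u x < +oo ->
  {ae m, forall x, u x = k x}.
Proof.
move=> nu nk uk ku uoo.
suff: {ae m, forall x, setT x -> u x = k x} by apply: filterS => x /=; exact.
have [[mu u0] [mk k0]] := (nu, nk).
apply: integral_ae_eq => //.
  apply/integrableP; split => //.
  by under eq_integral do rewrite gee0_abs//.
move=> E _ mE.
have H f : nnm f -> \int[m]_x f x = \int[m]_(x in E) f x + \int[m]_(x in ~` E) f x.
  move=> [mf f0]; rewrite -(setUv E) ge0_integral_setU//.
  - exact: measurableC.
  - by rewrite setUv.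
  - by apply/disj_set2P; rewrite setICr.
have le A : measurable A -> \int[m]_(x in A) u x <= \int[m]_(x in A) k x.
  move=> mA; apply: ae_ge0_le_integral => //.
  - exact: measurable_funS mu.
  - exact: measurable_funS mk.
  - by apply: filterS uk => x.
have mEC := measurableC mE.
have finA A : measurable A -> \int[m]_(x in A) u x \is a fin_num.
  move=> mA; rewrite ge0_fin_numE; last exact: integral_ge0.
  apply: le_lt_trans uoo; exact: ge0_subset_integral.
apply/eqP; rewrite eq_le le//=.
move: ku; rewrite (H _ nu) (H _ nk) => ku.
rewrite -(leeD2rE _ _ (finA _ mEC)) (le_trans _ ku)//.
by rewrite leeD2l// le.
Qed.

(** Testing with the indicator of [E = {u < h}] shows that the maximum of [u] and [h], written as
    [h] on [E] and [u] off [E], has no more mass than [u]; hence it equals [u] almost everywhere.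
    This is how weak inequalities become pointwise ones. *)
Lemma test_le_ae u h : nnm u -> nnm h -> \int[m]_x u x < +oo ->
  (forall phi, nnm phi -> \int[m]_x (phi x * h x) <= \int[m]_x (phi x * u x)) ->
  {ae m, forall x, h x <= u x}.
Proof.
move=> nu nh uoo test; have [[mu u0] [mh h0]] := (nu, nh).
pose E := [set x | u x < h x].
have mE : measurable E.
  by rewrite -[E]setTI; exact: measurable_lte.
have mEC := measurableC mE.
have nk : nnm (fun x => (\1_E x)%:E * h x + (\1_(~` E) x)%:E * u x).
  by apply: nnmD; apply: nnmM => //; exact: nnm_indic.
have uk x : u x <= (\1_E x)%:E * h x + (\1_(~` E) x)%:E * u x.
  rewrite !indicE in_setC; case: (boolP (x \in E)) => [/set_mem /ltW|_] //=.
    by rewrite mul1e mul0e adde0.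
  by rewrite mul1e mul0e add0e.
have uE : \int[m]_x u x = \int[m]_x ((\1_E x)%:E * u x + (\1_(~` E) x)%:E * u x).
  apply: eq_integral => x _; rewrite !indicE in_setC; case: (x \in E) => /=;
    by rewrite mul1e mul0e ?adde0 ?add0e.
have := nnm_le_ae_eq nu nk (aeW _ uk); rewrite [X in _ <= X -> _]uE.
rewrite !nnm_integralD; try by apply: nnmM => //; exact: nnm_indic.
rewrite leeD2r => [/(_ isT uoo)|]; last by apply: test; exact: nnm_indic.
apply: filterS => x /=; rewrite !indicE in_setC.
case: (boolP (x \in E)) => [|] /=.
  by rewrite mul1e mul0e adde0 => _ ->.
by move=> /negP xE _; rewrite leNgt; apply/negP => xE'; apply: xE; rewrite inE.
Qed.

Lemma test_eq_ae u h : nnm u -> nnm h -> \int[m]_x u x < +oo ->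
  (forall phi, nnm phi -> \int[m]_x (phi x * u x) = \int[m]_x (phi x * h x)) ->
  {ae m, forall x, u x = h x}.
Proof.
move=> nu nh uoo test.
have hoo : \int[m]_x h x < +oo.
  have := test _ (nnm_cst lee01); under eq_integral do rewrite mul1e.
  by under [X in _ = X -> _]eq_integral do rewrite mul1e; move=> <-.
have H1 : {ae m, forall x, h x <= u x} by apply: test_le_ae => // phi nphi; rewrite test.
have H2 : {ae m, forall x, u x <= h x} by apply: test_le_ae => // phi nphi; rewrite test.
by apply: filterS2 H1 H2 => x /= hu uh; apply/eqP; rewrite eq_le hu uh.
Qed.

(** The factor may be [+oo], as a value of a test function can be: then both sides are [+oo] once
    some term is positive, and [0] otherwise. *)
Lemma nneseries_mule (u : nat -> \bar R) c : 0 <= c -> (forall k, 0 <= u k) ->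
  c * (\sum_(0 <= k <oo) u k) = \sum_(0 <= k <oo) (c * u k).
Proof.
move=> c0 u0; case: c c0 => [r r0|_|//]; first by rewrite nneseriesZl.
have [uz|/existsNP[k /eqP uk]] := pselect (forall k, u k = 0).
  by rewrite !eseries0 ?mule0// => k _ _; rewrite uz ?mule0.
have {}uk : 0 < u k by rewrite lt0e uk u0.
have ge (w : nat -> \bar R) : (forall k, 0 <= w k) -> w k <= \sum_(0 <= k <oo) w k.
  move=> w0; apply: le_trans (nneseries_lim_ge k.+1 _) => //.
  by rewrite big_nat_recr//= leeDr// sume_ge0.
rewrite gt0_mulye; last by apply: lt_le_trans (ge _ u0).
apply/esym/eqP; rewrite -leye_eq.
have := ge (fun k => +oo * u k) (fun i => mule_ge0 le0y (u0 i)).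
by rewrite gt0_mulye.
Qed.

Lemma integral_mul_series (f : nat -> T -> \bar R) phi : (forall k, nnm (f k)) -> nnm phi ->
  \int[m]_x (phi x * \sum_(0 <= k <oo) f k x) =
  \sum_(0 <= k <oo) \int[m]_x (phi x * f k x).
Proof.
move=> nf nphi; rewrite -integral_nneseries//.
- apply: eq_integral => x _; apply: nneseries_mule; first by apply nphi.
  by move=> k; apply nf.
- by move=> k; apply: (nnmM nphi (nf k)).1.
- by move=> k x _; apply: (nnmM nphi (nf k)).2.
Qed.
End nonneg_measurable.

Lemma nnm_comp d d' (T : measurableType d) (T' : measurableType d') (R : realType)
    (phi : T' -> T) (f : T -> \bar R) :
  measurable_fun setT phi -> nnm f -> nnm (fun x => f (phi x)).
Proof. by move=> mphi [mf f0]; split=> //; exact: measurableT_comp. Qed.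

(** Here [a k] is the mass not yet regenerated after [k] steps, [M k] its energy and [s k] its part
    in the energy ball of level [r]. The mass balance telescopes and bounds the sum of [s]; the sum
    of [a] is then bounded up to the sum of [M] over [r], and the drift closes the loop because [r]
    is large. *)
Lemma splitting_bounds (R : realType) (a M s : nat -> R) (c D gamma K r : R) :
  0 < c -> 0 < D -> gamma < 1 -> 0 <= K -> 0 < r ->
  K / r <= (1 - gamma) / 2 ->
  (forall k, 0 <= a k) -> (forall k, 0 <= M k) ->
  (forall k, a k.+1 + c * s k * D = a k) ->
  (forall k, M k.+1 <= gamma * M k + K * a k) ->
  (forall k, a k <= s k + M k / r) ->
  exists B, forall n, \sum_(0 <= k < n) M k <= B /\ \sum_(0 <= k < n) a k <= B.
Proof.
move=> c0 D0 g1 K0 r0 Kr a0 M0 aE ME as_.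
have sE n : \sum_(0 <= k < n) s k <= a 0%N / (c * D).
  rewrite ler_pdivlMr ?mulr_gt0//.
  suff <- : a 0%N - a n = (\sum_(0 <= k < n) s k) * (c * D) by rewrite gerBl.
  elim: n => [|n IH]; first by rewrite big_geq// mul0r subrr.
  by rewrite big_nat_recr//= mulrDl -IH -[a n]aE; ring.
have Sa n : \sum_(0 <= k < n) a k <= a 0%N / (c * D) + (\sum_(0 <= k < n) M k) / r.
  apply: (@le_trans _ _ (\sum_(0 <= k < n) (s k + M k / r))); first exact: ler_sum.
  by rewrite big_split/= -mulr_suml lerD2r.
have SM0 n : 0 <= \sum_(0 <= k < n) M k by apply: sumr_ge0.
(* The condition on [K / r] lets half of [1 - gamma] absorb the energy term fed back by the masses;
   the other half is the denominator. *)
pose B1 := (M 0%N + K * (a 0%N / (c * D))) * 2 / (1 - gamma).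
have SM n : \sum_(0 <= k < n) M k <= B1.
  have H : \sum_(0 <= k < n) M k <=
      M 0%N + gamma * (\sum_(0 <= k < n) M k) + K * (\sum_(0 <= k < n) a k).
    case: n => [|n]; first by rewrite !big_geq// !mulr0 !addr0.
    rewrite [leLHS]big_nat_recl//= -addrA lerD2l.
    apply: (@le_trans _ _ (\sum_(0 <= k < n) (gamma * M k + K * a k))).
      exact: ler_sum.
    apply: (@le_trans _ _ (\sum_(0 <= k < n.+1) (gamma * M k + K * a k))).
      rewrite [leRHS]big_nat_recr//= lerDl; exact: le_trans (M0 n.+1) (ME n).
    by rewrite big_split/= -!mulr_sumr.
  rewrite /B1 ler_pdivlMr ?subr_gt0//.
  have Kx : K * (\sum_(0 <= k < n) a k) <=
      K * (a 0%N / (c * D)) + (1 - gamma) / 2 * (\sum_(0 <= k < n) M k).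
    apply: le_trans (ler_wpM2l K0 (Sa n)) _; rewrite mulrDr lerD2l mulrCA.
    by rewrite mulrC ler_wpM2r.
  move: H Kx; set x := \sum_(0 <= k < n) M k; set y := K * \sum_(_ <= _ < _) _.
  set z := K * (_ / _); lra.
exists (Num.max B1 (a 0%N / (c * D) + B1 / r)) => n; rewrite !le_max SM/=; split => //.
apply/orP; right; apply: le_trans (Sa n) _.
by rewrite lerD2l ler_pM2r ?invr_gt0// SM.
Qed.

(** * Invariant densities of Markov operators *)

Section harris.
Context d (T : measurableType d) (R : realType) (m : {measure set T -> \bar R}).
Local Open Scope ereal_scope.
Implicit Types (f h phi : T -> \bar R) (A B : (T -> \bar R) -> T -> \bar R).

(** [A] moves densities, [B] moves observables. Neither linearity nor monotonicity is part of the
    definition: both follow for [A], almost everywhere, from this identity. *)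
Definition dual_pair A B := [/\ forall f, nnm f -> nnm (A f),
  forall f, nnm f -> nnm (B f) &
  forall f phi, nnm f -> nnm phi ->
    \int[m]_x (phi x * A f x) = \int[m]_x (B phi x * f x)].

Definition mass_preserving A :=
  forall f, nnm f -> \int[m]_x A f x = \int[m]_x f x.

Lemma dual_pair_iter A B n : dual_pair A B -> dual_pair (iter n A) (iter n B).
Proof.
move=> [nA nB AB]; have nit C k f : (forall f, nnm f -> nnm (C f)) -> nnm f ->
    nnm (iter k C f) by move=> nC nf; elim: k => //= k; exact: nC.
split=> [f|f|]; [exact: nit|exact: nit|].
elim: n => // n IH f phi nf nphi; rewrite iterSr IH//; last exact: nA.
by rewrite AB// ?iterS//; exact: nit.
Qed.

Lemma dual_pairZ A B c : 0 <= c -> dual_pair A B ->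
  dual_pair (fun f x => c * A f x) (fun f x => c * B f x).
Proof.
move=> c0 [nA nB AB]; split => [f nf|f nf|f phi nf nphi].
- by apply: nnmZ => //; exact: nA.
- by apply: nnmZ => //; exact: nB.
- under eq_integral do rewrite muleCA.
  under [RHS]eq_integral do rewrite -muleA.
  have [nAf nBp] := (nA _ nf, nB _ nphi).
  by rewrite !nnm_integralZ ?AB//; exact: nnmM.
Qed.

Lemma dual_pair_sum (I : Type) (s : seq I) (S : pred I)
    (A B : I -> (T -> \bar R) -> T -> \bar R) :
  (forall i, S i -> dual_pair (A i) (B i)) ->
  dual_pair (fun f x => \sum_(i <- s | S i) A i f x)
            (fun f x => \sum_(i <- s | S i) B i f x).
Proof.
move=> AB.
have nA f i : nnm f -> S i -> nnm (A i f) by move=> nf /AB[+ _ _]; apply.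
have nB f i : nnm f -> S i -> nnm (B i f) by move=> nf /AB[_ + _]; apply.
split => [f nf|f nf|f phi nf nphi].
- by apply: nnm_sum => i; exact: nA.
- by apply: nnm_sum => i; exact: nB.
- under eq_integral => x _.
    rewrite ge0_sume_distrr; last by move=> i Si; case: (nA f i nf Si).
    over.
  under [RHS]eq_integral => x _.
    rewrite ge0_sume_distrl; last by move=> i Si; case: (nB phi i nphi Si).
    over.
  rewrite !nnm_integral_sum; last 2 first.
  + by move=> i Si; apply: nnmM => //; exact: nB.
  + by move=> i Si; apply: nnmM => //; exact: nA.
  by apply: eq_bigr => i /AB[_ _]; apply.
Qed.

Lemma dual_pairD A B A' B' : dual_pair A B -> dual_pair A' B' ->
  dual_pair (fun f x => A f x + A' f x) (fun f x => B f x + B' f x).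
Proof.
move=> [nA nB AB] [nA' nB' AB']; split => [f nf|f nf|f phi nf nphi].
- by apply: nnmD; [exact: nA|exact: nA'].
- by apply: nnmD; [exact: nB|exact: nB'].
- have [nAf nA'f nBp nB'p] := And4 (nA _ nf) (nA' _ nf) (nB _ nphi) (nB' _ nphi).
  under eq_integral do rewrite ge0_muleDr ?(nAf.2 _) ?(nA'f.2 _)//.
  under [RHS]eq_integral do rewrite ge0_muleDl ?(nBp.2 _) ?(nB'p.2 _)//.
  by rewrite !nnm_integralD ?AB ?AB'//; exact: nnmM.
Qed.

Lemma mass_preserving_iter A n : (forall f, nnm f -> nnm (A f)) ->
  mass_preserving A -> mass_preserving (iter n A).
Proof.
move=> nA mA; elim: n => // n IH f nf; rewrite iterSr IH//; last exact: nA.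
exact: mA.
Qed.

(** Operators act on functions and not on classes modulo null sets; duality shows that they respect
    almost everywhere equality, since the integral against [B phi] does not see null sets. *)
Lemma dual_pair_ae A B f h : dual_pair A B -> mass_preserving A ->
  nnm f -> nnm h -> \int[m]_x f x < +oo -> {ae m, forall x, f x = h x} ->
  {ae m, forall x, A f x = A h x}.
Proof.
move=> [nA nB AB] mA nf nh foo fh; apply: test_eq_ae; [exact: nA|exact: nA| |].
  by rewrite mA.
move=> phi nphi; rewrite !AB//; apply: nnm_ae_eq_integral.
- by apply: nnmM => //; exact: nB.
- by apply: nnmM => //; exact: nB.
- by apply: filterS fh => x /= ->.
Qed.

Variables (P Q : (T -> \bar R) -> T -> \bar R) (V : T -> R) (D : set T).
Hypotheses (PQ : dual_pair P Q) (massP : mass_preserving P).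
Hypotheses (mV : measurable_fun setT V) (V0 : forall x, (0 <= V x)%R).
Hypotheses (mD : measurable D) (D0 : 0 < m D).

Let C r := [set x | (V x <= r)%R].

(** Weak form of a transition kernel bound: from any point of [C r], the law after one step
    dominates [c] times the restriction of [m] to [D]. The set [D] is the same for all levels, only
    [c] depends on [r]. *)
Hypothesis minor : forall r : R, exists2 c : R, (0 < c)%R &
  forall f phi, nnm f -> nnm phi ->
    c%:E * (\int[m]_x ((\1_(C r) x)%:E * f x)) * \int[m]_x (phi x * (\1_D x)%:E)
      <= \int[m]_x (phi x * P f x).

Let nP f : nnm f -> nnm (P f). Proof. by case: PQ => + _ _; apply. Qed.
Let nQ f : nnm f -> nnm (Q f). Proof. by case: PQ => _ + _; apply. Qed.
Let dual f phi : nnm f -> nnm phi ->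
  \int[m]_x (phi x * P f x) = \int[m]_x (Q phi x * f x).
Proof. by case: PQ => _ _; apply. Qed.
Let n1D : nnm (fun x => (\1_D x)%:E : \bar R). Proof. exact: nnm_indic. Qed.
Let mC r : measurable (C r).
Proof.
rewrite (_ : C r = V @^-1` `]-oo, r]); last by apply/seteqP; split => x /=; rewrite in_itv/=.
by rewrite -[X in measurable X]setTI; apply: mV.
Qed.
Let n1C r : nnm (fun x => (\1_(C r) x)%:E : \bar R). Proof. exact: nnm_indic. Qed.

(** Since [V] is finite everywhere, the sublevel sets of integer level exhaust the space; if all the
    integrals vanished, so would the integral of the sum of the truncations, which dominates [f]. *)
Lemma sublevel_integral_gt0 f : nnm f -> 0 < \int[m]_x f x ->
  exists r, 0 < \int[m]_x ((\1_(C r) x)%:E * f x).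
Proof.
move=> nf f0; apply: contrapT => /forallNP H.
suff : \int[m]_x f x <= 0 by rewrite leNgt f0.
pose I k := fun x => (\1_(C k%:R) x)%:E * f x.
have nI k : nnm (I k) by exact: nnmM.
apply: (@le_trans _ _ (\int[m]_x \sum_(0 <= k <oo) I k x)).
  apply: nnm_le_integral => //; first exact: nnm_series.
  move=> x; pose k := (Num.truncn (V x)).+1.
  apply: le_trans (nneseries_lim_ge k.+1 _); last by move=> i _ _; apply nI.
  rewrite big_nat_recr//= {2}/I indicE mem_set ?mul1e; last first.
    by rewrite /C/=; apply/ltW/truncnS_gt.
  by rewrite leeDr// sume_ge0// => i _; apply nI.
rewrite integral_nneseries//; [|by move=> k; apply nI|by move=> k x _; apply nI].
rewrite eseries0// => k _ _; apply/eqP; rewrite eq_le nnm_integral_ge0// andbT leNgt.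
by apply/negP/H.
Qed.

(** The minorization is tested with the indicator of the zeros of [f] in [D]: by invariance its
    right side is the integral of [f] over its own zeros, while the left side is a positive multiple
    of their measure. *)
Lemma invariant_positive f : nnm f -> 0 < \int[m]_x f x ->
  {ae m, forall x, P f x = f x} -> m (D `&` [set x | f x = 0]) = 0.
Proof.
move=> nf f0 inv; have [r rf] := sublevel_integral_gt0 nf f0.
have [c c0 /(_ f)] := minor r.
have mE : measurable (D `&` [set x | f x = 0]).
  apply: measurableI => //; case: nf => + _ => /(_ measurableT [set 0]).
  by rewrite setTI; exact.
have nphi := nnm_indic R mE.
move=> /(_ _ nf nphi); set I := \int[m]_x (_ * P f x) => H.
have I0 : I = 0.
  transitivity (\int[m]_x ((\1_(D `&` [set x | f x = 0]) x)%:E * f x)).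
    apply: nnm_ae_eq_integral; [by apply: nnmM => //; exact: nP|exact: nnmM|].
    by apply: filterS inv => x /= ->.
  apply: integral0_eq => x _; rewrite indicE.
  by case: (boolP (x \in _)) => [/set_mem[_ /= ->]|_]; rewrite ?mule0 ?mul0e.
move: H; rewrite I0 (_ : \int[m]_x (_ * (\1_D x)%:E) = m (D `&` [set x | f x = 0])); last first.
  rewrite -[X in m X]setIT -integral_indic//.
  apply: eq_integral => x _; rewrite -EFinM !indicE -natrM mulnb -in_setI.
  by rewrite setIAC setIid.
move=> H; apply/eqP; rewrite eq_le measure_ge0 andbT.
rewrite leNgt; apply/negP => mE0; move: H; rewrite leNgt mule_gt0//.
by rewrite mule_gt0 ?lte_fin.
Qed.

Lemma harris_unique f h : nnm f -> nnm h ->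
  \int[m]_x f x = 1 -> \int[m]_x h x = 1 ->
  {ae m, forall x, P f x = f x} -> {ae m, forall x, P h x = h x} ->
  {ae m, forall x, f x = h x}.
Proof.
move=> nf nh f1 h1 fi hi.
pose M x := mine (f x) (h x).
have nM : nnm M.
  split; first by apply: measurable_mine; [apply nf|apply nh].
  by move=> x; rewrite le_min (nf.2 x) (nh.2 x).
have Mf x : M x <= f x by rewrite ge_min lexx.
have Mh x : M x <= h x by rewrite ge_min lexx orbT.
have M1 : \int[m]_x M x <= 1 by rewrite -f1; exact: nnm_le_integral.
have Moo : \int[m]_x M x < +oo by apply: le_lt_trans M1 (ltry _).
have foo : \int[m]_x f x < +oo by rewrite f1 ltry.
have hoo : \int[m]_x h x < +oo by rewrite h1 ltry.
(* Monotonicity, and additivity after it, are obtained by testing; the nonnegativity of [Q phi]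
   makes the first one work. *)
have monoP u k : nnm u -> nnm k -> \int[m]_x k x < +oo -> (forall x, u x <= k x) ->
    {ae m, forall x, P u x <= P k x}.
  move=> nu nk koo uk; apply: test_le_ae; [exact: nP|exact: nP|by rewrite massP|].
  move=> phi nphi; rewrite !dual//; apply: nnm_le_integral.
  - by apply: nnmM => //; exact: nQ.
  - by apply: nnmM => //; exact: nQ.
  - by move=> x; apply: lee_wpmul2l => //; apply nQ.
have addP u k : nnm u -> nnm k -> \int[m]_x (u x + k x) < +oo ->
    {ae m, forall x, P (fun x => u x + k x) x = P u x + P k x}.
  move=> nu nk ukoo; have nuk := nnmD nu nk.
  apply: test_eq_ae; [exact: nP|by apply: nnmD; exact: nP|by rewrite massP|].
  move=> phi nphi; rewrite dual//.
  have [nPu nPk nQp] := And3 (nP nu) (nP nk) (nQ nphi).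
  under eq_integral do rewrite ge0_muleDr ?(nu.2 _) ?(nk.2 _)//.
  under [RHS]eq_integral do rewrite ge0_muleDr ?(nPu.2 _) ?(nPk.2 _)//.
  by rewrite !nnm_integralD ?dual//; exact: nnmM.
(* [P M] lies below [P f = f] and [P h = h], hence below [M], and has the same finite mass as
   [M]. *)
have PM : {ae m, forall x, P M x = M x}.
  apply: nnm_le_ae_eq => //; [exact: nP| |by rewrite massP|by rewrite massP].
  have H1 := monoP _ _ nM nf foo Mf; have H2 := monoP _ _ nM nh hoo Mh.
  near=> x; rewrite /M le_min; apply/andP; split.
    rewrite -(near fi x)//; near: x; exact: H1.
  rewrite -(near hi x)//; near: x; exact: H2.
pose res u x := maxe 0 (u x - M x).
have nres u : nnm u -> nnm (res u).
  move=> nu; split => [|x]; last by rewrite le_max lexx.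
  apply: measurable_maxe; first exact: measurable_cst.
  by apply: emeasurable_funB; [apply nu|apply nM].
have Mfin := nnm_ae_fin nM Moo.
have resE u : nnm u -> (forall x, M x <= u x) -> {ae m, forall x, u x = M x + res u x}.
  move=> nu Mu; apply: filterS Mfin => x /= Mx.
  by rewrite /res (max_idPr _) ?sube_ge0 ?Mx// addeC subeK.
have resI u : nnm u -> (forall x, M x <= u x) -> \int[m]_x u x < +oo ->
    {ae m, forall x, P u x = u x} -> {ae m, forall x, P (res u) x = res u x}.
  move=> nu Mu uoo ui; have uE := resE u nu Mu; have nr := nres u nu.
  have uoo' : \int[m]_x (M x + res u x) < +oo.
    rewrite -(nnm_ae_eq_integral _ _ uE)//; exact: nnmD.
  have H1 := addP _ _ nM nr uoo'.
  have H2 := dual_pair_ae PQ massP nu (nnmD nM nr) uoo uE.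
  near=> x.
  have : M x + P (res u) x = M x + res u x.
    rewrite -(near uE x)// -(near ui x)// (near H2 x)// (near H1 x)// (near PM x)//.
  move=> /(congr1 (fun y => y - M x)); rewrite !(addeC (M x)) !addeK//; near: x; exact: Mfin.
have fi0 x : res f x = 0 \/ res h x = 0.
  have se y : maxe 0 (y - y) = 0 :> \bar R.
    by case: y => [y||] //=; rewrite subee ?maxxx.
  by rewrite /res /M; case: (leP (f x) (h x)) => _; [left|right]; exact: se.
have [M1'|M1'] := ltP (\int[m]_x M x) 1; last first.
  have H1 : {ae m, forall x, M x = f x}.
    by apply: nnm_le_ae_eq => //; [exact: aeW|rewrite f1].
  have H2 : {ae m, forall x, M x = h x}.
    by apply: nnm_le_ae_eq => //; [exact: aeW|rewrite h1].
  by apply: filterS2 H1 H2 => x /= <- <-.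
(* If [M] has mass less than 1, both residues have positive mass, so each is positive almost
   everywhere on [D]; as one of them vanishes at every point, [D] would be null. *)
have pos u : nnm u -> (forall x, M x <= u x) -> \int[m]_x u x = 1 ->
    {ae m, forall x, P u x = u x} -> m (D `&` [set x | res u x = 0]) = 0.
  move=> nu Mu u1 ui; apply: invariant_positive; [exact: nres| |].
    have : \int[m]_x u x = \int[m]_x M x + \int[m]_x res u x.
      rewrite -nnm_integralD//; last exact: nres.
      apply: nnm_ae_eq_integral => //; last exact: resE.
      by apply: nnmD => //; exact: nres.
    rewrite u1 lt0e nnm_integral_ge0 ?andbT; last exact: nres.
    by move=> u1E; apply/eqP => r0; move: M1'; rewrite u1E r0 adde0 ltxx.
  by apply: resI => //; rewrite u1 ltry.
have mR u : nnm u -> measurable (D `&` [set x | res u x = 0]).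
  move=> nu; apply: measurableI => //.
  have [mr _] := nres u nu; have := mr measurableT [set 0]; rewrite setTI; exact.
suff : m D <= 0 by rewrite leNgt D0.
have mf' := mR f nf; have mh' := mR h nh.
apply: (@le_trans _ _ (m (D `&` [set x | res f x = 0] `|` D `&` [set x | res h x = 0]))).
  apply: le_measure; rewrite ?inE//; first exact: measurableU.
  by move=> x Dx; case: (fi0 x) => r0; [left|right].
by rewrite measureU0//; [rewrite pos|exact: pos].
Unshelve. all: by end_near.
Qed.
Hypotheses (Doo : m D < +oo) (VDoo : \int[m]_x ((V x)%:E * (\1_D x)%:E) < +oo).
Variables (gamma K : R).
Hypotheses (gamma1 : (gamma < 1)%R) (gamma0 : (0 <= gamma)%R) (K0 : (0 <= K)%R).
Hypothesis drift : forall f, nnm f ->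
  \int[m]_x ((V x)%:E * P f x) <=
  gamma%:E * (\int[m]_x ((V x)%:E * f x)) + K%:E * \int[m]_x f x.

Let nV : nnm (fun x => (V x)%:E). Proof. exact: nnm_EFin. Qed.
Let n1 : nnm (fun _ : T => 1 : \bar R). Proof. exact: nnm_cst. Qed.

(* Nummelin splitting: [D] is a regeneration set, reached with rate [e f]; the
   invariant density sums the expected occupation between two regenerations. *)

Section splitting.
Variables (r c : R).
Hypotheses (r0 : (0 < r)%R) (Kr : (K / r <= (1 - gamma) / 2)%R) (c0 : (0 < c)%R).
Hypothesis rc_minor : forall f phi, nnm f -> nnm phi ->
    c%:E * (\int[m]_x ((\1_(C r) x)%:E * f x)) * \int[m]_x (phi x * (\1_D x)%:E)
      <= \int[m]_x (phi x * P f x).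

Let s f : R := fine (\int[m]_x ((\1_(C r) x)%:E * f x)).
Let e f : R := (c * s f)%R.
(** One step with the regenerated part removed. The maximum with [0] only keeps the function
    nonnegative everywhere: the minorization makes the difference nonnegative almost everywhere. The
    iterates [u k] start from the unnormalized restriction of [m] to [D]. *)
Let step f x := maxe 0 (P f x - (e f)%:E * (\1_D x)%:E).
Let u k := iter k step (fun x => (\1_D x)%:E).

Let s_ge0 f : nnm f -> (0 <= s f)%R.
Proof. by move=> nf; apply/fine_ge0/nnm_integral_ge0/nnmM. Qed.

Let e_ge0 f : nnm f -> (0 <= e f)%R.
Proof. by move=> nf; rewrite mulr_ge0// ?s_ge0// ltW. Qed.

Let sE f : nnm f -> \int[m]_x f x < +oo ->
  \int[m]_x ((\1_(C r) x)%:E * f x) = (s f)%:E.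
Proof.
move=> nf foo; rewrite fineK// ge0_fin_numE; last exact/nnm_integral_ge0/nnmM.
apply: le_lt_trans foo; apply: nnm_le_integral => //; first exact: nnmM.
move=> x; rewrite indicE; case: (_ \in _); rewrite ?mul1e ?mul0e//.
exact: nf.2.
Qed.

Let nstep f : nnm f -> nnm (step f).
Proof.
move=> nf; split => [|x]; last by rewrite le_max lexx.
apply: measurable_maxe; first exact: measurable_cst.
apply: emeasurable_funB; first exact: (nP nf).1.
by apply: emeasurable_funM; [exact: measurable_cst|exact: n1D.1].
Qed.

(** The minorization, tested against all observables, says that [e f] times the indicator of [D] is
    below [P f] almost everywhere, so the truncation in [step] is inactive and the subtraction can
    be undone. *)
Let stepE f phi : nnm f -> nnm phi -> \int[m]_x f x < +oo ->
  \int[m]_x (phi x * P f x) =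
  \int[m]_x (phi x * step f x) + (e f)%:E * \int[m]_x (phi x * (\1_D x)%:E).
Proof.
move=> nf nphi foo; have ef := e_ge0 nf; have nPf := nP nf; have ns := nstep nf.
have neD : nnm (fun x => (e f)%:E * (\1_D x)%:E) by apply: nnmZ; rewrite ?lee_fin.
rewrite -nnm_integralZ ?lee_fin//; last exact: nnmM.
rewrite -nnm_integralD//; [|exact: nnmM|]; last first.
  by apply: nnmZ; rewrite ?lee_fin//; exact: nnmM.
have H : {ae m, forall x, (e f)%:E * (\1_D x)%:E <= P f x}.
  apply: test_le_ae => //; first by rewrite massP.
  move=> psi npsi; under eq_integral do rewrite muleCA.
  rewrite nnm_integralZ ?lee_fin//; last exact: nnmM.
  by rewrite /e EFinM -sE//; exact: rc_minor.
apply: nnm_ae_eq_integral; first exact: nnmM.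
  by apply: nnmD; [exact: nnmM|apply: nnmZ; rewrite ?lee_fin//; exact: nnmM].
apply: filterS H => x /= le.
rewrite muleCA -ge0_muleDr ?(ns.2 x) ?(neD.2 x)//; congr (_ * _).
rewrite /step (max_idPr _) ?subeK// ?sube_ge0// fin_numM//.
Qed.

Let nu k : nnm (u k). Proof. by elim: k => //= k; exact: nstep. Qed.

Let uS k : \int[m]_x u k x < +oo ->
  \int[m]_x u k x = \int[m]_x u k.+1 x + (e (u k))%:E * m D.
Proof.
move=> uoo; have := stepE (nu k) n1 uoo.
under eq_integral do rewrite mul1e; rewrite massP// => ->.
under eq_integral do rewrite mul1e; congr (_ + _ * _).
under eq_integral do rewrite mul1e.
by rewrite integral_indic// setIT.
Qed.

Let uoo k : \int[m]_x u k x < +oo.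
Proof.
elim: k => [|k IH]; first by rewrite /= integral_indic// setIT.
move: (IH); rewrite uS//; apply: le_lt_trans; rewrite leeDl//.
by rewrite mule_ge0// lee_fin e_ge0.
Qed.

Let Vu k : \int[m]_x ((V x)%:E * u k.+1 x) <=
  gamma%:E * (\int[m]_x ((V x)%:E * u k x)) + K%:E * \int[m]_x u k x.
Proof.
apply: le_trans (drift (nu k)); rewrite stepE// leeDl//.
by rewrite mule_ge0 ?lee_fin ?e_ge0//; exact/nnm_integral_ge0/nnmM.
Qed.

Let Vuoo k : \int[m]_x ((V x)%:E * u k x) < +oo.
Proof.
elim: k => // k IH; apply: le_lt_trans (Vu k) _.
by rewrite lte_add_pinfty// lte_mul_pinfty ?lee_fin.
Qed.

Let a k : R := fine (\int[m]_x u k x).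
Let M k : R := fine (\int[m]_x ((V x)%:E * u k x)).

Let aE k : \int[m]_x u k x = (a k)%:E.
Proof. by rewrite fineK// ge0_fin_numE//; exact: nnm_integral_ge0. Qed.

Let ME k : \int[m]_x ((V x)%:E * u k x) = (M k)%:E.
Proof. by rewrite fineK// ge0_fin_numE//; exact/nnm_integral_ge0/nnmM. Qed.

(** Markov's inequality: outside [C r] the function [V / r] exceeds 1. *)
Let a_le k : (a k <= s (u k) + M k / r)%R.
Proof.
rewrite -lee_fin EFinD EFinM -aE -sE// -ME muleC.
rewrite -nnm_integralZ; [|by rewrite lee_fin invr_ge0 ltW|exact: nnmM].
have nVu : nnm (fun x => (r^-1)%:E * ((V x)%:E * u k x)).
  by apply: nnmZ; [by rewrite lee_fin invr_ge0 ltW|exact: nnmM].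
rewrite -nnm_integralD//; last exact: nnmM.
apply: nnm_le_integral => //; first by apply: nnmD => //; exact: nnmM.
move=> x; rewrite indicE; case: (boolP (x \in _)) => xC.
  by rewrite mul1e leeDl// nVu.2.
rewrite mul0e add0e muleA -EFinM; apply: lee_pemull; first exact: (nu k).2.
rewrite lee_fin ler_pdivlMl// mulr1; apply/ltW; rewrite ltNge; apply/negP => Vr.
by move/negP: xC; apply; rewrite inE.
Qed.

Let bounds : exists B : R, forall n,
  (\sum_(0 <= k < n) M k <= B)%R /\ (\sum_(0 <= k < n) a k <= B)%R.
Proof.
apply: (@splitting_bounds _ a M (fun k => s (u k)) c (fine (m D)) gamma K r) => //.
- by rewrite fine_gt0// D0 Doo.
- by move=> k; exact/fine_ge0/nnm_integral_ge0.
- by move=> k; exact/fine_ge0/nnm_integral_ge0/nnmM.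
- move=> k; apply: EFin_inj; rewrite EFinD EFinM -!aE (uS (uoo k)).
  by congr (_ + _ * _); rewrite fineK// ge0_fin_numE.
- by move=> k; rewrite -lee_fin EFinD !EFinM -!ME -aE.
Qed.

Let series_lty (w : nat -> \bar R) (b : nat -> R) (B : R) : (forall k, w k = (b k)%:E) ->
  (forall k, 0 <= w k) -> (forall n, (\sum_(0 <= k < n) b k <= B)%R) ->
  \sum_(0 <= k <oo) w k < +oo.
Proof.
move=> wb w0 bB; apply: (@le_lt_trans _ _ B%:E); last exact: ltry.
apply: lime_le; first exact: is_cvg_nneseries.
near=> n; rewrite (eq_bigr (fun k => (b k)%:E)) ?sumEFin ?lee_fin//.
Unshelve. all: by end_near.
Qed.

Lemma splitting_invariant : exists F, [/\ nnm F, 0 < \int[m]_x F x,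
  \int[m]_x F x < +oo, \int[m]_x ((V x)%:E * F x) < +oo &
  {ae m, forall x, P F x = F x}].
Proof.
have [B Bn] := bounds.
(* Applying [P] to the series yields the terms of index at least 1 and [\sum_k e (u k)] times the
   indicator of [D]. The missing term [u 0] is that indicator, so invariance amounts to the rates
   summing to 1. *)
pose F x := \sum_(0 <= k <oo) u k x.
have nF : nnm F by exact: nnm_series.
have IF : \int[m]_x F x = \sum_(0 <= k <oo) \int[m]_x u k x.
  rewrite integral_nneseries//; first by move=> k; apply nu.
  by move=> k x _; apply nu.
have Foo : \int[m]_x F x < +oo.
  rewrite IF; apply: (@series_lty _ a B aE) => [k|n]; first exact: nnm_integral_ge0.
  by case: (Bn n).
have recl (w : nat -> \bar R) : (forall k, 0 <= w k) ->
    \sum_(0 <= k <oo) w k = w 0%N + \sum_(0 <= k <oo) w k.+1.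
  move=> w0; rewrite nneseries_recl//; congr (_ + _).
  by rewrite -nneseries_addn//; under eq_eseriesr do rewrite addn1.
have a0 k : 0 <= \int[m]_x u k x by exact: nnm_integral_ge0.
have e0 k : 0 <= (e (u k))%:E by rewrite lee_fin e_ge0.
have u0E : \int[m]_x u 0%N x = m D by rewrite integral_indic// setIT.
have sumu := recl _ a0.
have Fpos : m D <= \int[m]_x F x.
  rewrite IF sumu u0E leeDl//; apply: nneseries_ge0 => k _ _; exact: a0.
have sumE (psi : T -> \bar R) : nnm psi -> \sum_(0 <= k <oo) \int[m]_x (psi x * P (u k) x) =
    \sum_(0 <= k <oo) \int[m]_x (psi x * u k.+1 x) +
    (\sum_(0 <= k <oo) (e (u k))%:E) * \int[m]_x (psi x * (\1_D x)%:E).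
  move=> npsi; rewrite muleC nneseries_mule//; last exact/nnm_integral_ge0/nnmM.
  rewrite -nneseriesD; last 2 first.
  - by move=> k _ _; exact/nnm_integral_ge0/nnmM.
  - by move=> k _ _; rewrite mule_ge0//; exact/nnm_integral_ge0/nnmM.
  by apply: eq_eseriesr => k _; rewrite stepE// muleC.
(* Regeneration occurs with probability one: the mass of [P F] equals that of [F], and after
   cancelling the finite mass of the terms of index at least 1, division by the mass of [D] leaves
   the sum of the rates. *)
have e1 : \sum_(0 <= k <oo) (e (u k))%:E = 1.
  have := sumE _ n1.
  under eq_eseriesr do (under eq_integral do rewrite mul1e; rewrite massP//).
  under [X in _ = X + _]eq_eseriesr do under eq_integral do rewrite mul1e.
  under [X in _ = _ + _ * X]eq_integral do rewrite mul1e.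
  move: Foo; rewrite IF sumu u0E => Foo.
  have tfin : \sum_(0 <= k <oo) \int[m]_x u k.+1 x \is a fin_num.
    rewrite ge0_fin_numE; last exact: nneseries_ge0.
    by apply: le_lt_trans Foo; rewrite leeDr.
  rewrite [X in _ = X -> _]addeC => /(congr1 (fun y => y - \sum_(0 <= k <oo) \int[m]_x u k.+1 x)).
  rewrite !addeK//.
  have mDf : m D \is a fin_num by rewrite ge0_fin_numE.
  rewrite -{1}[m D]mul1e => /esym/eqP.
  rewrite -(fineK mDf); set z := fine _; have z0 : (z != 0)%R.
    by rewrite gt_eqF// fine_gt0// D0 Doo.
  by move=> /eqP /(congr1 (fun y => y * z^-1%:E)); rewrite -!muleA -EFinM divff// !mule1.
exists F; split => //.
- exact: lt_le_trans Fpos.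
- rewrite integral_mul_series//; apply: (@series_lty _ M B ME) => [k|n].
    exact/nnm_integral_ge0/nnmM.
  by case: (Bn n).
- apply: test_eq_ae => //; [exact: nP|by rewrite massP|move=> phi nphi].
  rewrite dual// integral_mul_series//; last exact: nQ.
  under eq_eseriesr do rewrite -dual//.
  rewrite sumE// e1 mul1e addeC integral_mul_series// [RHS]recl//.
  by move=> k; exact/nnm_integral_ge0/nnmM.
Qed.
End splitting.

Lemma harris_exists : exists F, [/\ nnm F, \int[m]_x F x = 1,
  \int[m]_x ((V x)%:E * F x) < +oo & {ae m, forall x, P F x = F x}].
Proof.
(* The first summand makes [K / r] at most [(1 - gamma) / 2]; the [1] keeps the level positive when
   [K = 0]. *)
pose r := (2 * K / (1 - gamma) + 1)%R.
have g0 : (0 < 1 - gamma)%R by rewrite subr_gt0.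
have r0 : (0 < r)%R by rewrite ltr_wpDl// divr_ge0 ?mulr_ge0// ltW.
have Kr : (K / r <= (1 - gamma) / 2)%R.
  rewrite ler_pdivrMr// /r mulrDr mulr1.
  have -> : ((1 - gamma) / 2 * (2 * K / (1 - gamma)) = K)%R.
    by field; rewrite gt_eqF.
  by rewrite lerDl divr_ge0// ltW.
have [c c0 minc] := minor r.
have [F [nF F0 Foo VFoo PF]] := splitting_invariant r0 Kr c0 minc.
pose z := fine (\int[m]_x F x).
have zE : \int[m]_x F x = z%:E by rewrite fineK// ge0_fin_numE// ltW.
have z0 : (0 < z)%R by rewrite -lte_fin -zE.
have zi : 0 <= z^-1%:E :> \bar R by rewrite lee_fin invr_ge0 ltW.
have nG : nnm (fun x => z^-1%:E * F x) by exact: nnmZ.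
have I1 : \int[m]_x (z^-1%:E * F x) = 1.
  by rewrite nnm_integralZ// zE -EFinM mulVf// gt_eqF.
exists (fun x => z^-1%:E * F x); split => //.
- under eq_integral do rewrite muleCA.
  rewrite nnm_integralZ//; last exact: nnmM.
  by rewrite lte_mul_pinfty.
- apply: test_eq_ae => //; [exact: nP|by rewrite massP// I1 ltry|move=> phi nphi].
  rewrite dual//; under eq_integral do rewrite muleCA.
  under [RHS]eq_integral do rewrite muleCA.
  rewrite !nnm_integralZ//; [|exact: nnmM|by apply: nnmM => //; exact: nQ].
  rewrite -dual//; congr (_ * _); apply: nnm_ae_eq_integral.
  + by apply: nnmM => //; exact: nP.
  + exact: nnmM.
  + by apply: filterS PF => x /= ->.
Qed.
End harris.

(** * Lebesgue measure on tuples *)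

Section lebn.
Context (R : realType).
Local Open Scope ereal_scope.
Notation lam := (@lebesgue_measure R).
Notation RR := (measurableTypeR R).

Definition cons_pair n (p : RR * n.-tuple R) : n.+1.-tuple R := cons_tuple p.1 p.2.

Lemma measurable_cons_pair n : measurable_fun setT (@cons_pair n).
Proof.
have m1 : measurable_fun [set: RR * n.-tuple R] (fst : _ -> R) by exact: measurable_fst.
rewrite /cons_pair; exact: (measurable_cons m1 measurable_snd).
Qed.

Definition uncons n (v : n.+1.-tuple R) : RR * n.-tuple R := (thead v, [tuple of behead v]).

Lemma measurable_uncons n : measurable_fun setT (@uncons n).
Proof.
apply/measurable_fun_pairP; split; first exact: (@measurable_tnth _ R).
exact: measurable_behead.
Qed.

Lemma uncons_cons n p : @uncons n (cons_pair p) = p.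
Proof.
by case: p => x t; rewrite /uncons /cons_pair/= theadE; congr pair; exact: val_inj.
Qed.
Lemma lebn_step n (mn : {sigma_finite_measure set (n.-tuple R) -> \bar R}) :
  {mu : {sigma_finite_measure set (n.+1.-tuple R) -> \bar R} |
    forall f, nnm f -> \int[mu]_v f v = \int[lam \x mn]_p f (cons_pair p)}.
Proof.
pose p0 : {measure set (n.+1.-tuple R) -> \bar R} := pushforward (lam \x mn) (@cons_pair n).
pose p : {measure set (n.+1.-tuple R) -> \bar R} := p0 (@measurable_cons_pair n).
have sf : sigma_finite setT p.
  have /sigma_finiteP[F [TF ndF Foo]] := sigma_finiteT lam.
  have /sigma_finiteP[G [TG ndG Goo]] := sigma_finiteT mn.
  have mFG k : measurable (F k `*` G k).
    by apply: measurableX; [case: (Foo k)|case: (Goo k)].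
  (* Sigma-finiteness must be carried along, since the next dimension takes a product with this
     measure; exhaustions of the two factors are transported, an index common to both coming from
     their monotonicity. *)
  exists (fun k => @uncons n @^-1` (F k `*` G k)).
    rewrite predeqE => v; split => // _.
    have : setT (thead v) by []; have : setT [tuple of behead v] by [].
    rewrite TF TG => -[k _ Gk] [j _ Fj]; exists (maxn j k) => //; split => /=.
    - by move: Fj; exact/subsetPset/ndF/leq_maxl.
    - by move: Gk; exact/subsetPset/ndG/leq_maxr.
  move=> k; split.
    by rewrite -[X in measurable X]setTI; apply: measurable_uncons.
  have -> : p (@uncons n @^-1` (F k `*` G k)) = (lam \x mn) (F k `*` G k).
    congr ((lam \x mn) _).
    rewrite -comp_preimage (_ : @uncons n \o @cons_pair n = id)//.
    by apply/funext => z; exact: uncons_cons.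
  have [mF Fk] := Foo k; have [mG Gk] := Goo k.
  by rewrite product_measure1E// lte_mul_pinfty// ge0_fin_numE.
pose XS := Measure_isSigmaFinite.Build _ _ _ p sf.
exists (HB.pack_for {sigma_finite_measure set (n.+1.-tuple R) -> \bar R} (p : set _ -> \bar R) p XS).
move=> f [mf f0] /=.
by rewrite ge0_integral_pushforward//; exact: measurable_cons_pair.
Qed.

(** The statement speaks of iterated integrals only; an actual sigma-finite measure with the same
    integrals is built here, so that the general theory applies. The existence is informative
    because the measure is extracted as [lebn]. *)
Lemma lebn_sig n : {mu : {sigma_finite_measure set (n.-tuple R) -> \bar R} |
    forall f, nnm f -> \int[mu]_v f v = iint f}.
Proof.
elim: n => [|n [mn mnE]].
  exists (dirac ([tuple] : 0.-tuple R)) => f [mf f0].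
  by rewrite integral_dirac// diracT mul1e.
have [mu muE] := lebn_step mn; exists mu => f nf; rewrite muE//=.
have [mf f0] := nnm_comp (@measurable_cons_pair n) nf.
rewrite fubini_tonelli1//; apply: eq_integral => x _; rewrite /fubini_F mnE//.
by split => [|t]; [exact: (measurableT_comp mf (pair1_measurable x))|exact: f0 (x, t)].
Qed.

Definition lebn n := sval (lebn_sig n).

Lemma lebnE n f : nnm f -> \int[lebn n]_v f v = iint f.
Proof. exact: (svalP (lebn_sig n)). Qed.

Lemma lebn0 (f : 0.-tuple R -> \bar R) : nnm f -> \int[lebn 0]_v f v = f [tuple].
Proof. exact: lebnE. Qed.

Lemma nnm_section n (f : n.+1.-tuple R -> \bar R) x : nnm f -> nnm (fun t => f (cons_tuple x t)).
Proof.
move=> nf; have [mf f0] := nnm_comp (@measurable_cons_pair n) nf.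
by split => [|t]; [exact: (measurableT_comp mf (pair1_measurable x))|exact: f0 (x, t)].
Qed.

Lemma lebnS n (f : n.+1.-tuple R -> \bar R) : nnm f ->
  \int[lebn n.+1]_v f v = \int[lam]_x \int[lebn n]_t f (cons_tuple x t).
Proof.
move=> nf; rewrite lebnE//; apply: eq_integral => x _; rewrite lebnE//.
exact: nnm_section.
Qed.

Lemma lebnS_swap n (f : n.+1.-tuple R -> \bar R) : nnm f ->
  \int[lebn n.+1]_v f v = \int[lebn n]_t \int[lam]_x f (cons_tuple x t).
Proof.
move=> nf; rewrite lebnS//.
have [mf f0] := nnm_comp (@measurable_cons_pair n) nf.
exact: (@fubini_tonelli _ _ _ _ _ lam (lebn n) (fun p => f (cons_tuple p.1 p.2))).
Qed.
End lebn.

(** * Translations, shears and rotations preserve Lebesgue measure *)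

Section rotation.
Context (R : realType).
Local Open Scope ereal_scope.
Notation lam := (@lebesgue_measure R).
Notation RR := (measurableTypeR R).

Lemma lebesgue_translation (c : R) (f : RR -> \bar R) : nnm f ->
  \int[lam]_x f (x + c)%R = \int[lam]_x f x.
Proof.
move=> [mf f0].
have mT : measurable_fun [set: RR] ((fun x => x + c)%R : RR -> RR).
  have H : measurable_fun [set: R] (fun x : R => x + c)%R by apply: measurable_funD.
  exact: H.
have -> : \int[lam]_x f x = \int[pushforward lam ((fun x => x + c)%R : RR -> RR)]_x f x.
  apply: eq_measure_integral => A mA _.
  apply: (@lebesgue_measure_unique _ (pushforward lam ((fun x => x + c)%R : RR -> RR))) => //.
  move=> _ [[a b]] _ <-; rewrite /pushforward/=.
  transitivity (lam `](a - c)%R, (b - c)%R]%classic).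
    rewrite !lebesgue_measure_itv/= !lte_fin ltrD2r; case: ifP => // _.
    by rewrite -!EFinB; congr EFin; ring.
  congr (lam _).
  by apply/seteqP; split => x /=; rewrite !in_itv/= ltrBlDr lerBrDr.
by rewrite ge0_integral_pushforward.
Qed.

Definition upd n (i : 'I_n) (x : R) (v : n.-tuple R) : n.-tuple R :=
  [tuple if k == i then x else tnth v k | k < n].

Lemma tnth_upd n (i k : 'I_n) x v : tnth (upd i x v) k = if k == i then x else tnth v k.
Proof. by rewrite tnth_mktuple. Qed.

Lemma upd_cons0 n x y (t : n.-tuple R) : upd ord0 x (cons_tuple y t) = cons_tuple x t.
Proof.
apply: eq_from_tnth => k; rewrite tnth_upd.
by case: (unliftP ord0 k) => [j ->|->]; rewrite ?eqxx ?tnth0//= !tnthS.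
Qed.

Lemma upd_consS n (j : 'I_n) x y (t : n.-tuple R) :
  upd (lift ord0 j) x (cons_tuple y t) = cons_tuple y (upd j x t).
Proof.
apply: eq_from_tnth => k; rewrite tnth_upd.
case: (unliftP ord0 k) => [l ->|->]; last by rewrite !tnth0.
by rewrite (inj_eq lift_inj) !tnthS tnth_upd.
Qed.

Lemma measurable_upd d (T : measurableType d) n (i : 'I_n) (a : T -> R) (b : T -> n.-tuple R) :
  measurable_fun setT a -> measurable_fun setT b ->
  measurable_fun setT (fun z => upd i (a z) (b z)).
Proof.
move=> ma mb; apply/measurable_fun_tnthP => k /=.
rewrite (_ : _ \o _ = fun z => if k == i then a z else tnth (b z) k).
  by case: eqP => // _; exact: (measurableT_comp (measurable_tnth k) mb).
by apply/funext => z /=; rewrite tnth_upd.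
Qed.

Lemma measurable_shear n (i : 'I_n) (h : n.-tuple R -> R) : measurable_fun setT h ->
  measurable_fun setT (fun v : n.-tuple R => upd i (tnth v i + h v)%R v).
Proof.
move=> mh; apply: measurable_upd => //; apply: measurable_funD => //.
exact: measurable_tnth.
Qed.

(** Because [h] ignores coordinate [i], the map is a translation in that coordinate once the others
    are fixed. Induction strips leading coordinates until [i] is the first, which is then integrated
    innermost. *)
Lemma lebn_shear n (i : 'I_n) (h : n.-tuple R -> R) (f : n.-tuple R -> \bar R) :
  measurable_fun setT h -> (forall x v, h (upd i x v) = h v) -> nnm f ->
  \int[lebn R n]_v f (upd i (tnth v i + h v)%R v) = \int[lebn R n]_v f v.
Proof.
elim: n i h f => [[]//|n IH] i h f mh hi nf.
have nfh : nnm (fun v : n.+1.-tuple R => f (upd i (tnth v i + h v)%R v)).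
  exact: (nnm_comp (@measurable_shear _ i _ mh) nf).
have mcons x : measurable_fun setT (fun t : n.-tuple R => cons_tuple x t : n.+1.-tuple R).
  exact: (measurableT_comp (@measurable_cons_pair R n) (pair1_measurable x)).
case: (unliftP ord0 i) => [j ij|i0].
  rewrite (lebnS nfh) (lebnS nf); apply: eq_integral => x _; subst i.
  rewrite -(IH j (fun t => h (cons_tuple x t)) (fun t => f (cons_tuple x t))).
  - by apply: eq_integral => t _; rewrite tnthS upd_consS.
  - exact: (measurableT_comp mh (mcons x)).
  - by move=> y t; rewrite -upd_consS hi.
  - exact: nnm_section.
rewrite (lebnS_swap nfh) (lebnS_swap nf); apply: eq_integral => t _; subst i.
rewrite -[RHS](lebesgue_translation (h (cons_tuple 0%R t))).
  apply: eq_integral => x _; rewrite tnth0 upd_cons0; congr (f (cons_tuple (x + _)%R t)).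
  by rewrite -(hi 0%R (cons_tuple x t)) upd_cons0.
have [mf f0] := nnm_comp (@measurable_cons_pair R n) nf.
by split => [|x]; [exact: (measurableT_comp mf (pair2_measurable t))|exact: f0 (x, t)].
Qed.

(** [rot_pair] with cosine and sine as free parameters: the measure invariance becomes algebra in
    [c ^+ 2 + s ^+ 2 = 1], and the quarter turn is simply [(0, 1)]. *)
Definition rotcs n (i j : 'I_n) (c s : R) (v : n.-tuple R) : n.-tuple R :=
  [tuple (if k == i then tnth v i * c + tnth v j * s
          else if k == j then - tnth v i * s + tnth v j * c
          else tnth v k)%R | k < n].

Lemma measurable_rotcs d (T : measurableType d) n (i j : 'I_n)
    (c s : T -> R) (b : T -> n.-tuple R) :
  measurable_fun setT c -> measurable_fun setT s -> measurable_fun setT b ->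
  measurable_fun setT (fun z => rotcs i j (c z) (s z) (b z)).
Proof.
move=> mc ms mb; apply/measurable_fun_tnthP => k /=.
have mt l : measurable_fun setT (fun z => tnth (b z) l).
  exact: (measurableT_comp (measurable_tnth l) mb).
rewrite (_ : _ \o _ = fun z => if k == i then (tnth (b z) i * c z + tnth (b z) j * s z)%R
  else if k == j then (- tnth (b z) i * s z + tnth (b z) j * c z)%R else tnth (b z) k).
  case: eqP => _; first by apply: measurable_funD; exact: measurable_funM.
  case: eqP => // _; apply: measurable_funD; apply: measurable_funM => //.
  exact: measurableT_comp.
by apply/funext => z /=; rewrite tnth_mktuple.
Qed.

(* A rotation of angle different from [pi] is a product of three shears. *)
Lemma lebn_rotcs_neq n (i j : 'I_n) (c s : R) (f : n.-tuple R -> \bar R) : i != j ->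
  (c ^+ 2 + s ^+ 2 = 1)%R -> c != (-1)%R -> nnm f ->
  \int[lebn R n]_v f (rotcs i j c s v) = \int[lebn R n]_v f v.
Proof.
move=> ij cs c1 nf.
have c10 : (1 + c != 0)%R by rewrite addrC -[1%R]opprK subr_eq0.
(* The tangent of the half angle; the shears have slopes [t], [- s] and [t]. *)
pose t := (s / (1 + c))%R.
have mh (a b : 'I_n) u : a != b -> measurable_fun setT (fun v : n.-tuple R => u * tnth v b)%R /\
    forall x v, (u * tnth (upd a x v) b = u * tnth v b)%R.
  move=> ab; split; first by apply: measurable_funM => //; exact: measurable_tnth.
  by move=> x v; rewrite tnth_upd eq_sym (negbTE ab).
have ji : j != i by rewrite eq_sym.
have [m1 h1] := mh i j t ij; have [m2 h2] := mh j i (- s)%R ji.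
have n1 : nnm (fun v : n.-tuple R => f (upd i (tnth v i + t * tnth v j)%R v)).
  exact: (nnm_comp (@measurable_shear _ i _ m1) nf).
have n2 : nnm (fun v : n.-tuple R => f (upd i
    (tnth (upd j (tnth v j + - s * tnth v i)%R v) i +
     t * tnth (upd j (tnth v j + - s * tnth v i)%R v) j)%R
   (upd j (tnth v j + - s * tnth v i)%R v))).
  exact: (nnm_comp (@measurable_shear _ j _ m2) n1).
rewrite -(lebn_shear m1 h1 nf) -(lebn_shear m2 h2 n1) -(lebn_shear m1 h1 n2).
apply: eq_integral => v _; congr f; apply: eq_from_tnth => k.
have s1c : (s * s = (1 - c) * (1 + c))%R by move: cs; rewrite !expr2 => cs; lra.
have st : (s * t = 1 - c)%R by rewrite /t mulrA s1c mulfK.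
have tc : (t * (1 + c) = s)%R by rewrite /t divfK.
rewrite tnth_mktuple !tnth_upd !eqxx (negbTE ij) (negbTE ji).
case: eqP => [_|ki].
  set x := tnth v i; set y := tnth v j.
  have -> : (x + t * y + t * (y + - s * (x + t * y)) = x * (1 - s * t) + y * (t * (1 + (1 - s * t))))%R by ring.
  rewrite st (_ : 1 - (1 - c) = c)%R; last by ring.
  by rewrite tc.
case: eqP => [_|//].
set x := tnth v i; set y := tnth v j.
have -> : (y + - s * (x + t * y) = - x * s + y * (1 - s * t))%R by ring.
by rewrite st (_ : 1 - (1 - c) = c)%R//; ring.
Qed.

(** The half turn, where the tangent of the half angle is infinite, is the square of the quarter
    turn. *)
Lemma lebn_rotcs n (i j : 'I_n) (c s : R) (f : n.-tuple R -> \bar R) : i != j ->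
  (c ^+ 2 + s ^+ 2 = 1)%R -> nnm f ->
  \int[lebn R n]_v f (rotcs i j c s v) = \int[lebn R n]_v f v.
Proof.
move=> ij cs nf; have [c1|] := eqVneq c (-1)%R; last first.
  by move=> c1; exact: (lebn_rotcs_neq ij cs c1 nf).
have s0 : s = 0%R.
  by apply/eqP; rewrite -sqrf_eq0; apply/eqP; move: cs; rewrite c1 expr2; lra.
have cs' : (0 ^+ 2 + 1 ^+ 2 = 1 :> R)%R by rewrite expr0n expr1n add0r.
have c1' : 0%R != (-1)%R :> R by rewrite eq_sym oppr_eq0 oner_eq0.
have ng : nnm (fun v => f (rotcs i j 0%R 1%R v)).
  by apply: (nnm_comp _ nf); exact: measurable_rotcs.
rewrite -(lebn_rotcs_neq ij cs' c1' nf) -(lebn_rotcs_neq ij cs' c1' ng).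
apply: eq_integral => v _; congr f; apply: eq_from_tnth => k.
rewrite !tnth_mktuple !eqxx (eq_sym j i) (negbTE ij) c1 s0.
by case: eqP => _; [ring|case: eqP => _ //; ring].
Qed.
End rotation.

(** * Collision kernels *)

Section parameterized.
Context (R : realType) d (T : measurableType d).
Local Open Scope ereal_scope.
Notation lam := (@lebesgue_measure R).
Notation RR := (measurableTypeR R).
Implicit Types n : nat.
Implicit Types F : RR * T -> \bar R.

Lemma nnm_pair2 F t : nnm F -> nnm (fun x : RR => F (x, t)).
Proof.
move=> [mF F0]; split => [|x]; last exact: F0.
exact: (measurableT_comp mF (pair2_measurable t)).
Qed.

Lemma nnm_pair1 F x : nnm F -> nnm (fun t => F (x, t)).
Proof.
move=> [mF F0]; split => [|t]; last exact: F0.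
exact: (measurableT_comp mF (pair1_measurable x)).
Qed.

Lemma nnm_integral_fst F : nnm F -> nnm (fun t => \int[lam]_x F (x, t)).
Proof.
move=> [mF F0]; split => [|t]; last by apply: integral_ge0 => x _; exact: F0.
exact: (@measurable_fun_fubini_tonelli_G _ _ _ _ _ lam F).
Qed.

Lemma nnm_tonelli (m : {sigma_finite_measure set T -> \bar R}) F : nnm F ->
  \int[m]_t \int[lam]_x F (x, t) = \int[lam]_x \int[m]_t F (x, t).
Proof.
move=> [mF F0]; apply: esym.
exact: (@fubini_tonelli _ _ _ _ _ lam m F).
Qed.

End parameterized.

Section collisions.
Context (R : realType).
Local Open Scope ereal_scope.
Notation lam := (@lebesgue_measure R).
Notation RR := (measurableTypeR R).
Implicit Types n : nat.

Lemma measurable_angles : measurable (@angles R : set RR).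
Proof. exact: measurable_itv. Qed.

(** The factor [1 / (2 pi)] of the angular mean is left out here and restored in [pair_weight] and
    [res_weight]. *)
Definition kpair n (i j : 'I_n) (f : n.-tuple R -> \bar R) (v : n.-tuple R) :=
  \int[lam]_(th in angles) f (rot_pair i j th v).

Lemma measurable_rot_pair n (i j : 'I_n) :
  measurable_fun setT (fun p : RR * n.-tuple R => rot_pair i j (p.1 : R) p.2).
Proof.
have mtrig (h : R -> R) : continuous h ->
    measurable_fun setT (fun p : RR * n.-tuple R => h p.1).
  move=> ch; have mh : measurable_fun [set: R] h by exact: continuous_measurable_fun.
  exact: (@measurableT_comp _ _ _ _ _ _ (h : RR -> R)).
apply: (@measurable_rotcs R _ _ n i j) => //.
- exact: (mtrig cos (@continuous_cos R)).
- exact: (mtrig sin (@continuous_sin R)).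
Qed.

Lemma nnm_rot_pair n (i j : 'I_n) (f : n.-tuple R -> \bar R) : nnm f ->
  nnm (fun p : RR * n.-tuple R => f (rot_pair i j (p.1 : R) p.2)).
Proof. by move=> nf; apply: (nnm_comp _ nf); exact: measurable_rot_pair. Qed.

Lemma nnm_fst_angles n : nnm (fun p : RR * n.-tuple R => (\1_(@angles R) (p.1 : R))%:E : \bar R).
Proof.
exact: (nnm_comp measurable_fst (nnm_indic R measurable_angles)).
Qed.

Lemma kpairE n (i j : 'I_n) f v :
  kpair i j f v = \int[lam]_th ((\1_(@angles R) th)%:E * f (rot_pair i j th v)).
Proof. by rewrite /kpair integral_indicE//; exact: measurable_angles. Qed.

Lemma nnm_kpair n (i j : 'I_n) f : nnm f -> nnm (kpair i j f).
Proof.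
move=> nf; rewrite (_ : kpair i j f = fun v => \int[lam]_th
  ((\1_(@angles R) th)%:E * f (rot_pair i j th v))); last first.
  by apply/funext => v; exact: kpairE.
exact: (nnm_integral_fst (nnmM (nnm_fst_angles n) (nnm_rot_pair i j nf))).
Qed.

(** Exchanging the two indices reverses the orientation of the plane, hence the sense of rotation.
    This is why the dual of [kpair i j] is [kpair j i]. *)
Lemma rot_pairK n (i j : 'I_n) th (v : n.-tuple R) : i != j ->
  rot_pair j i th (rot_pair i j th v) = v.
Proof.
move=> ij; have ji : j != i by rewrite eq_sym.
have cs := cos2Dsin2 th; move: cs; rewrite !expr2 => cs.
apply: eq_from_tnth => k; rewrite !tnth_mktuple !eqxx (negbTE ji).
set x := tnth v i; set y := tnth v j.
case: eqP => [->|_].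
  have -> : ((- x * sin th + y * cos th) * cos th + (x * cos th + y * sin th) * sin th
    = y * (cos th * cos th + sin th * sin th))%R by ring.
  by rewrite cs mulr1.
case: eqP => [->|//].
have -> : (- (- x * sin th + y * cos th) * sin th + (x * cos th + y * sin th) * cos th
    = x * (cos th * cos th + sin th * sin th))%R by ring.
by rewrite cs mulr1.
Qed.

(** Tonelli brings the angle outside; for each angle the rotation is a measure preserving change of
    variable that moves from [f] to [phi] as its inverse. *)
Lemma dual_pair_kpair n (i j : 'I_n) : i != j -> dual_pair (lebn R n) (kpair i j) (kpair j i).
Proof.
move=> ij; split => [f|f|f phi nf nphi]; [exact: nnm_kpair|exact: nnm_kpair|].
have nsnd (h : n.-tuple R -> \bar R) : nnm h -> nnm (fun p : RR * n.-tuple R => h p.2).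
  by move=> nh; exact: (nnm_comp measurable_snd nh).
have na := nnm_fst_angles n.
under eq_integral => v _.
  rewrite kpairE -nnm_integralZ ?(nphi.2 v)//; last first.
    exact: (nnm_pair2 v (nnmM na (nnm_rot_pair i j nf))).
  over.
under [RHS]eq_integral => v _.
  rewrite kpairE muleC -nnm_integralZ ?(nf.2 v)//; last first.
    exact: (nnm_pair2 v (nnmM na (nnm_rot_pair j i nphi))).
  over.
rewrite (nnm_tonelli _ (nnmM (nsnd _ nphi) (nnmM na (nnm_rot_pair i j nf)))).
rewrite (nnm_tonelli _ (nnmM (nsnd _ nf) (nnmM na (nnm_rot_pair j i nphi)))).
apply: eq_integral => th _ /=.
have nrot (a b : 'I_n) (h : n.-tuple R -> \bar R) : nnm h -> nnm (fun v => h (rot_pair a b th v)).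
  by move=> nh; exact: (nnm_pair1 th (nnm_rot_pair a b nh)).
under eq_integral do rewrite muleCA.
under [RHS]eq_integral do rewrite muleCA.
have a0 : 0 <= (\1_(@angles R) th)%:E :> \bar R by rewrite lee_fin indicE.
rewrite !nnm_integralZ//; [|by apply: nnmM => //; exact: nrot..].
congr (_ * _).
have nh : nnm (fun v => f v * phi (rot_pair j i th v)) by apply: nnmM => //; exact: nrot.
rewrite -(lebn_rotcs ij (cos2Dsin2 th) nh).
by apply: eq_integral => v _; rewrite rot_pairK// muleC.
Qed.

Variable g : R -> R.
Hypotheses (g_meas : measurable_fun setT g) (g_ge0 : forall w, (0 <= g w)%R).

Definition gtimes n (f : n.-tuple R -> \bar R) (u : n.+1.-tuple R) : \bar R :=
  (g (thead u))%:E * f [tuple of behead u].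

(** The reservoir particle becomes coordinate [0] of an [n+1] particle system with density [g] in
    that coordinate: after a pair collision, coordinate [0] carries [w_j^*] and the tail
    [v_j(w, theta)]. In [kresD] the observable ignores coordinate [0] and [g] weighs the velocity
    before the collision. *)
Definition kres n (j : 'I_n) (f : n.-tuple R -> \bar R) (v : n.-tuple R) :=
  \int[lam]_w kpair (lift ord0 j) ord0 (gtimes f) (cons_tuple w v).

Definition kresD n (j : 'I_n) (phi : n.-tuple R -> \bar R) (v : n.-tuple R) :=
  \int[lam]_w ((g w)%:E *
    kpair ord0 (lift ord0 j) (fun u => phi [tuple of behead u]) (cons_tuple w v)).

Lemma nnm_g : nnm (fun w : RR => (g w)%:E). Proof. exact: nnm_EFin. Qed.

Lemma nnm_behead n (f : n.-tuple R -> \bar R) : nnm f -> nnm (fun u : n.+1.-tuple R => f [tuple of behead u]).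
Proof. by move=> nf; apply: (nnm_comp _ nf); exact: measurable_behead. Qed.

Lemma nnm_gtimes n (f : n.-tuple R -> \bar R) : nnm f -> nnm (gtimes f).
Proof.
move=> nf; apply: nnmM; last exact: nnm_behead.
apply: (nnm_comp _ nnm_g); exact: (@measurable_tnth _ R).
Qed.

Lemma nnm_cons_pair n (f : n.+1.-tuple R -> \bar R) : nnm f ->
  nnm (fun p : RR * n.-tuple R => f (cons_tuple p.1 p.2)).
Proof. by move=> nf; exact: (nnm_comp (@measurable_cons_pair R n) nf). Qed.

Lemma nnm_kres n (j : 'I_n) f : nnm f -> nnm (kres j f).
Proof.
move=> nf; have nk := nnm_kpair (lift ord0 j) ord0 (nnm_gtimes nf).
exact: (nnm_integral_fst (nnm_cons_pair nk)).
Qed.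

Let nnm_fst n : nnm (fun p : RR * n.-tuple R => (g p.1)%:E).
Proof. exact: (nnm_comp measurable_fst nnm_g). Qed.

Lemma nnm_kresD n (j : 'I_n) f : nnm f -> nnm (kresD j f).
Proof.
move=> nf; have nk := nnm_kpair ord0 (lift ord0 j) (nnm_behead nf).
exact: (nnm_integral_fst (nnmM (nnm_fst n) (nnm_cons_pair nk))).
Qed.

Lemma behead_cons n w (v : n.-tuple R) : [tuple of behead (cons_tuple w v)] = v.
Proof. exact: val_inj. Qed.

(** Both sides are integrals over [n+1] coordinates, so the duality is that of a pair collision in
    one more dimension. *)
Lemma dual_pair_kres n (j : 'I_n) : dual_pair (lebn R n) (kres j) (kresD j).
Proof.
split => [f|f|f phi nf nphi]; [exact: nnm_kres|exact: nnm_kresD|].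
have nk := nnm_kpair (lift ord0 j) ord0 (nnm_gtimes nf).
have nk' := nnm_kpair ord0 (lift ord0 j) (nnm_behead nphi).
have nb := nnm_behead nphi.
transitivity (\int[lebn R n.+1]_u (phi [tuple of behead u] *
    kpair (lift ord0 j) ord0 (gtimes f) u)).
  rewrite lebnS_swap; last exact: nnmM.
  apply: eq_integral => v _; rewrite -nnm_integralZ ?(nphi.2 v)//.
    by apply: eq_integral => w _; rewrite behead_cons.
  exact: (nnm_pair2 v (nnm_cons_pair nk)).
have [_ _ ->//] := @dual_pair_kpair n.+1 (lift ord0 j) ord0 isT; last exact: nnm_gtimes.
rewrite lebnS_swap; last by apply: nnmM => //; exact: nnm_gtimes.
apply: eq_integral => v _; rewrite [RHS]muleC -nnm_integralZ ?(nf.2 v)//.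
  by apply: eq_integral => w _; rewrite /gtimes behead_cons theadE muleCA muleA muleC muleA muleC.
exact: (nnm_pair2 v (nnmM (nnm_fst n) (nnm_cons_pair nk'))).
Qed.
End collisions.

(** * Minorization *)

Section lipschitz.
Context (R : realType).
Local Open Scope ereal_scope.
Notation lam := (@lebesgue_measure R).
Notation RR := (measurableTypeR R).

(** The measure of [A] is the infimum over coverings by half-open intervals. Each interval is mapped
    into a closed one of length [L] times as large, centred at the image of the midpoint, and these
    cover [E]. *)
Lemma lipschitz_measure_le (h : R -> R) (L : R) (A E : set RR) : (0 < L)%R ->
  (forall x y, `|h x - h y| <= L * `|x - y|)%R -> measurable E -> E `<=` h @` A ->
  lam E <= L%:E * lam A.
Proof.
move=> L0 hL mE EA.
rewrite -[leLHS]mul1e -(divff (lt0r_neq0 L0)) EFinM -muleA.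
apply: lee_wpmul2l; first by rewrite lee_fin ltW.
rewrite [leRHS]/lebesgue_measure [leRHS]/lebesgue_stieltjes_measure.
rewrite [leRHS]/measure_extension [leRHS]/mu_ext.
apply: le_ereal_inf_tmp => _ [F [mF AF] <-].
have cov k : exists B : set RR, [/\ measurable B, h @` (F k) `<=` B &
    lam B <= L%:E * wlength (idfun : R -> R) (F k)].
  have [[a b] _ <-] := mF k; have [ab|ba] := leP a b; last first.
    exists set0; split => //; last by rewrite measure0 wlength_itv/= lte_fin ltNge (ltW ba)/= mule0.
    by move=> _ [x /= + _]; rewrite in_itv/= => /andP[ax xb]; have := lt_le_trans ax xb; rewrite ltNge ltW.
  exists `[(h ((a + b) / 2) - L * ((b - a) / 2))%R, (h ((a + b) / 2) + L * ((b - a) / 2))%R]%classic.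
  split; first exact: measurable_itv.
    move=> _ [x /= + <-]; rewrite !in_itv/= => /andP[ax xb].
    have := hL x ((a + b) / 2)%R.
    have H : (`|x - (a + b) / 2| <= (b - a) / 2)%R.
      by rewrite ler_norml; apply/andP; split; lra.
    move=> /le_trans /(_ (ler_wpM2l (ltW L0) H)); rewrite ler_norml => /andP[]; lra.
  rewrite wlength_itv_bnd// lebesgue_measure_itv/= lte_fin -EFinM.
  case: ifP => _; first by rewrite -EFinB lee_fin; lra.
  by rewrite lee_fin mulr_ge0// ?subr_ge0// ltW.
have [B HB] := choice cov.
have : lam E <= \sum_(0 <= k <oo) lam (B k).
  apply: measure_sigma_subadditive => //; first by move=> k; case: (HB k).
  move=> y /EA[x Ax <-]; have [k _ Fkx] := AF x Ax; exists k => //.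
  by case: (HB k) => _ + _; apply; exists x.
move=> /le_trans; have -> : \sum_(0 <= k <oo) wlength (idfun : R -> R) (F k) =
    L^-1%:E * (L%:E * \sum_(0 <= k <oo) wlength (idfun : R -> R) (F k)).
  by rewrite muleA -EFinM mulVf ?mul1e// gt_eqF.
move=> H; apply: lee_wpmul2l; first by rewrite lee_fin invr_ge0 ltW.
apply: H; rewrite -nneseriesZl; last by move=> k _; exact: wlength_ge0.
by apply: lee_nneseries => k // _; case: (HB k).
Qed.

Import HBNNSimple.

(** Simple functions below [f] on [D] have their nonzero level sets inside [D], where the two
    measures are ordered. *)
Lemma le_measure_integral d (T : measurableType d) (m1 m2 : {measure set T -> \bar R})
    (D : set T) (f : T -> \bar R) : measurable D ->
  (forall A, measurable A -> A `<=` D -> m1 A <= m2 A) -> (forall x, 0 <= f x) ->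
  \int[m1]_(x in D) f x <= \int[m2]_(x in D) f x.
Proof.
move=> mD m12 f0; rewrite !ge0_integralE//.
apply: ge_ereal_sup => _ [s sf <-]; apply: le_trans (ereal_sup_ubound _); last first.
  by exists s => //.
rewrite !sintegralE; apply: lee_fsum => [|x [t _ <-]]; first exact: fimfunP.
have [->|st0] := eqVneq (s t) 0%R; first by rewrite !mul0e.
apply: lee_wpmul2l; first by rewrite lee_fin; exact: fun_ge0.
apply: m12 => // u /= sut; have := sf u; rewrite patchE.
case: ifPn => [|uD]; first by rewrite inE.
rewrite lee_fin sut => st; exfalso; move/eqP: st0; apply.
by apply/eqP; rewrite eq_le st fun_ge0.
Qed.

(** Replaces a change of variable for a map that need not be injective: the push-forward of Lebesgue
    measure on [S], multiplied by [L], dominates Lebesgue measure on [D]. *)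
Lemma lipschitz_integral_ge (h : R -> R) (L : R) (S D : set RR) (f : RR -> \bar R) :
  (0 < L)%R -> continuous h ->
  (forall x y, `|h x - h y| <= L * `|x - y|)%R -> measurable S -> measurable D ->
  D `<=` h @` S -> nnm f ->
  L^-1%:E * \int[lam]_(x in D) f x <= \int[lam]_(x in S) f (h x).
Proof.
move=> L0 ch hL mS mD DS [mf f0].
have mh : measurable_fun [set: RR] (h : RR -> RR).
  have mh : measurable_fun [set: R] h by exact: continuous_measurable_fun.
  exact: mh.
pose p0 : {measure set RR -> \bar R} := pushforward (mrestr lam mS) (h : RR -> RR).
pose p : {measure set RR -> \bar R} := p0 mh.
have L0' : (0 <= L)%R by exact: ltW.
pose q : {measure set RR -> \bar R} := mscale (NngNum L0') p.
have -> : \int[lam]_(x in S) f (h x) = \int[p]_x f x.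
  rewrite ge0_integral_pushforward// preimage_setT.
  rewrite (@ge0_negligible_integral _ _ _ (mrestr lam mS) setT (~` S))//.
  - rewrite setTD setCK; apply: eq_measure_integral => A mA AS.
    transitivity (lam (A `&` S)) => //; by rewrite setIidl.
  - exact: measurableC.
  - exact: measurableT_comp.
  - by move=> x _; exact: f0.
  - by transitivity (lam (~` S `&` S)) => //; rewrite setICl measure0.
rewrite -[leRHS]mul1e -(mulVf (lt0r_neq0 L0)) EFinM -muleA.
apply: lee_wpmul2l; first by rewrite lee_fin invr_ge0.
have <- : \int[q]_x f x = L%:E * \int[p]_x f x by rewrite ge0_integral_mscale.
apply: (@le_trans _ _ (\int[q]_(x in D) f x)); last exact: ge0_subset_integral.
apply: le_measure_integral => // A mA AD.
rewrite /q /= /mscale /= /p /= /pushforward /mrestr.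
apply: lipschitz_measure_le L0 hL mA _ => y Ay.
by have [x Sx hx] := DS y (AD y Ay); exists x => //; split => //=; rewrite hx.
Qed.
End lipschitz.

(** * The interval swept by a random rotation *)

Section minorization.
Context (R : realType).
Local Open Scope ereal_scope.
Notation lam := (@lebesgue_measure R).
Notation RR := (measurableTypeR R).

Lemma lipschitz_of_derivative (f df : R -> R) : (forall x : R, is_derive x 1%R f (df x)) ->
  (forall x, `|df x| <= 1)%R -> forall x y, (`|f x - f y| <= `|x - y|)%R.
Proof.
move=> fd df1; have le x y : (x <= y -> `|f y - f x| <= `|y - x|)%R.
  move=> xy; have [c _ ->] : exists2 c, c \in `[x, y] & (f y - f x = df c * (y - x))%R.
    apply: MVT_segment => //.
    apply: continuous_subspaceT => z; have ? := fd z.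
    by apply/differentiable_continuous/derivable1_diffP.
  by rewrite normrM ler_piMl.
move=> x y; have [xy|/ltW yx] := leP x y; last exact: le.
by rewrite distrC [leRHS]distrC; exact: le.
Qed.

Lemma rotation_lipschitz (a w B x y : R) : (`|a| + `|w| <= B)%R ->
  (`|(a * cos x - w * sin x) - (a * cos y - w * sin y)| <= B * `|x - y|)%R.
Proof.
move=> aw.
have hc : (`|cos x - cos y| <= `|x - y|)%R.
  apply: (lipschitz_of_derivative (@is_derive_cos R)) => z.
  by rewrite normrN sin_max.
have hs : (`|sin x - sin y| <= `|x - y|)%R.
  by apply: (lipschitz_of_derivative (@is_derive_sin R)) => z; exact: cos_max.
have -> : (a * cos x - w * sin x - (a * cos y - w * sin y) =
  a * (cos x - cos y) - w * (sin x - sin y))%R by ring.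
apply: le_trans (ler_normB _ _) _; rewrite !normrM.
apply: (@le_trans _ _ ((`|a| + `|w|) * `|x - y|)%R); last exact: ler_wpM2r.
by rewrite mulrDl lerD// ler_wpM2l.
Qed.

Lemma rotation_continuous (a w : R) : continuous (fun th => a * cos th - w * sin th)%R.
Proof.
move=> x; apply: cvgB; apply: cvgM; try exact: cvg_cst.
- exact: continuous_cos.
- exact: continuous_sin.
Qed.

Lemma rotation_onto (a w y : R) : (`|y| <= `|w|)%R ->
  exists2 th, angles th & (a * cos th - w * sin th = y)%R.
Proof.
move=> yw; pose h th := (a * cos th - w * sin th)%R.
have p0 : (0 < pi :> R)%R by exact: pi_gt0.
(* At the angles [pi / 2] and [3 pi / 2] the cosine vanishes and the function takes the values [- w]
   and [w] whatever [a] is; the intermediate value theorem does the rest. *)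
have h1 : h (pi / 2)%R = (- w)%R.
  by rewrite /h cos_pihalf sin_pihalf mulr0 mulr1 sub0r.
have h2 : h (pi / 2 + pi)%R = w.
  by rewrite /h sinDpi cosDpi cos_pihalf sin_pihalf oppr0 mulr0 mulrN1 opprK add0r.
have [th] : exists2 th, th \in `[(pi / 2)%R, (pi / 2 + pi)%R] & h th = y.
  apply: IVT; first by rewrite lerDl ltW.
    by apply: continuous_subspaceT; exact: rotation_continuous.
  rewrite h1 h2; move: yw; rewrite ler_norml ge_min le_max.
  have [w0|w0] := leP 0%R w; first by rewrite ger0_norm// => /andP[-> ->]; rewrite orbT.
  by rewrite ltr0_norm// opprK => /andP[-> ->]; rewrite orbT.
rewrite in_itv/= => /andP[t1 t2] hth; exists th => //.
by rewrite /angles/= in_itv/=; apply/andP; split; lra.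
Qed.

Definition shell (b C : R) : set RR := [set w | (b <= `|w| <= C)%R].

Lemma measurable_shell b C : measurable (shell b C).
Proof.
rewrite (_ : shell b C = ((fun w : R => `|w|%R) @^-1` `[b, C]%classic)); last first.
  by apply/seteqP; split => w; rewrite /shell/= in_itv.
have mn : measurable_fun [set: R] (fun w : R => `|w|%R) 
  by apply: measurableT_comp; [exact: normr_measurable|exact: measurable_id].
have := mn measurableT `[b, C]%classic (measurable_itv _); rewrite setTI; exact.
Qed.

Variable g : R -> R.
Hypotheses (g_meas : measurable_fun setT g) (g_ge0 : forall w, (0 <= g w)%R).
Hypothesis g_mass : \int[lam]_w (g w)%:E = 1.

(** The shells with radii [1 / (k+1)] and [k+1] exhaust the nonzero velocities and [0] is a null
    point, so they cannot all miss the mass of [g]. *)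
Lemma shell_mass : exists b C : R, [/\ (0 < b)%R, (0 < C)%R &
  0 < \int[lam]_w ((\1_(shell b C) w)%:E * (g w)%:E)].
Proof.
apply: contrapT => H; have ng : nnm (fun w : RR => (g w)%:E) := nnm_g g_meas g_ge0.
pose I k (w : RR) := (\1_(shell k.+1%:R^-1 k.+1%:R) w)%:E * (g w)%:E.
have nI k : nnm (I k) by apply: nnmM => //; exact: (nnm_indic R (measurable_shell _ _)).
suff : \int[lam]_w (g w)%:E <= 0 by rewrite g_mass leNgt lte01.
apply: (@le_trans _ _ (\int[lam]_w \sum_(0 <= k <oo) I k w)).
  apply: ae_ge0_le_integral => //.
  - by move=> w _; rewrite lee_fin.
  - exact: ng.1.
  - by move=> w _; exact: (nnm_series nI).2.
  - exact: (nnm_series nI).1.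
  exists [set 0%R]; split; [exact: measurable_set1|exact: lebesgue_measure_set1|].
  move=> w /=; apply: contra_notP => w0 _.
  have aw : (0 < `|w|)%R by rewrite normr_gt0; apply/eqP.
  (* Chosen so that [k+1] dominates both [|w|] and its inverse. *)
  pose k := Num.truncn (`|w| + `|w|^-1)%R.
  have kw : (`|w| + `|w|^-1 <= k.+1%:R)%R by apply/ltW/truncnS_gt.
  have wi : (0 < `|w|^-1)%R by rewrite invr_gt0.
  apply: le_trans (nneseries_lim_ge k.+1 _); last by move=> i _ _; apply nI.
  rewrite big_nat_recr//= {2}/I indicE mem_set ?mul1e; last first.
    rewrite /shell/= -[leRHS]invrK; apply/andP; split; last by lra.
    by rewrite lef_pV2 ?posrE//; lra.
  by rewrite leeDr// sume_ge0// => i _; apply nI.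
rewrite integral_nneseries//; [|by move=> k; apply nI|by move=> k x _; apply nI].
rewrite eseries0// => k _ _; apply/eqP; rewrite eq_le nnm_integral_ge0// andbT leNgt.
by apply/negP => H'; apply: H; exists k.+1%:R^-1%R, k.+1%:R%R; rewrite invr_gt0 ltr0n.
Qed.

Variables (n : nat) (b : R).
Hypothesis b0 : (0 < b)%R.
Notation J := (`[(- b)%R, b]%classic : set RR).

(** Unnormalized: no factor [1 / (2 b)], so that iterating over all coordinates gives Lebesgue
    measure on the cube. *)
Definition avg (j : 'I_n) (phi : n.-tuple R -> \bar R) (v : n.-tuple R) :=
  \int[lam]_(x in J) phi (upd j x v).
End minorization.

(** * Successive reservoir collisions *)

Section reservoir_sweep.
Context (R : realType).
Local Open Scope ereal_scope.
Notation lam := (@lebesgue_measure R).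
Notation RR := (measurableTypeR R).

Lemma nnm_updE n (j : 'I_n) (phi : n.-tuple R -> \bar R) : nnm phi ->
  nnm (fun p : RR * n.-tuple R => phi (upd j (p.1 : R) p.2)).
Proof.
move=> np; apply: (nnm_comp _ np).
have m1 : measurable_fun [set: RR * n.-tuple R] (fst : _ -> R) by exact: measurable_fst.
by apply: (measurable_upd j m1); exact: measurable_snd.
Qed.

Lemma avgE b n (j : 'I_n) phi v :
  avg b j phi v = \int[lam]_x ((\1_(`[(- b)%R, b]%classic : set RR) x)%:E * phi (upd j x v)).
Proof. by rewrite /avg integral_indicE//; exact: measurable_itv. Qed.

Lemma nnm_avg b n (j : 'I_n) (phi : n.-tuple R -> \bar R) : nnm phi -> nnm (avg b j phi).
Proof.
move=> np; rewrite (_ : avg b j phi = fun v =>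
  \int[lam]_x ((\1_(`[(- b)%R, b]%classic : set RR) x)%:E * phi (upd j x v))); last first.
  by apply/funext => v; exact: avgE.
apply: (nnm_integral_fst (F := fun p : RR * n.-tuple R =>
  (\1_(`[(- b)%R, b]%classic : set RR) p.1)%:E * phi (upd j (p.1 : R) p.2))).
apply: nnmM; last exact: nnm_updE.
by apply: (nnm_comp measurable_fst (nnm_indic R _)); exact: measurable_itv.
Qed.

Lemma behead_rot_pair n (j : 'I_n) (th w : R) (v : n.-tuple R) :
  [tuple of behead (rot_pair ord0 (lift ord0 j) th (cons_tuple w v))] =
  upd j (tnth v j * cos th - w * sin th)%R v.
Proof.
apply: eq_from_tnth => k; rewrite tnth_upd.
transitivity (tnth (rot_pair ord0 (lift ord0 j) th (cons_tuple w v)) (lift ord0 k)).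
  by rewrite [in RHS](tuple_eta (rot_pair _ _ _ _)) tnthS.
rewrite tnth_mktuple (inj_eq lift_inj) tnth0 !tnthS; case: eqP => // _.
by rewrite addrC mulNr.
Qed.

Lemma kresDE (g : R -> R) n (j : 'I_n) phi v : kresD g j phi v = \int[lam]_w ((g w)%:E *
  \int[lam]_(th in angles) phi (upd j (tnth v j * cos th - w * sin th)%R v)).
Proof.
apply: eq_integral => w _; congr (_ * _); apply: eq_integral => th _.
by rewrite behead_rot_pair.
Qed.

Variable g : R -> R.
Hypotheses (g_meas : measurable_fun setT g) (g_ge0 : forall w, (0 <= g w)%R).

(* As [th] runs over the circle, [tnth v j * cos th - w * sin th] sweeps
   [-|w|, |w|] at speed at most [|tnth v j| + |w|]. *)
Lemma kresD_ge n (j : 'I_n) (b C B : R) (phi : n.-tuple R -> \bar R) v : (0 < b)%R -> (0 < C)%R ->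
  (`|tnth v j| <= B)%R -> nnm phi ->
  (B + C)^-1%:E * (\int[lam]_w ((\1_(shell b C) w)%:E * (g w)%:E)) * avg b j phi v
    <= kresD g j phi v.
Proof.
move=> b0 C0 vB np; have ng : nnm (fun w : RR => (g w)%:E) := nnm_g g_meas g_ge0.
have B0 : (0 <= B)%R by apply: le_trans vB.
have BC : (0 < B + C)%R by rewrite ltr_wpDl.
have na := nnm_avg b j np.
have nS : nnm (fun w : RR => (\1_(shell b C) w)%:E * (g w)%:E).
  by apply: nnmM => //; exact: (nnm_indic R (measurable_shell _ _)).
have i0 : 0 <= (B + C)^-1%:E * avg b j phi v.
  by rewrite mule_ge0 ?(na.2 v)// lee_fin invr_ge0 ltW.
rewrite -muleA [X in _ * X]muleC muleA -nnm_integralZ// kresDE.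
have nu : nnm (fun x : RR => phi (upd j (x : R) v)) by exact: (nnm_pair2 v (nnm_updE j np)).
have nk : nnm (fun w : RR => \int[lam]_(th in angles) phi (upd j (tnth v j * cos th - w * sin th)%R v)).
  rewrite (_ : (fun w => _) = fun w => kpair ord0 (lift ord0 j)
    (fun u => phi [tuple of behead u]) (cons_tuple w v)); last first.
    by apply/funext => w; apply: eq_integral => th _; rewrite behead_rot_pair.
  exact: (nnm_pair2 v (nnm_cons_pair (nnm_kpair _ _ (nnm_behead np)))).
apply: nnm_le_integral; [exact: nnmZ|exact: nnmM|move=> w].
rewrite indicE; case: (boolP (w \in _)) => [/set_mem /andP[bw wC]|_]; last first.
  by rewrite mul0e mule0 mule_ge0 ?lee_fin// nk.2.
rewrite mul1e muleC; apply: lee_wpmul2l; first by rewrite lee_fin.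
apply: (@lipschitz_integral_ge R (fun th => tnth v j * cos th - w * sin th)%R (B + C)
  angles `[(- b)%R, b]%classic (fun x => phi (upd j x v))) => //.
- exact: rotation_continuous.
- by move=> x y; apply: rotation_lipschitz; exact: lerD.
- exact: measurable_angles.
- move=> y /=; rewrite in_itv/= => yb.
  by apply: rotation_onto; apply: le_trans bw; rewrite ler_norml.
Qed.

(** Only the listed coordinates are constrained: the chain of collisions consumes them one at a
    time. *)
Definition box n (B : R) (js : seq 'I_n) : set (n.-tuple R) :=
  [set v | all (fun j => `|tnth v j| <= B)%R js].

Lemma measurable_box n B (js : seq 'I_n) : measurable (box B js).
Proof.
elim: js => [|j js IH].
  by rewrite (_ : box B [::] = setT)//; apply/seteqP; split.
rewrite (_ : box B (j :: js) = (fun v => `|tnth v j|%R) @^-1` `]-oo, B]%classic `&` box B js).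
  apply: measurableI => //; rewrite -[X in measurable X]setTI.
  have : measurable_fun [set: n.-tuple R] (fun v : n.-tuple R => `|tnth v j|%R).
    by apply: measurableT_comp; [exact: normr_measurable|exact: measurable_tnth].
  by apply => //; exact: measurable_itv.
apply/seteqP; split => v /=; rewrite /box/= in_itv/=; first by case/andP.
by case=> -> ->.
Qed.

Lemma nnm_foldr_avg b n (js : seq 'I_n) (phi : n.-tuple R -> \bar R) : nnm phi ->
  nnm (foldr (avg b) phi js).
Proof. by move=> np; elim: js => //= j js; exact: nnm_avg. Qed.

(** Once every coordinate has been overwritten, nothing of [v] is left; this turns the chain of
    averages into the product form required of a minorization. *)
Lemma foldr_avg_cube b n (phi : n.-tuple R -> \bar R) (v : n.-tuple R) : nnm phi ->
  foldr (avg b) phi (enum 'I_n) v =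
  \int[lebn R n]_u (phi u * (\1_(box b (enum 'I_n)) u)%:E).
Proof.
elim: n phi v => [|n IH] phi v np.
  rewrite lebn0; last by apply: nnmM => //; exact: (nnm_indic R (measurable_box _ _)).
  rewrite (size0nil (size_enum_ord 0))/= indicE mem_set// mule1.
  by congr phi; exact: tuple0.
have lift_foldr (js : seq 'I_n) y t : foldr (avg b) phi (map (lift ord0) js) (cons_tuple y t) =
    foldr (avg b) (fun t => phi (cons_tuple y t)) js t.
  elim: js t => //= j js IHjs t; apply: eq_integral => x _.
  by rewrite upd_consS IHjs.
have nb : nnm (fun u => phi u * (\1_(box b (enum 'I_n.+1)) u)%:E).
  by apply: nnmM => //; exact: (nnm_indic R (measurable_box _ _)).
rewrite lebnS// enum_ordSl /= avgE; apply: eq_integral => y _.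
have -> : upd ord0 y v = cons_tuple y [tuple of behead v].
  have vE : v = cons_tuple (thead v) [tuple of behead v].
    by apply: val_inj; rewrite {1}(tuple_eta v).
  by rewrite {1}vE upd_cons0.
rewrite lift_foldr IH; last exact: nnm_section.
have ns : nnm (fun t => phi (cons_tuple y t)) by exact: nnm_section.
rewrite -nnm_integralZ//; last first.
  by apply: nnmM => //; exact: (nnm_indic R (measurable_box _ _)).
apply: eq_integral => t _; rewrite muleCA; congr (_ * _); rewrite -EFinM.
congr EFin; rewrite !indicE -natrM mulnb; congr (nat_of_bool _)%:R.
apply/idP/idP => [/andP[/set_mem + /set_mem]|/set_mem].
  rewrite /= in_itv/= => yb bt; apply/mem_set; rewrite /box/= tnth0 ler_norml yb/=.
  by rewrite all_map; apply: sub_all bt => k /=; rewrite tnthS.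
rewrite /box/= tnth0 ler_norml => /andP[yb]; rewrite all_map => bt.
apply/andP; split; apply/mem_set; rewrite /= ?in_itv//=.
by apply: sub_all bt => k /=; rewrite tnthS.
Qed.

(** The head of [js] collides first. Collisions with the reservoir change one velocity only and [js]
    has no repetition, so each particle still has its initial velocity, bounded by [B], when its
    turn comes, and [kresD_ge] applies with the same constant every time. *)
Lemma minorization_chain n (A : (n.-tuple R -> \bar R) -> n.-tuple R -> \bar R)
    (be b C B : R) (js : seq 'I_n) (f phi : n.-tuple R -> \bar R) :
  (0 <= be)%R -> (0 < b)%R -> (0 < C)%R -> (0 <= B)%R ->
  (forall f, nnm f -> nnm (A f)) ->
  (forall j f phi, nnm f -> nnm phi ->
     be%:E * \int[lebn R n]_v (phi v * kres g j f v) <= \int[lebn R n]_v (phi v * A f v)) ->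
  nnm f -> nnm phi -> uniq js ->
  (be%:E * ((B + C)^-1%:E * \int[lam]_w ((\1_(shell b C) w)%:E * (g w)%:E))) ^+ size js *
    \int[lebn R n]_v ((\1_(box B js) v)%:E * foldr (avg b) phi js v * f v)
  <= \int[lebn R n]_v (phi v * iter (size js) A f v).
Proof.
move=> be0 b0 C0 B0 nA Ab nf np; set c1 := _^-1%:E * _.
have c10 : 0 <= c1.
  rewrite mule_ge0 ?lee_fin ?invr_ge0 ?addr_ge0 ?(ltW C0)// nnm_integral_ge0//.
  apply: nnmM; first exact: (nnm_indic R (measurable_shell _ _)).
  exact: (nnm_g g_meas g_ge0).
have c0 : 0 <= be%:E * c1 by rewrite mule_ge0 ?lee_fin.
elim: js f nf => [|j js IH] f nf.
  move=> _; rewrite expe0 mul1e; apply: nnm_le_integral; [|exact: nnmM|].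
    by apply: nnmM => //; apply: nnmM => //; exact: (nnm_indic R (measurable_box _ _)).
  by move=> v; rewrite indicE mem_set// mul1e.
rewrite [uniq _]/= => /andP[jjs ujs]; rewrite [size _]/= iterSr.
apply: le_trans (IH _ (nA _ nf) ujs).
rewrite expeS [X in X * _]muleC -muleA; apply: lee_wpmul2l; first exact: expe_ge0.
set psi := fun v => (\1_(box B js) v)%:E * foldr (avg b) phi js v.
have npsi : nnm psi.
  by apply: nnmM; [exact: (nnm_indic R (measurable_box _ _))|exact: nnm_foldr_avg].
apply: le_trans (Ab j f psi nf npsi); rewrite -muleA.
apply: lee_wpmul2l; first by rewrite lee_fin.
have [_ _ ->//] := dual_pair_kres g_meas g_ge0 j.
have nk := nnm_kresD g_meas g_ge0 j npsi.
have nm : nnm (fun v => (\1_(box B (j :: js)) v)%:E * foldr (avg b) phi (j :: js) v * f v).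
  apply: nnmM => //; apply: nnmM; first exact: (nnm_indic R (measurable_box _ _)).
  exact: nnm_foldr_avg.
rewrite -nnm_integralZ//; apply: nnm_le_integral; [exact: nnmZ|exact: nnmM|move=> v].
rewrite muleA; apply: lee_wpmul2r; first exact: nf.2.
rewrite indicE; case: (boolP (v \in _)) => [/set_mem /andP[vj vjs]|_]; last first.
  by rewrite mul0e mule0 nk.2.
rewrite mul1e; apply: le_trans (kresD_ge b0 C0 vj npsi).
suff -> : avg b j psi v = foldr (avg b) phi (j :: js) v by [].
(* Overwriting coordinate [j] keeps the point in the box of the remaining indices, since [j] is not
   among them. *)
apply: eq_integral => x _; rewrite /psi indicE mem_set ?mul1e//.
rewrite /box/=; move: vjs jjs; elim: (js) => //= k s IHs /andP[vk vs].
rewrite inE negb_or => /andP[jk js']; rewrite IHs// andbT tnth_upd.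
by rewrite eq_sym (negbTE jk).
Qed.
End reservoir_sweep.

(** * The Kac operator *)

Section trigonometric_average.
Context (R : realType).
Local Open Scope ereal_scope.
Notation lam := (@lebesgue_measure R).
Notation RR := (measurableTypeR R).

(** Orthogonality of [1], [cos] and [sin] on the circle. Both kinds of collision turn the square of
    an affine function of the velocities into an integrand of this form. *)
Lemma integral_trig_square (L al be : R) :
  \int[lam]_(th in angles) ((L + al * cos th + be * sin th) ^+ 2)%:E =
  (2 * pi * L ^+ 2 + pi * (al ^+ 2 + be ^+ 2))%:E.
Proof.
pose c : R := (L ^+ 2 + (al ^+ 2 + be ^+ 2) / 2)%R.
(* The primitive after linearizing the squares: [c] is the mean value, the last two terms integrate
   the double angle part. *)
pose F : R -> R := (c *: id + (2 * L * al) *: sin - (2 * L * be) *: cos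
  + ((al ^+ 2 - be ^+ 2) / 2) *: (sin * cos) + (al * be) *: (sin * sin))%R.
have Fd (x : R) : is_derive x 1%R F ((L + al * cos x + be * sin x) ^+ 2)%R.
  have ds := is_derive_sin x; have dc := is_derive_cos x.
  have h1 := is_deriveZ c (is_derive_id x 1%R).
  have h2 := is_deriveZ (2 * L * al) ds.
  have h3 := is_deriveZ (2 * L * be) dc.
  have h4 := is_deriveZ ((al ^+ 2 - be ^+ 2) / 2) (is_deriveM ds dc).
  have h5 := is_deriveZ (al * be) (is_deriveM ds ds).
  apply: (is_derive_eq (is_deriveD (is_deriveD (is_deriveB (is_deriveD h1 h2) h3) h4) h5)).
  rewrite /GRing.scale/= /c.
  have cs := cos2Dsin2 x; move: cs; rewrite !expr2; set C := cos x; set S := sin x.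
  move=> cs; have -> : ((L + al * C + be * S) * (L + al * C + be * S) = L * L +
    (al * al + be * be) / 2 * (C * C + S * S) + (al * al - be * be) / 2 * (C * C - S * S)
     + 2 * L * al * C + 2 * L * be * S + 2 * al * be * (C * S))%R by field.
  by rewrite cs; field.
have Fc : continuous F.
  move=> x; have ? := Fd x.
  by apply/differentiable_continuous/derivable1_diffP.
rewrite /angles (@continuous_FTC2 _ _ F).
- rewrite -EFinB /F !fctE /GRing.scale/= mulr_natl cos2pi sin2pi cos0 sin0 /c.
  by congr EFin; field.
- by rewrite mulr_gt0// pi_gt0.
- apply: continuous_subspaceT => x.
  have cx : {for x, continuous (fun th => L + al * cos th + be * sin th)%R}.
    apply: cvgD; last by apply: cvgM; [exact: cvg_cst|exact: continuous_sin].
    apply: cvgD; first exact: cvg_cst.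
    by apply: cvgM; [exact: cvg_cst|exact: continuous_cos].
  exact: (cvgM cx cx).
- split => [x _||]; first by have ? := Fd x.
    by apply: cvg_at_right_filter; exact: Fc.
  by apply: cvg_at_left_filter; exact: Fc.
- by move=> x _; rewrite derive1E; have ? := Fd x; rewrite derive_val.
Qed.
End trigonometric_average.

(** * Collision averages of squares of affine functions *)

Section quadratic_observables.
Context (R : realType) (n : nat).
Local Open Scope ereal_scope.
Notation lam := (@lebesgue_measure R).
Notation RR := (measurableTypeR R).
Implicit Types (v : n.-tuple R) (i j k l : 'I_n).

(** Nonnegative, hence admissible in the duality, and rich enough: it contains the constant [1] and
    the squares [v_k ^ 2], and its coefficients can be polarized. *)
Definition quad k l (x0 x1 x2 : R) v : R := ((x0 + x1 * tnth v k + x2 * tnth v l) ^+ 2)%R.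

(** Mean over the angle. Coordinates involved in the collision leave the affine part, and each
    contributes its squared coefficient times half of the energy of the pair; the mixed term
    averages to zero even when [k] and [l] are the two colliding indices. *)
Definition quad_pair k l (x0 x1 x2 : R) i j v : R :=
  ((x0 + (if (k == i) || (k == j) then 0 else x1 * tnth v k)
       + (if (l == i) || (l == j) then 0 else x2 * tnth v l)) ^+ 2
   + ((if (k == i) || (k == j) then x1 ^+ 2 else 0)
      + (if (l == i) || (l == j) then x2 ^+ 2 else 0))
     * (tnth v i ^+ 2 + tnth v j ^+ 2) / 2)%R.

Definition quad_res (K : R) k l (x0 x1 x2 : R) j v : R :=
  ((x0 + (if k == j then 0 else x1 * tnth v k)
       + (if l == j then 0 else x2 * tnth v l)) ^+ 2
   + ((if k == j then x1 ^+ 2 else 0) + (if l == j then x2 ^+ 2 else 0))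
     * (tnth v j ^+ 2 + K) / 2)%R.

Lemma measurable_quad k l x0 x1 x2 : measurable_fun setT (quad k l x0 x1 x2).
Proof.
apply: measurable_funX; apply: measurable_funD; last first.
  by apply: measurable_funM => //; exact: measurable_tnth.
apply: measurable_funD => //.
by apply: measurable_funM => //; exact: measurable_tnth.
Qed.

Lemma nnm_quad k l x0 x1 x2 : nnm (fun v => (quad k l x0 x1 x2 v)%:E).
Proof.
by apply: nnm_EFin; [exact: measurable_quad|move=> v; exact: sqr_ge0].
Qed.

Lemma kpair_quad k l x0 x1 x2 i j v : k != l -> i != j ->
  kpair i j (fun v => (quad k l x0 x1 x2 v)%:E) v =
  (2 * pi * quad_pair k l x0 x1 x2 i j v)%:E.
Proof.
move=> kl ij; pose L : R := (x0 + (if (k == i) || (k == j) then 0 else x1 * tnth v k)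
       + (if (l == i) || (l == j) then 0 else x2 * tnth v l))%R.
pose al : R := ((if k == i then x1 * tnth v i else if k == j then x1 * tnth v j else 0)
  + (if l == i then x2 * tnth v i else if l == j then x2 * tnth v j else 0))%R.
pose be : R := ((if k == i then x1 * tnth v j else if k == j then - (x1 * tnth v i) else 0)
  + (if l == i then x2 * tnth v j else if l == j then - (x2 * tnth v i) else 0))%R.
transitivity (\int[lam]_(th in angles) ((L + al * cos th + be * sin th) ^+ 2)%:E).
  apply: eq_integral => th _; rewrite /quad !tnth_mktuple; congr EFin.
  congr (_ ^+ 2)%R; rewrite /L /al /be.
  by case: (k == i); case: (k == j); case: (l == i); case: (l == j) => /=; ring.
rewrite integral_trig_square; congr EFin; rewrite /quad_pair -/L /al /be.
case: (eqVneq k i) => [ki|ki]; case: (eqVneq k j) => [kj|kj];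
case: (eqVneq l i) => [li|li]; case: (eqVneq l j) => [lj|lj] /=;
  try (by exfalso; move: kl ij; rewrite ?ki ?kj ?li ?lj ?eqxx);
  try (by exfalso; move: ij; rewrite -?ki -?kj -?li -?lj ?eqxx); by field.
Qed.

Variables (g : R -> R) (K : R).
Hypotheses (g_meas : measurable_fun setT g) (g_ge0 : forall w, (0 <= g w)%R).
Hypothesis g_mass : \int[lam]_w (g w)%:E = 1.
Hypothesis g_K : \int[lam]_w (w ^+ 2 * g w)%:E = K%:E.

Lemma integral_g_quad (c0 c1 : R) : (0 <= c0)%R -> (0 <= c1)%R ->
  \int[lam]_w ((g w)%:E * (c0 + c1 * w ^+ 2)%:E) = (c0 + c1 * K)%:E.
Proof.
move=> c00 c10; have ng : nnm (fun w : RR => (g w)%:E) := nnm_g g_meas g_ge0.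
have nw : nnm (fun w : RR => (w ^+ 2 * g w)%:E).
  have mw : measurable_fun [set: R] (fun w : R => w ^+ 2 * g w)%R.
    by apply: measurable_funM => //; apply: measurable_funX; exact: measurable_id.
  by apply: (nnm_EFin (T := RR) mw) => w; rewrite mulr_ge0// sqr_ge0.
transitivity (\int[lam]_w (c0%:E * (g w)%:E + c1%:E * (w ^+ 2 * g w)%:E)).
  by apply: eq_integral => w _; rewrite -!EFinM -EFinD; congr EFin; ring.
rewrite nnm_integralD ?nnm_integralZ ?lee_fin//; try exact: nnmZ.
by rewrite g_mass g_K mule1.
Qed.

Lemma kresD_quad k l x0 x1 x2 j v : k != l ->
  kresD g j (fun v => (quad k l x0 x1 x2 v)%:E) v =
  (2 * pi * quad_res K k l x0 x1 x2 j v)%:E.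
Proof.
move=> kl; pose L : R := (x0 + (if k == j then 0 else x1 * tnth v k)
       + (if l == j then 0 else x2 * tnth v l))%R.
pose a : R := ((if k == j then x1 else 0) + (if l == j then x2 else 0))%R.
have p0 : (0 <= pi :> R)%R by exact: pi_ge0.
rewrite kresDE; transitivity (\int[lam]_w ((g w)%:E *
   ((2 * pi * L ^+ 2 + pi * (a * tnth v j) ^+ 2) + pi * a ^+ 2 * w ^+ 2)%:E)).
  apply: eq_integral => w _; congr (_ * _).
  transitivity (\int[lam]_(th in angles)
     ((L + (a * tnth v j) * cos th + (- (a * w)) * sin th) ^+ 2)%:E).
    apply: eq_integral => th _; rewrite /quad !tnth_upd; congr EFin.
    congr (_ ^+ 2)%R; rewrite /L /a.
    by case: (k == j); case: (l == j); ring.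
  by rewrite integral_trig_square; congr EFin; ring.
rewrite integral_g_quad; last 2 first.
- by apply: addr_ge0; apply: mulr_ge0; rewrite ?sqr_ge0 ?mulr_ge0.
- by apply: mulr_ge0 => //; exact: sqr_ge0.
congr EFin; rewrite /quad_res -/L /a.
case: (eqVneq k j) => [kj|kj]; case: (eqVneq l j) => [lj|lj];
  try (by exfalso; move: kl; rewrite kj lj eqxx); by field.
Qed.
End quadratic_observables.

(** * Drift, minorization and invariant density of the collision operator *)

Section kac_operator.
Context (R : realType) (N : nat).
Local Open Scope ereal_scope.
Notation lam := (@lebesgue_measure R).
Notation RR := (measurableTypeR R).
Variables (la mu : R) (g : R -> R) (K : R).
Hypotheses (hN : (2 <= N)%N) (la0 : (0 < la)%R) (mu0 : (0 < mu)%R).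
Hypotheses (g_meas : measurable_fun setT g) (g_ge0 : forall w, (0 <= g w)%R).
Hypothesis g_mass : \int[lam]_w (g w)%:E = 1.
Hypothesis g_K : \int[lam]_w (w ^+ 2 * g w)%:E = K%:E.
Implicit Types (v : N.-tuple R) (f phi : N.-tuple R -> \bar R).

(** Collisions occur at total rate [(la + mu) * N], of which a given pair has the share
    [la * N / 'C(N, 2)] and a given particle with the reservoir [mu]; the [2 * pi] normalizes the
    angular integrals. *)
Definition pair_weight : R := (la * N%:R / ('C(N, 2)%:R * (2 * pi) * ((la + mu) * N%:R)))%R.
Definition res_weight : R := (mu / (2 * pi * ((la + mu) * N%:R)))%R.

(* [Aop] is [(la * N * Q + mu * \sum_j R_j) / ((la + mu) * N)], so that
   [L F = (la + mu) * N * (Aop F - F)]. *)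
Definition Aop f v : \bar R :=
  \sum_(i < N) \sum_(j < N | (i < j)%N) pair_weight%:E * kpair i j f v
  + \sum_(j < N) res_weight%:E * kres g j f v.

Definition Bop phi v : \bar R :=
  \sum_(i < N) \sum_(j < N | (i < j)%N) pair_weight%:E * kpair j i phi v
  + \sum_(j < N) res_weight%:E * kresD g j phi v.

Let N0 : (0 < N%:R :> R)%R. Proof. by rewrite ltr0n; case: N hN. Qed.
Let W0 : (0 < (la + mu) * N%:R :> R)%R. Proof. by rewrite mulr_gt0// addr_gt0. Qed.
Let pi2 : (0 < 2 * pi :> R)%R. Proof. by rewrite mulr_gt0// pi_gt0. Qed.
Let C0 : (0 < 'C(N, 2)%:R :> R)%R. Proof. by rewrite ltr0n bin_gt0. Qed.

Lemma pair_weight_gt0 : (0 < pair_weight)%R.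
Proof.
apply: divr_gt0; first exact: mulr_gt0.
by apply: mulr_gt0 => //; exact: mulr_gt0.
Qed.
Let pw0 : (0 <= pair_weight)%R. Proof. exact/ltW/pair_weight_gt0. Qed.

Lemma res_weight_gt0 : (0 < res_weight)%R.
Proof. by rewrite divr_gt0// mulr_gt0. Qed.
Let rw0 : (0 <= res_weight)%R. Proof. exact/ltW/res_weight_gt0. Qed.

(** Probabilities that the next collision is that of a given pair ([P2]), or of a given particle
    with the reservoir ([Q1]). *)
Let P2 : R := (pair_weight * (2 * pi))%R.
Let Q1 : R := (res_weight * (2 * pi))%R.

Lemma sum_pairs (x : R) : (\sum_(i < N) \sum_(j < N | (i < j)%N) x = 'C(N, 2)%:R * x)%R.
Proof.
rewrite (exchange_big_dep predT)//= -bin2_sum big_mkord natr_sum mulr_suml.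
apply: eq_bigr => j _; rewrite -(big_ord_widen N (fun=> x)); last exact/ltnW.
by rewrite sumr_const card_ord mulr_natl.
Qed.

Lemma weights_sum : ('C(N, 2)%:R * P2 + N%:R * Q1 = 1)%R.
Proof.
rewrite /P2 /Q1 /pair_weight /res_weight.
move: (pi_gt0 R); generalize (pi : R) => p p0; field.
by rewrite !gt_eqF//= ?addr_gt0.
Qed.

Lemma dual_pair_op : dual_pair (lebn R N) Aop Bop.
Proof.
apply: dual_pairD; apply: dual_pair_sum => i _.
  apply: dual_pair_sum => j ij; apply: dual_pairZ; first by rewrite lee_fin.
  by apply: dual_pair_kpair; apply/eqP => ijE; rewrite ijE ltnn in ij.
by apply: dual_pairZ; [rewrite lee_fin|exact: dual_pair_kres].
Qed.

Let nA f : nnm f -> nnm (Aop f). Proof. by case: dual_pair_op => + _ _; apply. Qed.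
Let nB f : nnm f -> nnm (Bop f). Proof. by case: dual_pair_op => _ + _; apply. Qed.

Definition quad_mean k l x0 x1 x2 v : R :=
  (\sum_(i < N) \sum_(j < N | (i < j)%N) P2 * quad_pair k l x0 x1 x2 j i v
   + \sum_(j < N) Q1 * quad_res K k l x0 x1 x2 j v)%R.

Lemma Bop_quad (k l : 'I_N) x0 x1 x2 v : k != l ->
  Bop (fun v => (quad k l x0 x1 x2 v)%:E) v = (quad_mean k l x0 x1 x2 v)%:E.
Proof.
move=> kl; rewrite /Bop /quad_mean EFinD -!sumEFin; congr (_ + _).
  apply: eq_bigr => i _; rewrite -sumEFin; apply: eq_bigr => j ij.
  rewrite kpair_quad//; last by apply/eqP => ijE; rewrite ijE ltnn in ij.
  by rewrite -EFinM mulrA.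
by apply: eq_bigr => j _; rewrite (kresD_quad g_meas g_ge0 g_mass g_K)// -EFinM mulrA.
Qed.

(** The formulas for [quad] ask for two distinct indices even when one coefficient is zero; [hN]
    supplies a partner for each index. *)
Lemma other_index : exists oth : 'I_N -> 'I_N, forall k, k != oth k.
Proof.
have N1 : (0 < N)%N by exact: ltnW.
exists (fun k => if k == Ordinal N1 then Ordinal hN else Ordinal N1) => k.
by case: (eqVneq k (Ordinal N1)) => [->|//]; apply/eqP => /(congr1 val).
Qed.

Lemma Bop1 v : Bop (fun=> 1) v = 1.
Proof.
have [oth othP] := other_index; pose k : 'I_N := Ordinal hN.
have -> : (fun=> 1) = (fun v => (quad k (oth k) 1 0 0 v)%:E) :> (N.-tuple R -> \bar R).
  by apply/funext => u; rewrite /quad !mul0r !addr0 expr1n.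
rewrite Bop_quad//; congr EFin; rewrite -[RHS]weights_sum -sum_pairs /quad_mean.
congr (_ + _)%R; last first.
  rewrite mulr_natl -[N in RHS]card_ord -sumr_const; apply: eq_bigr => j _.
  by rewrite /quad_res !mul0r !expr0n/= !if_same !addr0 expr1n !mul0r addr0 mulr1.
apply: eq_bigr => i _; apply: eq_bigr => j _.
by rewrite /quad_pair !mul0r !expr0n/= !if_same !addr0 expr1n !mul0r addr0 mulr1.
Qed.

Lemma mass_preserving_op : mass_preserving (lebn R N) Aop.
Proof.
move=> f nf; have [_ _ /(_ _ _ nf (nnm_cst _ lee01))] := dual_pair_op.
under eq_integral do rewrite mul1e.
by move=> ->; apply: eq_integral => v _; rewrite Bop1 mul1e.
Qed.

Definition energy v : R := (\sum_(k < N) tnth v k ^+ 2)%R.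

Lemma sum_except2 (i j : 'I_N) (c : R) (a : 'I_N -> R) : i != j ->
  (\sum_(k < N) (if (k == i) || (k == j) then c else a k) = \sum_(k < N) a k - a i - a j + c + c)%R.
Proof.
move=> ij; have ji : j != i by rewrite eq_sym.
rewrite (bigD1 i)//= (bigD1 j)//= eqxx/= eqxx orbT.
rewrite [in RHS](bigD1 i)//= [in RHS](bigD1 j)//=.
rewrite (eq_bigr a) => [|k /andP[/negbTE-> /negbTE->]//]; ring.
Qed.

Lemma sum_except1 (j : 'I_N) (c : R) (a : 'I_N -> R) :
  (\sum_(k < N) (if k == j then c else a k) = \sum_(k < N) a k - a j + c)%R.
Proof.
rewrite (bigD1 j)//= eqxx [in RHS](bigD1 j)//=.
rewrite (eq_bigr a) => [|k /negbTE->//]; ring.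
Qed.

Lemma quad_pair_sq k l i j v : quad_pair k l 0 1 0 i j v =
  (if (k == i) || (k == j) then (tnth v i ^+ 2 + tnth v j ^+ 2) / 2 else tnth v k ^+ 2)%R.
Proof.
by rewrite /quad_pair !mul0r !expr0n/= !if_same !addr0 add0r; case: ifP => _;
  rewrite ?expr0n ?expr1n/= ?mul1r ?mul0r ?add0r ?addr0.
Qed.

Lemma quad_res_sq k l j v : quad_res K k l 0 1 0 j v =
  (if k == j then (tnth v j ^+ 2 + K) / 2 else tnth v k ^+ 2)%R.
Proof.
by rewrite /quad_res !mul0r !expr0n/= !if_same !addr0 add0r; case: ifP => _;
  rewrite ?expr0n ?expr1n/= ?mul1r ?mul0r ?add0r ?addr0.
Qed.

(** Pair collisions conserve the energy. The reservoir, with probability [Q1] for each particle,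
    replaces [v_j ^ 2] by its mean with [K], which removes the fraction [Q1 / 2] of the energy. *)
Lemma quad_mean_energy (oth : 'I_N -> 'I_N) v :
  (\sum_(k < N) quad_mean k (oth k) 0 1 0 v = (1 - Q1 / 2) * energy v + N%:R * Q1 * K / 2)%R.
Proof.
rewrite big_split/= exchange_big/=.
have -> : (\sum_(i < N) \sum_(k < N) \sum_(j < N | (i < j)%N) P2 * quad_pair k (oth k) 0 1 0 j i v
   = 'C(N, 2)%:R * (P2 * energy v))%R.
  rewrite -sum_pairs; apply: eq_bigr => i _; rewrite exchange_big/=.
  apply: eq_bigr => j ij; rewrite -mulr_sumr; congr (_ * _)%R.
  have ji : j != i by apply/eqP => ijE; rewrite ijE ltnn in ij.
  under eq_bigr do rewrite quad_pair_sq.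
  by rewrite (sum_except2 _ (fun k => tnth v k ^+ 2)%R ji) /energy; field.
rewrite exchange_big/=.
under [X in (_ + X)%R]eq_bigr => j _.
  rewrite -mulr_sumr; under eq_bigr do rewrite quad_res_sq.
  rewrite (sum_except1 _ _ (fun k => tnth v k ^+ 2)%R) -/(energy v).
  rewrite (_ : Q1 * _ = Q1 * energy v + Q1 * K / 2 - Q1 / 2 * tnth v j ^+ 2)%R; last by field.
  over.
rewrite sumrB -mulr_sumr -/(energy v) sumr_const card_ord -mulr_natl.
have -> : ((1 - Q1 / 2) * energy v + N%:R * Q1 * K / 2 =
  ('C(N, 2)%:R * P2 + N%:R * Q1 - Q1 / 2) * energy v + N%:R * Q1 * K / 2)%R.
  by rewrite weights_sum.
ring.
Qed.

Lemma measurable_energy : measurable_fun setT energy.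
Proof.
apply: measurable_sum => k; apply: measurable_funX; exact: measurable_tnth.
Qed.

Lemma energy_ge0 v : (0 <= energy v)%R.
Proof. by apply: sumr_ge0 => k _; exact: sqr_ge0. Qed.

Lemma nnm_energy : nnm (fun v => (energy v)%:E).
Proof. by apply: nnm_EFin; [exact: measurable_energy|exact: energy_ge0]. Qed.

Let K0 : (0 <= K)%R.
Proof.
rewrite -lee_fin -g_K; apply: integral_ge0 => w _.
by rewrite lee_fin mulr_ge0// sqr_ge0.
Qed.

Lemma Q1_gt0 : (0 < Q1)%R. Proof. by rewrite mulr_gt0// res_weight_gt0. Qed.

Lemma Q1_le1 : (Q1 <= 1)%R.
Proof.
have P20 : (0 <= P2)%R by rewrite mulr_ge0// ltW.
have Q0 := ltW Q1_gt0; have N1 : (1 <= N%:R :> R)%R by rewrite ler1n; case: N hN.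
rewrite -weights_sum; apply: (@le_trans _ _ (N%:R * Q1)%R).
  by rewrite ler_peMl.
by rewrite lerDr mulr_ge0// ltW.
Qed.

Lemma energy_drift f : nnm f ->
  \int[lebn R N]_v ((energy v)%:E * Aop f v) =
  (1 - Q1 / 2)%:E * (\int[lebn R N]_v ((energy v)%:E * f v))
  + (N%:R * Q1 * K / 2)%:E * \int[lebn R N]_v f v.
Proof.
move=> nf; have [oth othP] := other_index.
have nq k := nnm_quad k (oth k) (0 : R)%R 1%R 0%R.
have nBq k := nB (nq k).
have eE u : (energy u)%:E = \sum_(k < N) (quad k (oth k) 0 1 0 u)%:E.
  rewrite sumEFin; congr EFin; apply: eq_bigr => k _.
  by rewrite /quad mul1r mul0r add0r addr0.
transitivity (\sum_(k < N) \int[lebn R N]_v ((quad k (oth k) 0 1 0 v)%:E * Aop f v)).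
  rewrite -nnm_integral_sum; last by move=> k _; apply: nnmM => //; exact: nA.
  apply: eq_integral => v _; rewrite eE ge0_sume_distrl// => k _.
  exact: (nq k).2.
have [_ _ dual] := dual_pair_op.
rewrite (eq_bigr (fun k => \int[lebn R N]_v
   (Bop (fun v => (quad k (oth k) 0 1 0 v)%:E) v * f v))) => [|k _]; last by rewrite dual.
rewrite -nnm_integral_sum; last by move=> k _; exact: nnmM.
have g1 : (0 <= 1 - Q1 / 2)%R by have := Q1_le1; have := Q1_gt0; lra.
have k1 : (0 <= N%:R * Q1 * K / 2)%R.
  have Q0 := ltW Q1_gt0; have N0' := ltW N0.
  by apply: divr_ge0 => //; do 2 apply: mulr_ge0 => //.
have nef : nnm (fun v => (energy v)%:E * f v) by apply: nnmM => //; exact: nnm_energy.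
rewrite -!nnm_integralZ ?lee_fin// -nnm_integralD; [|exact: nnmZ..].
apply: eq_integral => v _; rewrite -ge0_sume_distrl; last by move=> k _; exact: (nBq k).2.
rewrite (eq_bigr (fun k => (quad_mean k (oth k) 0 1 0 v)%:E)) => [|k _]; last by rewrite Bop_quad.
rewrite sumEFin quad_mean_energy EFinD muleA ge0_muleDl ?lee_fin//.
by rewrite mulr_ge0// energy_ge0.
Qed.

(** One contraction factor is kept, the others are bounded by 1 while the constants add up: a factor
    below 1 is all that a drift condition asks for. *)
Lemma energy_drift_iter n f : nnm f ->
  \int[lebn R N]_v ((energy v)%:E * iter n.+1 Aop f v) <=
  (1 - Q1 / 2)%:E * (\int[lebn R N]_v ((energy v)%:E * f v))
  + (n.+1%:R * (N%:R * Q1 * K / 2))%:E * \int[lebn R N]_v f v.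
Proof.
have g1 : (0 <= 1 - Q1 / 2)%R by have := Q1_le1; have := Q1_gt0; lra.
have g2 : (1 - Q1 / 2 <= 1)%R by have := Q1_gt0; lra.
have k1 : (0 <= N%:R * Q1 * K / 2)%R.
  have Q0 := ltW Q1_gt0; have N0' := ltW N0.
  by apply: divr_ge0 => //; do 2 apply: mulr_ge0 => //.
move=> nf; have nef : nnm (fun v => (energy v)%:E * f v) by apply: nnmM => //; exact: nnm_energy.
have I0 := nnm_integral_ge0 (lebn R N) nef; have J0 := nnm_integral_ge0 (lebn R N) nf.
elim: n => [|n IH]; first by rewrite /= energy_drift// mul1r.
have nit : nnm (iter n.+1 Aop f).
  by case: (dual_pair_iter n.+1 dual_pair_op) => + _ _; apply.
rewrite iterS energy_drift// (mass_preserving_iter _ _ mass_preserving_op)//.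
apply: (@le_trans _ _ ((1 - Q1 / 2)%:E * ((1 - Q1 / 2)%:E * (\int[lebn R N]_v ((energy v)%:E * f v))
  + (n.+1%:R * (N%:R * Q1 * K / 2))%:E * \int[lebn R N]_v f v)
  + (N%:R * Q1 * K / 2)%:E * \int[lebn R N]_v f v)).
  by apply: leeD2r; apply: lee_wpmul2l; rewrite ?lee_fin.
move: k1; set c := (N%:R * Q1 * K / 2)%R in IH *; move=> k1.
have k2 : (0 <= n.+1%:R * c)%R by rewrite mulr_ge0.
have -> : (n.+2%:R * c)%:E = (n.+1%:R * c)%:E + c%:E.
  by rewrite -EFinD -[n.+2%:R]natr1 mulrDl mul1r.
rewrite [in leRHS]ge0_muleDl ?lee_fin// [leRHS]addeA.
apply: leeD2r; set X := _ + _.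
have X0 : 0 <= X by apply: adde_ge0; apply: mule_ge0; rewrite ?lee_fin.
by rewrite -[leRHS]mul1e; apply: lee_wpmul2r; rewrite ?lee_fin.
Qed.

Lemma kres_le_op (j : 'I_N) f phi : nnm f -> nnm phi ->
  res_weight%:E * \int[lebn R N]_v (phi v * kres g j f v) <=
  \int[lebn R N]_v (phi v * Aop f v).
Proof.
move=> nf np; have nk i := nnm_kres g_meas g_ge0 i nf.
rewrite -nnm_integralZ ?lee_fin//; last exact: nnmM.
apply: nnm_le_integral; first by apply: nnmZ; rewrite ?lee_fin//; exact: nnmM.
  by apply: nnmM => //; exact: nA.
move=> v; rewrite muleCA; apply: lee_wpmul2l; first exact: np.2.
rewrite /Aop -[leLHS]add0e; apply: leeD.
  apply: sume_ge0 => i _; apply: sume_ge0 => k _; rewrite mule_ge0 ?lee_fin//.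
  exact: (nnm_kpair i k nf).2.
rewrite (bigD1 j)//= leeDl//.
by apply: sume_ge0 => i _; rewrite mule_ge0 ?lee_fin// (nk i).2.
Qed.

Lemma foldr_avg1 (b : R) (js : seq 'I_N) v : (0 <= b)%R ->
  foldr (avg b) (fun=> 1) js v = (((2 * b) ^+ size js)%R)%:E.
Proof.
move=> b0; elim: js v => [|j js IH] v //=.
rewrite avgE; under eq_integral do rewrite IH.
rewrite -integral_indicE; last exact: measurable_itv.
rewrite integral_cst; last exact: measurable_itv.
rewrite /= lebesgue_measure_itv/= lte_fin exprS; case: ltP => bb.
  by rewrite -EFinB -EFinM; congr EFin; ring.
have -> : b = 0%R by apply/eqP; rewrite eq_le b0 andbT; lra.
by rewrite mule0 mulr0 mul0r.
Qed.

Lemma measure_cube (b : R) : (0 <= b)%R ->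
  (lebn R N : {measure set _ -> \bar R}) (box b (enum 'I_N)) = (((2 * b) ^+ N)%R)%:E.
Proof.
move=> b0; have n1 : nnm (fun _ : N.-tuple R => 1 : \bar R) by exact: nnm_cst.
have := foldr_avg_cube b [tuple 0%R | _ < N] n1.
rewrite foldr_avg1// size_enum_ord => ->; under [RHS]eq_integral do rewrite mul1e.
by rewrite integral_indic// ?setIT//; exact: measurable_box.
Qed.

Lemma energy_cube_lty (b : R) : (0 <= b)%R ->
  \int[lebn R N]_v ((energy v)%:E * (\1_(box b (enum 'I_N)) v)%:E) < +oo.
Proof.
move=> b0; have nD := nnm_indic R (measurable_box b (enum 'I_N)).
have Nb : (0 <= N%:R * b ^+ 2)%R by rewrite mulr_ge0// sqr_ge0.
apply: (@le_lt_trans _ _ (\int[lebn R N]_v ((N%:R * b ^+ 2)%:E * (\1_(box b (enum 'I_N)) v)%:E))).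
  apply: nnm_le_integral; [exact: (nnmM nnm_energy)|by apply: nnmZ; rewrite ?lee_fin|].
  move=> v; rewrite indicE; case: (boolP (v \in _)) => [/set_mem vb|_]; last by rewrite !mule0.
  rewrite !mule1 lee_fin mulr_natl -[N in leRHS]card_ord -sumr_const.
  apply: ler_sum => k _; rewrite -real_normK ?num_real// ler_pXn2r ?nnegrE//.
  by move/allP : vb; apply; rewrite mem_enum.
have I1 : \int[lebn R N]_v (\1_(box b (enum 'I_N)) v)%:E = (((2 * b) ^+ N)%R)%:E.
  by rewrite integral_indic ?setIT//; [exact: measure_cube|exact: measurable_box].
by rewrite nnm_integralZ ?lee_fin// I1 -EFinM ltry.
Qed.

(** In a chain of [N] steps, only the history where the particles meet the reservoir in the order of
    [enum 'I_N] is retained; it is minorized on the box of side [B], which contains the energy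
    ball. *)
Lemma op_minor (b C : R) : (0 < b)%R -> (0 < C)%R ->
  0 < \int[lam]_w ((\1_(shell b C) w)%:E * (g w)%:E) ->
  forall r : R, exists2 c : R, (0 < c)%R &
  forall f phi, nnm f -> nnm phi ->
    c%:E * (\int[lebn R N]_v ((\1_[set v | (energy v <= r)%R] v)%:E * f v))
     * \int[lebn R N]_v (phi v * (\1_(box b (enum 'I_N)) v)%:E)
      <= \int[lebn R N]_v (phi v * iter N Aop f v).
Proof.
(* [B] bounds every velocity on the energy ball, because [v_k ^ 2 <= |r| <= (|r| + 1) ^ 2]. *)
move=> b0 C0' G0 r; pose B : R := (`|r| + 1)%R.
have B0 : (0 <= B)%R by rewrite addr_ge0.
pose G := fine (\int[lam]_w ((\1_(shell b C) w)%:E * (g w)%:E)).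
have GE : \int[lam]_w ((\1_(shell b C) w)%:E * (g w)%:E) = G%:E.
  rewrite fineK// ge0_fin_numE; last exact: ltW.
  apply: (@le_lt_trans _ _ (\int[lam]_w (g w)%:E)); last by rewrite g_mass ltry.
  have ng : nnm (fun w : RR => (g w)%:E) := nnm_g g_meas g_ge0.
  apply: nnm_le_integral => //.
    by apply: nnmM => //; exact: (nnm_indic R (measurable_shell _ _)).
  move=> w; rewrite indicE; case: (w \in _); rewrite ?mul1e ?mul0e//.
  by rewrite lee_fin.
have {}G0 : (0 < G)%R by rewrite -lte_fin -GE.
(* One factor per collision: its weight, the mass [G] of the shell, and the inverse of the largest
   sweeping speed. *)
pose c := ((res_weight * ((B + C)^-1 * G)) ^+ N)%R.
have c0 : (0 < c)%R.
  apply: exprn_gt0; apply: mulr_gt0; first exact: res_weight_gt0.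
  by apply: mulr_gt0 => //; rewrite invr_gt0 ltr_wpDl.
exists c => // f phi nf np.
have := minorization_chain g_meas g_ge0 rw0 b0 C0' B0 nA kres_le_op nf np (enum_uniq 'I_N).
rewrite size_enum_ord GE -!EFinM -EFin_expe -/c; apply: le_trans; rewrite -muleA.
apply: lee_wpmul2l; first by rewrite lee_fin ltW.
set I := \int[_]_v (phi v * _).
have nI : 0 <= I.
  apply: nnm_integral_ge0; apply: nnmM => //.
  exact: (nnm_indic R (measurable_box _ _)).
have mE : measurable [set v | (energy v <= r)%R].
  rewrite (_ : [set v | _] = energy @^-1` `]-oo, r]); last first.
    by apply/seteqP; split => x /=; rewrite in_itv/=.
  rewrite -[X in measurable X]setTI; apply: measurable_energy => //.
have nE := nnm_indic R mE.
have nb := nnm_indic R (measurable_box B (enum 'I_N)).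
rewrite muleC -nnm_integralZ//; last exact: nnmM.
apply: nnm_le_integral.
- by apply: nnmZ => //; exact: nnmM.
- by apply: nnmM => //; apply: nnmM => //; exact: nnm_foldr_avg.
move=> v; rewrite foldr_avg_cube// -/I muleA; apply: lee_wpmul2r; first exact: nf.2.
rewrite [leRHS]muleC; apply: lee_wpmul2l => //; rewrite lee_fin !indicE.
case: (boolP (v \in [set v | (energy v <= r)%R])) => //= /set_mem /= vr.
rewrite mem_set// /box/=; apply/allP => k _.
have kr : (tnth v k ^+ 2 <= r)%R.
  apply: le_trans vr; rewrite /energy (bigD1 k)//= lerDl.
  by apply: sumr_ge0 => i _; exact: sqr_ge0.
rewrite -(ler_pXn2r (isT : (0 < 2)%N)) ?nnegrE// real_normK ?num_real//.
apply: (le_trans kr); apply: (le_trans (ler_norm r)).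
by rewrite /B expr2; have := normr_ge0 r; nra.
Qed.

Lemma op_unique f h : nnm f -> nnm h ->
  \int[lebn R N]_v f v = 1 -> \int[lebn R N]_v h v = 1 ->
  {ae lebn R N, forall v, iter N Aop f v = f v} ->
  {ae lebn R N, forall v, iter N Aop h v = h v} ->
  {ae lebn R N, forall v, f v = h v}.
Proof.
have [b [C [b0 C0' G0]]] := shell_mass g_meas g_ge0 g_mass.
have dP := dual_pair_iter N dual_pair_op.
have mP := mass_preserving_iter N nA mass_preserving_op.
apply: (harris_unique dP mP measurable_energy (measurable_box b (enum 'I_N))).
  by rewrite measure_cube ?ltW// lte_fin exprn_gt0// mulr_gt0.
exact: (op_minor b0 C0' G0).
Qed.

Lemma op_iter_invariant f n : nnm f -> \int[lebn R N]_v f v < +oo ->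
  {ae lebn R N, forall v, Aop f v = f v} ->
  {ae lebn R N, forall v, iter n Aop f v = f v}.
Proof.
move=> nf foo Af; elim: n => [|n IH]; first exact: aeW.
have nit : nnm (iter n Aop f) by case: (dual_pair_iter n dual_pair_op) => + _ _; apply.
have itoo : \int[lebn R N]_v iter n Aop f v < +oo.
  by rewrite (mass_preserving_iter n nA mass_preserving_op nf).
have H := dual_pair_ae dual_pair_op mass_preserving_op nit nf itoo IH.
by apply: filterS2 H Af => v /= -> ->.
Qed.

Lemma op_exists : exists F, [/\ nnm F, \int[lebn R N]_v F v = 1,
  \int[lebn R N]_v ((energy v)%:E * F v) < +oo &
  {ae lebn R N, forall v, Aop F v = F v}].
Proof.
have [b [C [b0 C0' G0]]] := shell_mass g_meas g_ge0 g_mass.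
have dP := dual_pair_iter N dual_pair_op.
have mP := mass_preserving_iter N nA mass_preserving_op.
have mD := measurable_box b (enum 'I_N).
have D0 : 0 < (lebn R N : {measure set _ -> \bar R}) (box b (enum 'I_N)).
  by rewrite measure_cube ?ltW// lte_fin exprn_gt0// mulr_gt0.
have Doo : (lebn R N : {measure set _ -> \bar R}) (box b (enum 'I_N)) < +oo by rewrite measure_cube ?ltW// ltry.
have Q0 := Q1_gt0; have Q11 := Q1_le1.
have NE : N = N.-1.+1 by rewrite prednK// ltnW.
have [F [nF F1 VF PF]] : exists F, [/\ nnm F, \int[lebn R N]_v F v = 1,
    \int[lebn R N]_v ((energy v)%:E * F v) < +oo &
    {ae lebn R N, forall v, iter N Aop F v = F v}].
  apply: (harris_exists dP mP measurable_energy energy_ge0 mD D0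
    (op_minor b0 C0' G0) Doo (energy_cube_lty (ltW b0))
    (gamma := (1 - Q1 / 2)%R) (K := (N%:R * (N%:R * Q1 * K / 2))%R)).
  - by lra.
  - by lra.
  - have N0' := ltW N0; have Q0' := ltW Q0; apply: mulr_ge0 => //.
    by apply: divr_ge0 => //; do 2 apply: mulr_ge0 => //.
  - by move=> f nf; have := energy_drift_iter N.-1 nf; rewrite -NE.
exists F; split => //.
(* [Aop F] has mass one and is invariant under the [N]-th power as well, so it coincides with
   [F]. *)
have AF1 : \int[lebn R N]_v Aop F v = 1 by rewrite mass_preserving_op.
have Foo : \int[lebn R N]_v F v < +oo by rewrite F1 ltry.
apply: op_unique => //; first exact: nA.
have nit : nnm (iter N Aop F) by case: dP => + _ _; apply.
have itoo : \int[lebn R N]_v iter N Aop F v < +oo by rewrite (mP _ nF).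
have H := dual_pair_ae dual_pair_op mass_preserving_op nit nF itoo PF.
apply: filterS H => v /= <-.
by rewrite -iterSr.
Qed.
End kac_operator.

(** * Moments *)

Section moment_algebra.
Context (R : realType) (N : nat) (P2 Q1 K : R).
Hypotheses (P20 : 0 <= P2) (Q10 : 0 < Q1).
Hypothesis weights : 'C(N, 2)%:R * P2 + N%:R * Q1 = 1.

(** Maximum principle: [t] is a convex combination of quantities bounded by [a], except the one of
    weight [Q1], belonging to the reservoir collision of particle [k], which satisfies the better
    bound [b]. *)
Lemma weighted_max (t a b : R) (k : 'I_N) (w : 'I_N -> 'I_N -> R) (z : 'I_N -> R) :
  t = \sum_(i < N) \sum_(j < N | (i < j)%N) P2 * w i j + \sum_(j < N) Q1 * z j ->
  (forall i j, `|w i j| <= a) -> (forall j, `|z j| <= if k == j then b else a) ->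
  `|t| <= (1 - Q1) * a + Q1 * b.
Proof.
move=> -> wa zb; apply: le_trans (ler_normD _ _) _.
have -> : (1 - Q1) * a + Q1 * b = 'C(N, 2)%:R * (P2 * a) + (N%:R * (Q1 * a) - Q1 * a + Q1 * b).
  by rewrite -[X in (X - Q1) * a]weights; ring.
apply: lerD.
  rewrite -sum_pairs; apply: le_trans (ler_norm_sum _ _ _) _; apply: ler_sum => i _.
  apply: le_trans (ler_norm_sum _ _ _) _; apply: ler_sum => j _.
  by rewrite normrM (ger0_norm P20) ler_wpM2l.
apply: le_trans (ler_norm_sum _ _ _) _.
apply: (@le_trans _ _ (\sum_(j < N) (if j == k then Q1 * b else Q1 * a))).
  apply: ler_sum => j _; rewrite normrM (gtr0_norm Q10) eq_sym; move: (zb j).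
  by case: ifP => _ H; apply: ler_wpM2l => //; exact: ltW.
by rewrite (sum_except1 _ _ (fun=> Q1 * a)) sumr_const card_ord mulr_natl.
Qed.

Variables (e : 'I_N -> R) (s : 'I_N -> 'I_N -> R).

Definition quad_moment k l (x0 x1 x2 : R) : R :=
  x0 ^+ 2 + x1 ^+ 2 * s k k + x2 ^+ 2 * s l l
  + 2 * x0 * x1 * e k + 2 * x0 * x2 * e l + 2 * x1 * x2 * s k l.

Hypothesis stationary : forall k l x0 x1 x2, k != l ->
  quad_moment k l x0 x1 x2 =
  \sum_(i < N) \sum_(j < N | (i < j)%N) P2 *
    (quad_moment k l x0 (if (k == j) || (k == i) then 0 else x1)
                        (if (l == j) || (l == i) then 0 else x2)
     + ((if (k == j) || (k == i) then x1 ^+ 2 else 0)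
        + (if (l == j) || (l == i) then x2 ^+ 2 else 0)) * (s j j + s i i) / 2)
  + \sum_(j < N) Q1 *
    (quad_moment k l x0 (if k == j then 0 else x1) (if l == j then 0 else x2)
     + ((if k == j then x1 ^+ 2 else 0) + (if l == j then x2 ^+ 2 else 0)) * (s j j + K) / 2).

(** Half the difference of the stationary equations at [x1 = 1] and [x1 = -1]: everything even in
    [x1] cancels and the terms in [e k] and [s k l] remain. *)
Let polarized k l x0 x2 : k != l -> let m := 2 * x0 * e k + 2 * x2 * s k l in
  m = \sum_(i < N) \sum_(j < N | (i < j)%N) P2 *
     (if (k == j) || (k == i) then 0 else 2 * x0 * e k + 2 * (if (l == j) || (l == i) then 0 else x2) * s k l)
   + \sum_(j < N) Q1 * (if k == j then 0 else 2 * x0 * e k + 2 * (if l == j then 0 else x2) * s k l).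
Proof.
move=> kl m; have H1 := stationary x0 1 x2 kl; have H2 := stationary x0 (-1) x2 kl.
have -> : m = (quad_moment k l x0 1 x2 - quad_moment k l x0 (-1) x2) / 2.
  by rewrite /quad_moment /m; field.
rewrite H1 H2 opprD addrACA -!sumrB mulrDl !mulr_suml; congr (_ + _).
  apply: eq_bigr => i _; rewrite -sumrB mulr_suml; apply: eq_bigr => j _.
  by rewrite /quad_moment; case: ifP => _; case: ifP => _; field.
apply: eq_bigr => j _.
by rewrite /quad_moment; case: ifP => _; case: ifP => _; field.
Qed.

Let contraction (a : R) : 0 <= a -> a <= (1 - Q1) * a + Q1 * 0 -> a = 0.
Proof.
move=> a0; rewrite mulr0 addr0 mulrBl mul1r lerBrDr gerDl => H.
by apply/eqP; rewrite eq_le a0 andbT -(pmulr_rle0 _ Q10).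
Qed.

(** At [x0 = 1], [x2 = 0] every term is either zero or the unknown itself, and the reservoir
    collision of [k] gives zero with weight [Q1 > 0]. *)
Lemma first_moment0 k l : k != l -> e k = 0.
Proof.
move=> kl; have := @polarized k l 1 0 kl; rewrite /= !mulr0 !mul0r !addr0 => E.
have {}E : 2 * 1 * e k = \sum_(i < N) \sum_(j < N | (i < j)%N) P2 *
     (if (k == j) || (k == i) then 0 else 2 * 1 * e k)
   + \sum_(j < N) Q1 * (if k == j then 0 else 2 * 1 * e k).
  rewrite {1}E; congr (_ + _).
    by apply: eq_bigr => i _; apply: eq_bigr => j _; rewrite if_same mulr0 mul0r addr0.
  by apply: eq_bigr => j _; rewrite if_same mulr0 mul0r addr0.
have := weighted_max (a := `|2 * 1 * e k|) (b := 0) (k := k) E.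
move=> H; have /eqP : `|2 * 1 * e k| = 0.
  apply: contraction => //; apply: H => [i j|j]; case: ifP => _ //; by rewrite normr0.
by rewrite normr_eq0 !mulf_eq0 pnatr_eq0 oner_eq0 /= => /eqP.
Qed.

(** The same contraction at [x0 = 0], [x2 = 1]: any collision involving [k] or [l] destroys the
    correlation. *)
Lemma cross_moment0 k l : k != l -> s k l = 0.
Proof.
move=> kl; have := @polarized k l 0 1 kl; rewrite /= !mulr0 !mul0r !add0r => E.
have {}E : 2 * 1 * s k l = \sum_(i < N) \sum_(j < N | (i < j)%N) P2 *
     (if (k == j) || (k == i) then 0 else 2 * (if (l == j) || (l == i) then 0 else 1) * s k l)
   + \sum_(j < N) Q1 * (if k == j then 0 else 2 * (if l == j then 0 else 1) * s k l).
  rewrite {1}E; congr (_ + _).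
    by apply: eq_bigr => i _; apply: eq_bigr => j _; rewrite add0r.
  by apply: eq_bigr => j _; rewrite add0r.
have := weighted_max (a := `|2 * 1 * s k l|) (b := 0) (k := k) E.
move=> H; have /eqP : `|2 * 1 * s k l| = 0.
  apply: contraction => //; apply: H => [i j|j]; case: ifP => _ //; rewrite ?normr0//;
    by case: ifP => _; rewrite ?mulr0 ?mul0r ?normr0.
by rewrite normr_eq0 !mulf_eq0 pnatr_eq0 oner_eq0 /= => /eqP.
Qed.

(** Pair collisions mix the deviations [s k k - K] of different particles, so they are controlled
    together: where the deviation is largest in absolute value, the reservoir halves it with weight
    [Q1] and no other term exceeds it. *)
Lemma second_moment (o : 'I_N -> 'I_N) : (forall k, k != o k) -> forall k, s k k = K.
Proof.
move=> ok k0; pose y k := s k k - K.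
have yE k : y k = \sum_(i < N) \sum_(j < N | (i < j)%N) P2 *
     (if (k == j) || (k == i) then (y j + y i) / 2 else y k)
   + \sum_(j < N) Q1 * (if k == j then y j / 2 else y k).
  have qE x1 : quad_moment k (o k) 0 x1 0 = x1 ^+ 2 * s k k.
    by rewrite /quad_moment !mulr0 !mul0r !expr0n/=; ring.
  (* Since the weights sum to 1, [K] satisfies the homogeneous averaging identity and can be
     subtracted term by term. *)
  have KE : K = \sum_(i < N) \sum_(j < N | (i < j)%N) P2 * K + \sum_(j < N) Q1 * K.
    rewrite sum_pairs sumr_const card_ord -[_ *+ N]mulr_natl -{1}[K]mul1r -[X in X * K = _]weights; ring.
  have := stationary 0 1 0 (ok k); rewrite qE expr1n mul1r => sE.
  apply: (etrans (congr2 (fun a b => a - b) sE KE)); rewrite opprD addrACA -!sumrB; congr (_ + _).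
    apply: eq_bigr => i _; rewrite -sumrB; apply: eq_bigr => j _.
    rewrite -mulrBr; congr (_ * _); rewrite if_same qE expr0n/= if_same addr0.
    by rewrite /y; case: ifP => _; field.
  apply: eq_bigr => j _; rewrite -mulrBr; congr (_ * _).
  rewrite if_same qE expr0n/= if_same addr0.
  by rewrite /y; case: ifP => _; field.
pose kmax := [arg max_(k > k0) `|y k|]%O.
have ymax k : `|y k| <= `|y kmax|.
  by rewrite /kmax; case: arg_maxP => // i _ /(_ k); exact.
have half (a b : R) : `|a| <= `|y kmax| -> `|b| <= `|y kmax| -> `|(a + b) / 2| <= `|y kmax|.
  rewrite normrM [`|2^-1|]ger0_norm ?invr_ge0// => H1 H2.
  have := ler_normD a b; lra.
have H : `|y kmax| <= (1 - Q1) * `|y kmax| + Q1 * (`|y kmax| / 2).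
  apply: (weighted_max (k := kmax) (yE kmax)) => [i j|j]; case: ifP => _ //.
    exact: half.
  by rewrite normrM [`|2^-1|]ger0_norm ?invr_ge0// ler_pM2r.
have ymax0 : `|y kmax| = 0.
  apply/eqP; rewrite eq_le normr_ge0 andbT -(pmulr_rle0 _ Q10).
  by have := H; lra.
by apply/eqP; rewrite -subr_eq0 -normr_le0 -ymax0; exact: ymax.
Qed.
End moment_algebra.

(** * Moments of the product density *)

Section tensor_moments.
Context (R : realType).
Local Open Scope ereal_scope.
Notation lam := (@lebesgue_measure R).
Notation RR := (measurableTypeR R).

Definition pos (x : R) : R := Num.max x 0%R.

Lemma pos_ge0 x : (0 <= pos x)%R. Proof. by rewrite le_max lexx orbT. Qed.

Lemma pos_id x : (0 <= x)%R -> pos x = x. Proof. exact: max_l. Qed.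

Lemma pos_eq0 x : (x <= 0)%R -> pos x = 0%R. Proof. exact: max_r. Qed.

(** [integral_Rn] is a difference of two iterated integrals; with this formula Tonelli applies to
    positive and negative parts separately. *)
Lemma pos_mul x y : pos (x * y) = (pos x * pos y + pos (- x) * pos (- y))%R.
Proof.
have [x0|/ltW x0] := leP 0%R x; have [y0|/ltW y0] := leP 0%R y.
- rewrite (pos_id x0) (pos_id y0) (pos_id (mulr_ge0 x0 y0)).
  by rewrite (pos_eq0 (x := - x)%R) ?oppr_le0// mul0r addr0.
- rewrite (pos_eq0 y0) (pos_eq0 (x := - x)%R) ?oppr_le0// mulr0 mul0r addr0.
  by rewrite pos_eq0// mulr_ge0_le0.
- rewrite (pos_eq0 x0) (pos_eq0 (x := - y)%R) ?oppr_le0// mulr0 mul0r addr0.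
  by rewrite pos_eq0// mulr_le0_ge0.
- rewrite (pos_eq0 x0) mul0r add0r (pos_id (x := - x)%R) ?oppr_ge0//.
  by rewrite (pos_id (x := - y)%R) ?oppr_ge0// mulrNN pos_id// mulr_le0.
Qed.

Lemma measurable_pos d (T : measurableType d) (f : T -> R) :
  measurable_fun setT f -> measurable_fun setT (fun x => pos (f x)).
Proof. by move=> mf; apply: measurable_maxr => //; exact: measurable_cst. Qed.

Lemma nnm_pos d (T : measurableType d) (f : T -> R) :
  measurable_fun setT f -> nnm (fun x => (pos (f x))%:E).
Proof. by move=> mf; apply: nnm_EFin; [exact: measurable_pos|move=> x; exact: pos_ge0]. Qed.

Lemma measurable_prod_coord n (h : 'I_n -> R -> R) : (forall i, measurable_fun setT (h i)) ->
  measurable_fun setT (fun v : n.-tuple R => \prod_(i < n) h i (tnth v i))%R.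
Proof.
move=> mh; apply: measurable_prod => i _.
exact: (measurableT_comp (mh i) (measurable_tnth i)).
Qed.

(** The two parts of a product do not factor, but their integrals are updated as
    [(p P + q Q, q P + p Q)] when a coordinate is added, and the difference is then
    multiplicative. *)
Lemma product_moments n (h : 'I_n -> R -> R) (p q : 'I_n -> R) :
  (forall i, measurable_fun setT (h i)) ->
  (forall i, \int[lam]_x (pos (h i x))%:E = (p i)%:E) ->
  (forall i, \int[lam]_x (pos (- h i x))%:E = (q i)%:E) ->
  exists P Q, [/\ (\int[lebn R n]_v (pos (\prod_(i < n) h i (tnth v i)))%:E = P%:E),
    (\int[lebn R n]_v (pos (- \prod_(i < n) h i (tnth v i)))%:E = Q%:E) &
    (P - Q = \prod_(i < n) (p i - q i))%R].
Proof.
elim: n h p q => [|n IH] h p q mh hp hq.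
  exists 1%R, 0%R; rewrite !lebn0 ?big_ord0 ?subr0//; last 2 first.
  - apply: nnm_pos; apply: measurableT_comp => //.
    exact: (measurable_prod_coord mh).
  - exact: (nnm_pos (measurable_prod_coord mh)).
  by split => //; congr EFin; [rewrite pos_id|rewrite pos_eq0// oppr_le0].
have [P [Q [HP HQ HPQ]]] := IH (fun i => h (lift ord0 i)) (fun i => p (lift ord0 i))
  (fun i => q (lift ord0 i)) (fun i => mh _) (fun i => hp _) (fun i => hq _).
pose G (t : n.-tuple R) := (\prod_(i < n) h (lift ord0 i) (tnth t i))%R.
have mG : measurable_fun setT G.
  by apply: (measurable_prod_coord (h := fun i => h (lift ord0 i))) => i.
have mNG : measurable_fun setT (fun t => - G t)%R by exact: measurableT_comp.
have m0 : measurable_fun [set: RR] (h ord0 : RR -> R) := mh ord0.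
have mN0 : measurable_fun [set: RR] (fun x : RR => - h ord0 x)%R.
  have H : measurable_fun [set: R] (fun x : R => - h ord0 x)%R by exact: measurableT_comp.
  exact: H.
have step (h1 h2 : RR -> R) (G1 G2 : n.-tuple R -> R) p1 p2 P1 P2 :
    measurable_fun setT h1 -> measurable_fun setT h2 ->
    measurable_fun setT G1 -> measurable_fun setT G2 ->
    \int[lam]_x (pos (h1 x))%:E = p1%:E -> \int[lam]_x (pos (h2 x))%:E = p2%:E ->
    \int[lebn R n]_t (pos (G1 t))%:E = P1%:E -> \int[lebn R n]_t (pos (G2 t))%:E = P2%:E ->
    \int[lam]_x \int[lebn R n]_t (pos (h1 x) * pos (G1 t) + pos (h2 x) * pos (G2 t))%:E
      = (p1 * P1 + p2 * P2)%:E.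
  move=> mh1 mh2 mG1 mG2 hp1 hp2 hP1 hP2.
  have [nh1 nh2 nG1 nG2] := And4 (nnm_pos mh1) (nnm_pos mh2) (nnm_pos mG1) (nnm_pos mG2).
  transitivity (\int[lam]_x (P1%:E * (pos (h1 x))%:E + P2%:E * (pos (h2 x))%:E)).
    apply: eq_integral => x _; under eq_integral do rewrite EFinD !EFinM.
    rewrite nnm_integralD; [|by apply: nnmZ; rewrite ?lee_fin ?pos_ge0..].
    by rewrite !nnm_integralZ ?lee_fin ?pos_ge0// hP1 hP2 muleC [X in _ + X]muleC.
  have P10 : (0 <= P1)%R by rewrite -lee_fin -hP1 nnm_integral_ge0.
  have P20 : (0 <= P2)%R by rewrite -lee_fin -hP2 nnm_integral_ge0.
  rewrite nnm_integralD; [|by apply: nnmZ; rewrite ?lee_fin..].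
  rewrite !nnm_integralZ ?lee_fin// hp1 hp2 -!EFinM -EFinD; congr EFin; ring.
have prodE x t : (\prod_(i < n.+1) h i (tnth (cons_tuple x t) i) = h ord0 x * G t)%R.
  rewrite big_ord_recl tnth0; congr (_ * _)%R; apply: eq_bigr => i _; by rewrite tnthS.
have mall := measurable_prod_coord mh.
exists (p ord0 * P + q ord0 * Q)%R, (q ord0 * P + p ord0 * Q)%R; split.
- rewrite lebnS; last exact: (nnm_pos mall).
  rewrite -(step _ _ _ _ _ _ _ _ m0 mN0 mG mNG (hp ord0) (hq ord0) HP HQ).
  apply: eq_integral => x _; apply: eq_integral => t _.
  by rewrite prodE pos_mul.
- rewrite lebnS; last by apply: nnm_pos; exact: measurableT_comp.
  rewrite -(step _ _ _ _ _ _ _ _ mN0 m0 mG mNG (hq ord0) (hp ord0) HP HQ).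
  apply: eq_integral => x _; apply: eq_integral => t _.
  by rewrite prodE -mulNr pos_mul opprK.
- by rewrite big_ord_recl -HPQ; ring.
Qed.

Lemma integral_product n (h : 'I_n -> R -> R) (p q : 'I_n -> R) :
  (forall i, measurable_fun setT (h i)) ->
  (forall i, \int[lam]_x (pos (h i x))%:E = (p i)%:E) ->
  (forall i, \int[lam]_x (pos (- h i x))%:E = (q i)%:E) ->
  integral_Rn (fun v : n.-tuple R => \prod_(i < n) h i (tnth v i))%R =
  (\prod_(i < n) (p i - q i))%R.
Proof.
move=> mh hp hq; have [P [Q [HP HQ <-]]] := product_moments mh hp hq.
have mall := measurable_prod_coord mh.
rewrite /integral_Rn -!lebnE ?HP ?HQ//.
  by apply: nnm_pos; exact: measurableT_comp.
exact: (nnm_pos mall).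
Qed.

Lemma integral_posneg d (T : measurableType d) (m : {measure set T -> \bar R}) (f : T -> R) :
  m.-integrable setT (fun x => (f x)%:E) ->
  exists p q, [/\ \int[m]_x (pos (f x))%:E = p%:E,
    \int[m]_x (pos (- f x))%:E = q%:E & \int[m]_x (f x)%:E = (p - q)%:E].
Proof.
move=> If; have posE x : (EFin \o f)^\+ x = (pos (f x))%:E by rewrite funeposE /pos /= EFin_max.
have negE x : (EFin \o f)^\- x = (pos (- f x))%:E by rewrite funenegE /pos /= EFin_max.
have Ip := integrable_funepos measurableT If; have In := integrable_funeneg measurableT If.
have fp := integrable_fin_num measurableT Ip; have fn := integrable_fin_num measurableT In.
exists (fine (\int[m]_x (EFin \o f)^\+ x)), (fine (\int[m]_x (EFin \o f)^\- x)).
split; rewrite ?EFinB ?fineK//.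
- by apply: eq_integral => x _; rewrite posE.
- by apply: eq_integral => x _; rewrite negE.
- by rewrite integralE.
Qed.

Variables (g : R -> R) (K : R).
Hypotheses (g_meas : measurable_fun setT g) (g_ge0 : forall w, (0 <= g w)%R).
Hypothesis g_mass : \int[lam]_w (g w)%:E = 1.
Hypothesis g_m1 : lam.-integrable setT (fun w => (w * g w)%:E).
Hypothesis g_mean0 : \int[lam]_w (w * g w)%:E = 0.
Hypothesis g_K : \int[lam]_w (w ^+ 2 * g w)%:E = K%:E.

Let moment (d : nat) : R := if d == 0%N then 1%R else if d == 1%N then 0%R else K.

Lemma integral_monomial_gtensor n (d : 'I_n -> nat) : (forall i, (d i <= 2)%N) ->
  integral_Rn (fun v : n.-tuple R => (\prod_(i < n) tnth v i ^+ d i) * gtensor g v)%R =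
  (\prod_(i < n) moment (d i))%R.
Proof.
move=> d2; pose h i (x : R) := (x ^+ d i * g x)%R.
have mh i : measurable_fun setT (h i).
  by apply: measurable_funM => //; apply: measurable_funX; exact: measurable_id.
have hpq i : exists pq : R * R, [/\ \int[lam]_x (pos (h i x))%:E = pq.1%:E,
    \int[lam]_x (pos (- h i x))%:E = pq.2%:E & (pq.1 - pq.2 = moment (d i))%R].
  have nn (c : R) : (forall x, (0 <= h i x)%R) -> \int[lam]_x (h i x)%:E = c%:E ->
    exists pq : R * R, [/\ \int[lam]_x (pos (h i x))%:E = pq.1%:E,
    \int[lam]_x (pos (- h i x))%:E = pq.2%:E & (pq.1 - pq.2 = c)%R].
    move=> h0 hc; exists (c, 0%R); rewrite /= subr0; split => //.
      by rewrite -hc; apply: eq_integral => x _; rewrite /pos max_l.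
    by apply: integral0_eq => x _; rewrite /pos max_r// oppr_le0.
  (* Degrees 0 and 2 give nonnegative functions, with no negative part; degree 1 needs the
     integrability of [w * g w] to split into two finite parts. *)
  move: (d2 i); rewrite /moment /h in nn *; move: nn; case: (d i) => [|[|[|//]]] nn _ /=.
  - apply: nn => [x|]; first by rewrite mul1r.
    by under eq_integral do rewrite mul1r.
  - have [p [q [Hp Hq Hpq]]] := integral_posneg g_m1.
    exists (p, q); split => //=.
    by apply: EFin_inj; rewrite -Hpq.
  - by apply: nn => // x; rewrite mulr_ge0// sqr_ge0.
have [pq pqE] := choice hpq.
have := @integral_product n h (fun i => (pq i).1) (fun i => (pq i).2) mh.
move=> /(_ (fun i => let: And3 H _ _ := pqE i in H) (fun i => let: And3 _ H _ := pqE i in H)).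
rewrite (eq_bigr (fun i => moment (d i))) => [<-|i _]; last by case: (pqE i).
by congr integral_Rn; apply/funext => v; rewrite /gtensor -big_split.
Qed.

Lemma gtensor_moment1 n (i : 'I_n) :
  integral_Rn (fun v : n.-tuple R => tnth v i * gtensor g v)%R = 0%R.
Proof.
have := @integral_monomial_gtensor n (fun k => nat_of_bool (k == i)) _.
rewrite (bigD1 i)//= eqxx /moment/= mul0r => <-; last by move=> k; case: (k == i).
congr integral_Rn; apply/funext => v; congr (_ * _)%R.
by rewrite (bigD1 i)//= eqxx expr1 big1 ?mulr1// => k /negbTE ->.
Qed.

Lemma gtensor_moment2 n (i j : 'I_n) :
  integral_Rn (fun v : n.-tuple R => tnth v i * tnth v j * gtensor g v)%R =
  if i == j then K else 0%R.
Proof.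
have := @integral_monomial_gtensor n (fun k => (k == i) + (k == j))%N _.
have -> : (\prod_(k < n) moment ((k == i) + (k == j)) = if i == j then K else 0)%R.
  rewrite (bigD1 i)//= eqxx; case: (eqVneq i j) => [<-|ij].
    by rewrite big1 ?mulr1// => k /negbTE ->.
  by rewrite /moment /= mul0r.
move=> <-; last by move=> k; case: (k == i); case: (k == j).
congr integral_Rn; apply/funext => v; congr (_ * _)%R.
under eq_bigr do rewrite exprD; rewrite big_split/=.
congr (_ * _)%R; [rewrite (bigD1 i)//=|rewrite (bigD1 j)//=];
  by rewrite eqxx expr1 big1 ?mulr1// => k /negbTE ->.
Qed.
End tensor_moments.

(** * Moments of an invariant density of finite energy *)

Section density_moments.
Context (R : realType) (N : nat).
Local Open Scope ereal_scope.
Notation lam := (@lebesgue_measure R).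
Notation RR := (measurableTypeR R).
Variables (la mu : R) (g : R -> R) (K : R).
Hypotheses (hN : (2 <= N)%N) (la0 : (0 < la)%R) (mu0 : (0 < mu)%R).
Hypotheses (g_meas : measurable_fun setT g) (g_ge0 : forall w, (0 <= g w)%R).
Hypothesis g_mass : \int[lam]_w (g w)%:E = 1.
Hypothesis g_K : \int[lam]_w (w ^+ 2 * g w)%:E = K%:E.
Variable F : N.-tuple R -> R.
Hypotheses (mF : measurable_fun setT F) (F0 : forall v, (0 <= F v)%R).
Hypothesis F1 : \int[lebn R N]_v (F v)%:E = 1.
Hypothesis VF : \int[lebn R N]_v ((energy v)%:E * (F v)%:E) < +oo.
Hypothesis AF : {ae lebn R N, forall v, Aop la mu g (fun v => (F v)%:E) v = (F v)%:E}.
Notation m := (lebn R N).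
Implicit Types p q : N.-tuple R -> R.

Definition has_mean p := m.-integrable setT (fun v => (p v * F v)%:E).
Definition mean p : R := fine (\int[m]_v (p v * F v)%:E).

(** Mass and energy are the only moments known to be finite; this growth bound covers all
    polynomials of degree at most 2. *)
Lemma has_mean_bound p (c : R) : measurable_fun setT p -> (0 <= c)%R ->
  (forall v, `|p v| <= c * (1 + energy v))%R -> has_mean p.
Proof.
move=> mp c0 pc; have nF := nnm_EFin mF F0.
have nVF : nnm (fun v => (energy v)%:E * (F v)%:E) by apply: nnmM => //; exact: nnm_energy.
have nall : nnm (fun v => c%:E * ((F v)%:E + (energy v)%:E * (F v)%:E)).
  by apply: nnmZ; rewrite ?lee_fin//; exact: nnmD.
apply/integrableP; split; first by apply/measurable_EFinP; exact: measurable_funM.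
apply: (@le_lt_trans _ _ (\int[m]_v (c%:E * ((F v)%:E + (energy v)%:E * (F v)%:E)))).
  apply: ge0_le_integral => //.
  - apply/measurable_EFinP; apply: measurableT_comp => //.
    exact: measurable_funM.
  - exact: nall.1.
  move=> v _.
  have -> : c%:E * ((F v)%:E + (energy v)%:E * (F v)%:E) = (c * (1 + energy v) * F v)%:E.
    by transitivity (c * (F v + energy v * F v))%:E => //; congr EFin; ring.
  by rewrite /= lee_fin normrM (ger0_norm (F0 v)) ler_wpM2r.
rewrite nnm_integralZ ?lee_fin//; last exact: nnmD.
rewrite nnm_integralD// F1 lte_mul_pinfty ?lee_fin//.
by rewrite lte_add_pinfty// ltry.
Qed.

Lemma has_meanD p q : has_mean p -> has_mean q -> has_mean (fun v => p v + q v)%R.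
Proof.
move=> ip iq; rewrite /has_mean.
rewrite (_ : (fun v => _) = (fun v => (p v * F v)%:E) \+ (fun v => (q v * F v)%:E)).
  exact: integrableD.
by apply/funext => v /=; rewrite mulrDl EFinD.
Qed.

Lemma meanD p q : has_mean p -> has_mean q -> (mean (fun v => p v + q v) = mean p + mean q)%R.
Proof.
move=> ip iq; rewrite /mean -fineD; [|exact: integrable_fin_num..].
rewrite -integralD//; congr fine; apply: eq_integral => v _.
by rewrite mulrDl EFinD.
Qed.

Lemma has_meanZ c p : has_mean p -> has_mean (fun v => c * p v)%R.
Proof.
move=> ip; rewrite /has_mean (_ : (fun v => _) = (fun v => c%:E * (p v * F v)%:E)).
  exact: integrableZl.
by apply/funext => v /=; rewrite -EFinM mulrA.
Qed.

Lemma meanZ c p : has_mean p -> (mean (fun v => c * p v) = c * mean p)%R.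
Proof.
move=> ip; rewrite /mean; under eq_integral do rewrite -mulrA EFinM.
by rewrite integralZl// fineM//; exact: integrable_fin_num.
Qed.

Lemma mean_sum (I : Type) (r : seq I) (P : pred I) (f : I -> N.-tuple R -> R) :
  (forall i, P i -> has_mean (f i)) ->
  has_mean (fun v => \sum_(i <- r | P i) f i v)%R /\
  (mean (fun v => \sum_(i <- r | P i) f i v) = \sum_(i <- r | P i) mean (f i))%R.
Proof.
move=> hf; elim: r => [|i r [IH1 IH2]].
  have E0 : (fun v : N.-tuple R => ((\sum_(i <- [::] | P i) f i v) * F v)%:E) = cst 0.
    by apply/funext => v; rewrite big_nil mul0r.
  rewrite /has_mean /mean E0 big_nil integral_cst// mul0e; split => //.
  exact: integrable0.
have EE : (fun v => \sum_(i0 <- i :: r | P i0) f i0 v)%R =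
  if P i then (fun v => f i v + \sum_(i0 <- r | P i0) f i0 v)%R
  else (fun v => \sum_(i0 <- r | P i0) f i0 v)%R.
  by apply/funext => v; rewrite big_cons; case: (P i).
rewrite EE big_cons; case: (boolP (P i)) => // Pi; rewrite -IH2.
by split; [apply: has_meanD => //; exact: hf|apply: meanD => //; exact: hf].
Qed.

Lemma sqr_le_energy (v : N.-tuple R) (k : 'I_N) : (tnth v k ^+ 2 <= energy v)%R.
Proof.
rewrite /energy (bigD1 k)//= lerDl; apply: sumr_ge0 => i _; exact: sqr_ge0.
Qed.

Lemma has_mean_cst c : has_mean (fun=> c).
Proof.
apply: (@has_mean_bound _ `|c|%R) => // v.
by rewrite ler_peMr// lerDl energy_ge0.
Qed.

Lemma mean_cst c : mean (fun=> c) = c.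
Proof.
rewrite /mean; under eq_integral do rewrite EFinM.
rewrite -[in RHS](mulr1 c) integralZl//; first by rewrite F1 mule1 mulr1.
have := has_mean_cst 1; rewrite /has_mean; under eq_fun do rewrite mul1r; exact.
Qed.

Lemma has_mean1 k : has_mean (fun v => tnth v k).
Proof.
apply: (@has_mean_bound _ 1%R) => // [|v]; first exact: measurable_tnth.
rewrite mul1r; have := sqr_le_energy v k; rewrite -real_normK ?num_real//.
have := normr_ge0 (tnth v k); nra.
Qed.

Lemma has_mean2 k l : has_mean (fun v => tnth v k * tnth v l)%R.
Proof.
apply: (@has_mean_bound _ 1%R) => // [|v].
  by apply: measurable_funM; exact: measurable_tnth.
rewrite mul1r normrM; have := sqr_le_energy v k; have := sqr_le_energy v l.
rewrite -(real_normK (num_real (tnth v k))) -(real_normK (num_real (tnth v l))).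
have := sqr_ge0 (`|tnth v k| - `|tnth v l|)%R; nra.
Qed.

Let e k := mean (fun v => tnth v k).
Let s k l := mean (fun v => tnth v k * tnth v l)%R.
Let Q1 : R := (res_weight N la mu * (2 * pi))%R.
Let P2 : R := (pair_weight N la mu * (2 * pi))%R.

Let pi2 : (0 < 2 * pi :> R)%R. Proof. by rewrite mulr_gt0// pi_gt0. Qed.
Let Q10 : (0 < Q1)%R.
Proof. by rewrite mulr_gt0// (res_weight_gt0 hN la0 mu0). Qed.
Let P20 : (0 <= P2)%R.
Proof. by rewrite mulr_ge0 ?(ltW pi2)// (ltW (pair_weight_gt0 hN la0 mu0)). Qed.

Lemma mean_quad k l x0 x1 x2 : has_mean (quad k l x0 x1 x2) /\
  mean (quad k l x0 x1 x2) = quad_moment e s k l x0 x1 x2.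
Proof.
have -> : quad k l x0 x1 x2 = (fun v => x0 ^+ 2 + x1 ^+ 2 * (tnth v k * tnth v k)
  + x2 ^+ 2 * (tnth v l * tnth v l) + 2 * x0 * x1 * tnth v k + 2 * x0 * x2 * tnth v l
  + 2 * x1 * x2 * (tnth v k * tnth v l))%R.
  by apply/funext => v; rewrite /quad; ring.
have h1 := has_mean1; have h2 := has_mean2; have hc := has_mean_cst.
split; first by do ![apply: has_meanD|apply: has_meanZ]; auto.
by rewrite !meanD ?meanZ ?mean_cst//; do ![apply: has_meanD|apply: has_meanZ]; auto.
Qed.

(** Common shape of [quad_pair] and [quad_res]: a [quad] with some coefficients erased, multiples of
    two squares, and a constant. *)
Lemma mean_quad_plus (p : N.-tuple R -> R) k l x0 x1 x2 c1 c2 c3 i j :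
  (forall v, p v = quad k l x0 x1 x2 v + c1 * (tnth v i * tnth v i)
    + c2 * (tnth v j * tnth v j) + c3)%R ->
  has_mean p /\
  (mean p = quad_moment e s k l x0 x1 x2 + c1 * s i i + c2 * s j j + c3)%R.
Proof.
move=> pE; have -> : p = (fun v => quad k l x0 x1 x2 v + c1 * (tnth v i * tnth v i)
    + c2 * (tnth v j * tnth v j) + c3)%R by apply/funext.
have [hq <-] := mean_quad k l x0 x1 x2; have h2 := has_mean2; have hc := has_mean_cst.
split; first by do ![apply: has_meanD|apply: has_meanZ]; auto.
by rewrite !meanD ?meanZ ?mean_cst//; do ![apply: has_meanD|apply: has_meanZ]; auto.
Qed.

(** Invariance tested against a square: [F] is replaced by [Aop F], and duality moves the collision
    onto the observable. *)
Lemma mean_quad_mean k l x0 x1 x2 : k != l ->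
  mean (quad k l x0 x1 x2) = mean (quad_mean la mu K k l x0 x1 x2).
Proof.
move=> kl; congr fine; have nq := nnm_quad k l x0 x1 x2; have nF := nnm_EFin mF F0.
have [nA nB dual] := dual_pair_op hN la0 mu0 g_meas g_ge0.
transitivity (\int[m]_v ((quad k l x0 x1 x2 v)%:E * Aop la mu g (fun v => (F v)%:E) v)).
  apply: nnm_ae_eq_integral.
  - by under eq_fun do rewrite EFinM; exact: nnmM.
  - by apply: nnmM => //; exact: nA.
  - by apply: filterS AF => v /= ->; rewrite EFinM.
rewrite dual//; apply: eq_integral => v _.
by rewrite (Bop_quad la mu g_meas g_ge0 g_mass g_K)// EFinM.
Qed.

Lemma moments_stationary k l x0 x1 x2 : k != l ->
  (quad_moment e s k l x0 x1 x2 =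
  \sum_(i < N) \sum_(j < N | (i < j)%N) P2 *
    (quad_moment e s k l x0 (if (k == j) || (k == i) then 0 else x1)
                        (if (l == j) || (l == i) then 0 else x2)
     + ((if (k == j) || (k == i) then x1 ^+ 2 else 0)
        + (if (l == j) || (l == i) then x2 ^+ 2 else 0)) * (s j j + s i i) / 2)
  + \sum_(j < N) Q1 *
    (quad_moment e s k l x0 (if k == j then 0 else x1) (if l == j then 0 else x2)
     + ((if k == j then x1 ^+ 2 else 0) + (if l == j then x2 ^+ 2 else 0)) * (s j j + K) / 2))%R.
Proof.
move=> kl; rewrite -(mean_quad k l x0 x1 x2).2 mean_quad_mean//.
have pairE i j : has_mean (quad_pair k l x0 x1 x2 j i) /\
   (mean (quad_pair k l x0 x1 x2 j i) = quad_moment e s k l x0 (if (k == j) || (k == i) then 0 else x1)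
                        (if (l == j) || (l == i) then 0 else x2)
     + ((if (k == j) || (k == i) then x1 ^+ 2 else 0)
        + (if (l == j) || (l == i) then x2 ^+ 2 else 0)) * (s j j + s i i) / 2)%R.
  pose c := ((if (k == j) || (k == i) then x1 ^+ 2 else 0)
    + (if (l == j) || (l == i) then x2 ^+ 2 else 0))%R.
  have [|h ->] := @mean_quad_plus (quad_pair k l x0 x1 x2 j i) k l x0
    (if (k == j) || (k == i) then 0 else x1)%R (if (l == j) || (l == i) then 0 else x2)%R
    (c / 2)%R (c / 2)%R 0%R j i.
    move=> v; rewrite /quad_pair /quad -/c.
    by case: ifP => _; case: ifP => _; field.
  by split => //; rewrite -/c; field.
have resE j : has_mean (quad_res K k l x0 x1 x2 j) /\
   (mean (quad_res K k l x0 x1 x2 j) =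
     quad_moment e s k l x0 (if k == j then 0 else x1) (if l == j then 0 else x2)
     + ((if k == j then x1 ^+ 2 else 0) + (if l == j then x2 ^+ 2 else 0)) * (s j j + K) / 2)%R.
  pose c := ((if k == j then x1 ^+ 2 else 0) + (if l == j then x2 ^+ 2 else 0))%R.
  have [|h ->] := @mean_quad_plus (quad_res K k l x0 x1 x2 j) k l x0
    (if k == j then 0 else x1)%R (if l == j then 0 else x2)%R
    (c / 2)%R 0%R (c * K / 2)%R j j.
    move=> v; rewrite /quad_res /quad -/c.
    by case: ifP => _; case: ifP => _; field.
  by split => //; rewrite -/c; field.
have S1 (i : 'I_N) := mean_sum (index_enum 'I_N) (P := fun j : 'I_N => (i < j)%N)
  (fun j _ => has_meanZ P2 (pairE i j).1).
have [S2h S2] := mean_sum (index_enum 'I_N) (P := predT) (fun i _ => (S1 i).1).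
have [S3h S3] := mean_sum (index_enum 'I_N) (P := predT) (fun j _ => has_meanZ Q1 (resE j).1).
transitivity (mean (fun v => \sum_(i < N) \sum_(j < N | (i < j)%N) P2 * quad_pair k l x0 x1 x2 j i v)
  + mean (fun v => \sum_(j < N) Q1 * quad_res K k l x0 x1 x2 j v))%R.
  exact: meanD.
rewrite S2 S3; congr (_ + _)%R; apply: eq_bigr => i _.
  rewrite (S1 i).2; apply: eq_bigr => j _; rewrite meanZ ?(pairE i j).2//.
  exact: (pairE i j).1.
by rewrite meanZ ?(resE i).2//; exact: (resE i).1.
Qed.

Lemma mean_first k : mean (fun v => tnth v k) = 0%R.
Proof.
have [oth othP] := other_index hN.
exact: (first_moment0 P20 Q10 (weights_sum hN la0 mu0) moments_stationary (othP k)).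
Qed.

Lemma mean_second k l : (mean (fun v => tnth v k * tnth v l) = if k == l then K else 0)%R.
Proof.
have [oth othP] := other_index hN.
have [<-|kl] := eqVneq k l.
  exact: (second_moment P20 Q10 (weights_sum hN la0 mu0) moments_stationary othP).
exact: (cross_moment0 P20 Q10 (weights_sum hN la0 mu0) moments_stationary kl).
Qed.
End density_moments.

(** * Steady states *)

Section lebesgue_on_tuples.
Context (R : realType) (n : nat).
Local Open Scope ereal_scope.

Lemma ae_RnP (P : n.-tuple R -> Prop) : ae_Rn P <-> {ae lebn R n, forall v, P v}.
Proof.
have nullE (A : set (n.-tuple R)) : measurable A ->
    iint (fun v : n.-tuple R => (\1_A v)%:E) = (lebn R n : {measure set _ -> \bar R}) A.
  by move=> mA; rewrite -lebnE ?integral_indic ?setIT//; exact: nnm_indic.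
split=> [[A [[mA A0] AP]]|[A [mA A0 AP]]].
  exists A; split => //; first by rewrite -nullE.
  by move=> v /= nP; apply: contrapT => /AP.
exists A; split; first by split => //; rewrite nullE.
by move=> v nA; apply: contrapT => nP; apply: nA; exact: AP.
Qed.

Lemma integral_Rn_mean (F p : n.-tuple R -> R) : measurable_fun setT p ->
  measurable_fun setT F -> has_mean F p ->
  integrable_Rn (fun v => p v * F v)%R /\ integral_Rn (fun v => p v * F v)%R = mean F p.
Proof.
move=> mp mF hp; have mpF := measurable_funM mp mF.
split.
  split => //; rewrite -lebnE; first by have /integrableP[] := hp.
  by apply: nnm_EFin => //; exact: measurableT_comp.
have [P [Q [HP HQ HPQ]]] := integral_posneg hp.
rewrite /integral_Rn /mean HPQ -!lebnE ?HP ?HQ//.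
  by apply: nnm_pos; exact: measurableT_comp.
exact: (nnm_pos mpF).
Qed.
End lebesgue_on_tuples.

(** * From the collision operator to the master equation *)

Section steady_states.
Context (R : realType) (N : nat).
Local Open Scope ereal_scope.
Notation lam := (@lebesgue_measure R).
Notation RR := (measurableTypeR R).
Variables (la mu : R) (g : R -> R) (K : R).
Hypotheses (hN : (2 <= N)%N) (la0 : (0 < la)%R) (mu0 : (0 < mu)%R).
Hypotheses (g_meas : measurable_fun setT g) (g_ge0 : forall w, (0 <= g w)%R).
Hypothesis g_mass : \int[lam]_w (g w)%:E = 1.
Hypothesis g_K : \int[lam]_w (w ^+ 2 * g w)%:E = K%:E.
Notation m := (lebn R N).
Implicit Types F G : N.-tuple R -> R.
Notation A F := (Aop la mu g (fun v : N.-tuple R => (F v)%:E)).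

Let N0 : (0 < N%:R :> R)%R. Proof. by rewrite ltr0n; case: (N) hN. Qed.
Let C0 : (0 < 'C(N, 2)%:R :> R)%R. Proof. by rewrite ltr0n bin_gt0. Qed.
Let pi0 : (0 < pi :> R)%R. Proof. exact: pi_gt0. Qed.

Lemma kresE (j : 'I_N) F v : measurable_fun setT F -> (forall v, (0 <= F v)%R) ->
  Rop g j F v = ((2 * pi)^-1 * fine (kres g j (fun v => (F v)%:E) v))%R.
Proof.
move=> mF F0; have nF := nnm_EFin mF F0; have nG := nnm_gtimes g_meas g_ge0 nF.
have p0 : (0 <= (2 * pi)^-1 :> R)%R by rewrite invr_ge0 mulr_ge0// ltW.
rewrite /Rop (_ : \int[lam]_w _ = (2 * pi)^-1%:E * kres g j (fun v => (F v)%:E) v).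
  (* When the integral is infinite, [fine] returns 0 on both sides. *)
  by case: (kres _ _ _ _) => [r||]; rewrite //= ?mulr0// mulr_infty/= ?gtr0_sg ?mul1e ?invr_gt0 ?mulr_gt0//= mulr0.
rewrite /kres -nnm_integralZ ?lee_fin//; last first.
  exact: (nnm_pair2 v (nnm_cons_pair (nnm_kpair (lift ord0 j) ord0 nG))).
apply: eq_integral => w _; rewrite /kpair -ge0_integralZl_EFin//.
- apply: eq_integral => th _; rewrite /gtimes -!EFinM; congr (_ * (g _ * F _))%:E.
    rewrite /thead /rot_pair tnth_mktuple (negbTE (neq_lift _ _)) eqxx tnthS tnth0.
    by rewrite /wstar mulNr addrC.
  apply: eq_from_tnth => k; rewrite tnth_mktuple.
  transitivity (tnth (rot_pair (lift ord0 j) ord0 th (cons_tuple w v)) (lift ord0 k)).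
    rewrite tnth_mktuple (inj_eq lift_inj) !tnthS tnth0.
    by rewrite [lift _ _ == ord0]eq_sym (negbTE (neq_lift _ _)).
  by rewrite [in LHS](tuple_eta (rot_pair _ _ _ _)) tnthS.
- exact: measurable_angles.
- by move=> th _; exact: nG.2.
- have nP := nnm_pair2 (cons_tuple w v) (nnm_rot_pair (lift ord0 j) ord0 nG).
  exact: measurable_funS nP.1.
Qed.

Lemma fin_num_sum_ge0 (I : finType) (P : pred I) (x : I -> \bar R) :
  (forall i, 0 <= x i) -> \sum_(i | P i) x i \is a fin_num ->
  forall i, P i -> x i \is a fin_num.
Proof.
move=> x0 sf i Pi; rewrite ge0_fin_numE//.
apply: (@le_lt_trans _ _ (\sum_(i | P i) x i)); last by rewrite ltey_eq sf.
by rewrite (bigD1 i)//= leeDl// sume_ge0.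
Qed.

(** Where an integral diverges, [Qop] and [Rop] fall back on the value 0 while [Aop] is infinite. If
    the sum defining [Aop] is finite, so is each of its nonnegative terms, and the two sides
    agree. *)
Lemma Lop_Aop F v : measurable_fun setT F -> (forall v, (0 <= F v)%R) ->
  A F v \is a fin_num ->
  Lop la mu g F v = ((la + mu) * N%:R * (fine (A F v) - F v))%R.
Proof.
move=> mF F0; have nF := nnm_EFin mF F0.
have pw0 := pair_weight_gt0 hN la0 mu0.
have rw0 := res_weight_gt0 hN la0 mu0.
pose a i j := kpair i j (fun v => (F v)%:E) v.
pose r j := kres g j (fun v => (F v)%:E) v.
have a0 i j : 0 <= a i j by exact: (nnm_kpair i j nF).2.
have r0 j : 0 <= r j by exact: (nnm_kres g_meas g_ge0 j nF).2.
have pa0 i j : 0 <= (pair_weight N la mu)%:E * a i j by rewrite mule_ge0// lee_fin ltW.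
have rr0 j : 0 <= (res_weight N la mu)%:E * r j by rewrite mule_ge0// lee_fin ltW.
have fin_mul (c : R) (x : \bar R) : (0 < c)%R -> c%:E * x \is a fin_num -> x \is a fin_num.
  by move=> c0; case: x => [//||]; rewrite mulr_infty gtr0_sg// mul1e.
have s0 (i : 'I_N) : 0 <= \sum_(j < N | (i < j)%N) (pair_weight N la mu)%:E * a i j by exact: sume_ge0.
have AE : A F v = \sum_(i < N) \sum_(j < N | (i < j)%N) (pair_weight N la mu)%:E * a i j
  + \sum_(j < N) (res_weight N la mu)%:E * r j by [].
rewrite AE fin_numD => /andP[sA sR].
have fa (i j : 'I_N) : (i < j)%N -> a i j \is a fin_num.
  move=> ij; apply: (fin_mul _ _ pw0).
  exact: (fin_num_sum_ge0 (pa0 i) (fin_num_sum_ge0 s0 sA isT) ij).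
have fr j : r j \is a fin_num by exact: (fin_mul _ _ rw0 (fin_num_sum_ge0 rr0 sR isT)).
pose S := (\sum_(i < N) \sum_(j < N | (i < j)%N) fine (a i j))%R.
pose T := (\sum_(j < N) fine (r j))%R.
have -> : \sum_(i < N) \sum_(j < N | (i < j)%N) (pair_weight N la mu)%:E * a i j
    = (pair_weight N la mu * S)%:E.
  rewrite mulr_sumr -sumEFin; apply: eq_bigr => i _.
  rewrite mulr_sumr -sumEFin; apply: eq_bigr => j ij.
  by rewrite -{1}(fineK (fa i j ij)).
have -> : \sum_(j < N) (res_weight N la mu)%:E * r j = (res_weight N la mu * T)%:E.
  by rewrite mulr_sumr -sumEFin; apply: eq_bigr => j _; rewrite -{1}(fineK (fr j)).
have QE : Qop F v = (('C(N, 2)%:R)^-1 * ((2 * pi)^-1 * S))%R.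
  rewrite /Qop; congr (_ * _)%R; rewrite [RHS]mulr_sumr; apply: eq_bigr => i _.
  by rewrite [RHS]mulr_sumr.
have RE : (\sum_(j < N) (F v - Rop g j F v) = N%:R * F v - (2 * pi)^-1 * T)%R.
  rewrite sumrB sumr_const card_ord mulr_natl mulr_sumr; congr (_ - _)%R.
  by apply: eq_bigr => j _; rewrite kresE.
rewrite /Lop QE RE /= /pair_weight /res_weight.
have l0 := addr_gt0 la0 mu0; move: pi0; generalize (pi : R) => p p0; field.
by rewrite !gt_eqF.
Qed.

(** [Aop F] has the mass of [F], so it is finite almost everywhere and the pointwise formula for
    [Lop] holds outside a null set. *)
Lemma steady_stateP F : is_densityN F ->
  ae_Rn (fun v => Lop la mu g F v = 0%R) <-> {ae m, forall v, A F v = (F v)%:E}.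
Proof.
move=> [mF F0 F1]; have nF := nnm_EFin mF F0.
have [nA _ _] := dual_pair_op hN la0 mu0 g_meas g_ge0.
have fA : {ae m, forall v, A F v \is a fin_num}.
  apply: nnm_ae_fin; first exact: nA.
  rewrite (mass_preserving_op hN la0 mu0 g_meas g_ge0 g_mass g_K nF) lebnE//.
  by rewrite F1 ltry.
have W0 : ((la + mu) * N%:R != 0 :> R)%R by rewrite gt_eqF// mulr_gt0// addr_gt0.
rewrite ae_RnP; split=> H.
  apply: filterS2 fA H => v fv; rewrite Lop_Aop// => /eqP.
  by rewrite mulf_eq0 (negbTE W0)/= subr_eq0 => /eqP <-; rewrite fineK.
by apply: filterS2 fA H => v fv Av; rewrite Lop_Aop// Av /= subrr mulr0.
Qed.

Lemma steady_state_exists : exists F, [/\ steady_state la mu g F,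
  \int[m]_v (F v)%:E = 1, \int[m]_v ((energy v)%:E * (F v)%:E) < +oo &
  {ae m, forall v, A F v = (F v)%:E}].
Proof.
have [nA nB dual] := dual_pair_op hN la0 mu0 g_meas g_ge0.
have [f [nf f1 Vf Af]] := op_exists hN la0 mu0 g_meas g_ge0 g_mass g_K.
have foo : \int[m]_v f v < +oo by rewrite f1 ltry.
(* The invariant density takes extended values; its real version differs from it on a null set only,
   and the operator does not see the difference. *)
pose F v := fine (f v).
have mF : measurable_fun setT F.
  by apply: (measurableT_comp _ nf.1); exact: fine_measurable.
have F0 v : (0 <= F v)%R by apply: fine_ge0; exact: nf.2.
have nF := nnm_EFin mF F0.
have fF : {ae m, forall v, f v = (F v)%:E}.
  by apply: filterS (nnm_ae_fin nf foo) => v fv; rewrite fineK.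
have F1 : \int[m]_v (F v)%:E = 1 by rewrite -f1; apply: nnm_ae_eq_integral => //; apply: filterS fF.
have AF : {ae m, forall v, A F v = (F v)%:E}.
  have AfF := dual_pair_ae (dual_pair_op hN la0 mu0 g_meas g_ge0)
    (mass_preserving_op hN la0 mu0 g_meas g_ge0 g_mass g_K) nf nF foo fF.
  by apply: filterS3 AfF Af fF => v <- -> ->.
have dF : is_densityN F by split => //; rewrite -lebnE.
exists F; split => //; first by split => //; exact/steady_stateP.
rewrite (_ : \int[m]_v _ = \int[m]_v ((energy v)%:E * f v))//.
have nE := nnm_energy R N; apply: nnm_ae_eq_integral; [exact: nnmM|exact: nnmM|].
by apply: filterS fF => v ->.
Qed.

Lemma steady_state_unique F G : steady_state la mu g F -> steady_state la mu g G ->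
  ae_Rn (fun v => G v = F v).
Proof.
move=> [dF LF] [dG LG]; apply/ae_RnP.
have key H : is_densityN H -> ae_Rn (fun v => Lop la mu g H v = 0%R) ->
    [/\ nnm (fun v : N.-tuple R => (H v)%:E), \int[m]_v (H v)%:E = 1 &
    {ae m, forall v, iter N (Aop la mu g) (fun v => (H v)%:E) v = (H v)%:E}].
  move=> dH; have [mH H0 H1] := dH; have nH := nnm_EFin mH H0.
  have mass : \int[m]_v (H v)%:E = 1 by rewrite lebnE.
  move=> /(steady_stateP dH) AH; split => //.
  by apply: (op_iter_invariant hN la0 mu0 g_meas g_ge0 g_mass g_K) => //; rewrite mass ltry.
have [nF F1 AF] := key F dF LF; have [nG G1 AG] := key G dG LG.
have := op_unique hN la0 mu0 g_meas g_ge0 g_mass g_K nG nF G1 F1 AG AF.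
by apply: filterS => v [].
Qed.
End steady_states.

Theorem theorem1 (R : realType) (N : nat) (hN : (2 <= N)%N)
  (lam mu : R) (hlam : 0 < lam) (hmu : 0 < mu) (g : R -> R)
  (g_meas : measurable_fun setT g) (g_ge0 : forall w, 0 <= g w)
  (g_mass : (\int[@lebesgue_measure R]_w (g w)%:E = 1)%E)
  (g_L2 : (@lebesgue_measure R).-integrable setT (fun w => (g w ^+ 2)%:E))
  (g_m1 : (@lebesgue_measure R).-integrable setT (fun w => (w * g w)%:E))
  (g_mean0 : (\int[@lebesgue_measure R]_w (w * g w)%:E = 0)%E)
  (g_m2 : (@lebesgue_measure R).-integrable setT (fun w => (w ^+ 2 * g w)%:E)) :
  exists F : N.-tuple R -> R,
    [/\ steady_state lam mu g F,
        (forall G : N.-tuple R -> R, steady_state lam mu g G ->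
           ae_Rn (fun v => G v = F v)),
        (forall i : 'I_N,
           integrable_Rn (fun v => tnth v i * F v) /\
           integral_Rn (fun v => tnth v i * F v) = integral_Rn (fun v => tnth v i * gtensor g v))
      & (forall i j : 'I_N,
           integrable_Rn (fun v => tnth v i * tnth v j * F v) /\
           integral_Rn (fun v => tnth v i * tnth v j * F v)
             = integral_Rn (fun v => tnth v i * tnth v j * gtensor g v))].
Proof.
set K := fine (\int[@lebesgue_measure R]_w (w ^+ 2 * g w)%:E)%E.
have g_K : (\int[@lebesgue_measure R]_w (w ^+ 2 * g w)%:E = K%:E)%E.
  by rewrite fineK//; exact: integrable_fin_num g_m2.
have [F [sF F1 VF AF]] := steady_state_exists hN hlam hmu g_meas g_ge0 g_mass g_K.
have [[mF F0 _] _] := sF.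
exists F; split => // [G sG|i|i j].
- exact: (steady_state_unique hN hlam hmu g_meas g_ge0 g_mass g_K sF sG).
- have [|hi ->] := integral_Rn_mean _ mF (has_mean1 mF F0 F1 VF i).
    exact: measurable_tnth.
  split => //; rewrite (gtensor_moment1 g_meas g_ge0 g_mass g_m1 g_mean0 g_K).
  exact: (mean_first hN hlam hmu g_meas g_ge0 g_mass g_K mF F0 F1 VF AF).
- have [|hij ->] := integral_Rn_mean _ mF (has_mean2 mF F0 F1 VF i j).
    by apply: measurable_funM; exact: measurable_tnth.
  split => //; rewrite (gtensor_moment2 g_meas g_ge0 g_mass g_m1 g_mean0 g_K).
  exact: (mean_second hN hlam hmu g_meas g_ge0 g_mass g_K mF F0 F1 VF AF).
Qed.
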